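(* Let $n\ge 1$. The group $UR_n=\pi_1\,\mathcal{UR}_n$ has a presentation with generators $\sigma_i$ and $\rho_i$ for $i=1,\dots,n-1$ and the following relations (for all indices for which the symbols are defined): \begin{itemize} \item $[\rho_i,\rho_j]=[\sigma_i,\sigma_j]=[\rho_i,\sigma_j]=1$ if $|i-j|>1$; \item $\rho_i\rho_{i+1}\rho_i=\rho_{i+1}\rho_i\rho_{i+1}$ and $\sigma_i\sigma_{i+1}\sigma_i=\sigma_{i+1}\sigma_i\sigma_{i+1}$; \item $\rho_i\sigma_{i+1}\sigma_i=\sigma_{i+1}\sigma_i\rho_{i+1}$, $\ \sigma_i\sigma_{i+1}\rho_i=\rho_{i+1}\sigma_i\sigma_{i+1}$, and $\ \sigma_i\rho_{i+1}\rho_i=\rho_{i+1}\rho_i\sigma_{i+1}$; \item $\sigma_i^2=1$. \end{itemize}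
   Context: A ring is a Euclidean (round) circle in $\mathbb R^3$. $\mathcal{UR}_n$ is the space of unordered configurations of $n$ disjoint, pairwise unlinked rings in $\mathbb R^3$ all lying in planes perpendicular to the $x$-axis (parallel to the $yz$-plane), topologized by centers and radii; it is path-connected. Products of loops are composed from left to right. Take as basepoint a configuration in which the $i$th ring has radius $1$ and center $(4i,0,0)$, $i=1,\dots,n$ (the subspace of configurations whose rings lie in distinct planes is contractible). For $1\le i\le n-1$, $\rho_i$ and $\sigma_i$ are represented by loops in $\mathcal{UR}_n$ in which all rings other than the $i$th and $(i+1)$st are fixed and the $i$th and $(i+1)$st rings exchange places, their planes coinciding at exactly one moment and not coinciding with the planes of other rings. For $\rho_i$, at that moment the $i$th ring (the one moving in the positive $x$-direction) is nested inside the $(i+1)$st, so it passes through the $(i+1)$st ring. For $\sigma_i$, at that moment the two rings are not nested and the $i$th ring lies on the side of larger $y$-coordinate, so it passes around the $(i+1)$st ring. *)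

(* Defs.v *)
From HB Require Import structures.
From mathcomp Require Import all_boot all_order all_algebra perm.
From mathcomp Require Import all_classical all_reals all_analysis.
From mathcomp Require Import wedge_sigT continuous_path.
From mathcomp Require Import lra.

Set Implicit Arguments.
Unset Strict Implicit.
Unset Printing Implicit Defensive.
Set SsrOldRewriteGoalsOrder.

Import Order.TTheory GRing.Theory Num.Theory.
Import numFieldNormedType.Exports.

Local Open Scope classical_set_scope.
Local Open Scope ring_scope.

Section pasting.
Context {R : realType} {Z X : topologicalType}.

Lemma pasting (h : Z -> R) (c : R) (f g : Z -> X) :
  continuous h -> continuous f -> continuous g ->
  (forall z, h z = c -> f z = g z) ->
  continuous (fun z => if h z <= c then f z else g z).
Proof.
move=> ch cf cg fg; set k := fun z => _.
suff kc z U : nbhs (k z) U -> nbhs z (k @^-1` U) by move=> z U; exact: kc.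
rewrite {1}/k; have [hz|hz|hz] := ltgtP (h z) c => hU.
- have fU : nbhs z (f @^-1` U) by exact: cf.
  have hc : nbhs z [set y | h y < c] by apply: (ch z [set x | x < c]); apply: open_nbhs_nbhs; split; [exact: open_lt|].
  by apply: filterS (filterI fU hc) => y; rewrite /k /= => -[Uy /ltW ->].
- have gU : nbhs z (g @^-1` U) by exact: cg.
  have hc : nbhs z [set y | c < h y] by apply: (ch z [set x | c < x]); apply: open_nbhs_nbhs; split; [exact: open_gt|].
  by apply: filterS (filterI gU hc) => y; rewrite /k /= => -[Uy hy]; rewrite leNgt hy.
- have fU : nbhs z (f @^-1` U) by exact: cf.
  have gU : nbhs z (g @^-1` U) by apply: cg; rewrite -(fg _ hz).
  apply: filterS (filterI fU gU) => y; rewrite /k /= => -[Ufy Ugy].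
  by case: ifP.
Qed.

End pasting.

Definition unit_interval (R : realType) : Type := `[0%R : R, 1%R]%classic.

Section unit_interval.
Context {R : realType}.
Local Notation I := (unit_interval R).

HB.instance Definition _ := Topological.copy I (set_type `[0%R : R, 1%R]%classic).

Definition Ival (t : I) : R := set_val t.

Lemma Ival_itv t : 0 <= Ival t <= 1.
Proof.
by case: t => t; rewrite /Ival set_valE /= inE /= in_itv.
Qed.

Fact clip_subproof (r : R) :
  Num.max 0 (Num.min r 1) \in (`[0%R : R, 1%R]%classic).
Proof. by rewrite inE /= in_itv /= le_max lexx /= ge_max ler01 ge_min lexx orbT. Qed.

(* The retraction of the real line onto the unit interval. *)
Definition clip (r : R) : I := 
  @exist R (fun x => x \in `[0%R : R, 1%R]%classic) _ (clip_subproof r).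

Lemma IvalK : cancel Ival clip.
Proof.
move=> t; apply: val_inj => /=.
have /andP[t0 t1] := Ival_itv t; rewrite /Ival set_valE in t0 t1.
by rewrite /Ival set_valE /= (min_idPl t1) (max_idPr t0).
Qed.

Lemma clipE r : Ival (clip r) = Num.max 0 (Num.min r 1).
Proof. by rewrite /Ival set_valE. Qed.

Lemma clipK r : 0 <= r <= 1 -> Ival (clip r) = r.
Proof. by move=> /andP[r0 r1]; rewrite clipE (min_idPl r1) (max_idPr r0). Qed.

Lemma Ival_continuous : continuous Ival.
Proof. exact: initial_continuous. Qed.

Lemma clip_continuous : continuous clip.
Proof.
have E : Ival \o clip = cst 0 \max (fun x : R => Num.min x 1).
  by apply/funext => x; rewrite /= clipE.
suff c : continuous (Ival \o clip) by exact: (continuous_comp_initial c).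
rewrite E => r; apply: continuous_max; first exact: cvg_cst.
by apply: (@continuous_min _ _ id (cst 1)); [exact: cvg_id|exact: cvg_cst].
Qed.

Lemma clip_le0 r : r <= 0 -> clip r = clip 0.
Proof.
move=> r0; apply: val_inj => /=.
by rewrite (min_idPl (le_trans r0 ler01)) (min_idPl ler01) (max_idPl r0) maxxx.
Qed.

Lemma clip_ge1 r : 1 <= r -> clip r = clip 1.
Proof. by move=> r1; apply: val_inj => /=; rewrite (min_idPr r1) minxx. Qed.

Fact clip0_neq_clip1 : clip 0 != clip 1.
Proof.
apply/eqP => /(congr1 Ival); rewrite !clipK ?lexx ?ler01// => /eqP.
by rewrite eq_sym oner_eq0.
Qed.

HB.instance Definition _ := isBiPointed.Build I clip0_neq_clip1.

Lemma Ival0 : Ival zero = 0.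
Proof. by rewrite clipK ?lexx ?ler01. Qed.

Lemma Ival1 : Ival one = 1.
Proof. by rewrite clipK ?lexx ?ler01. Qed.

End unit_interval.

Section loops.
Context {R : realType} {X : topologicalType} (x0 : X).
Local Notation I := (unit_interval R).
Local Notation loop := {path I from x0 to x0 in X}.
Implicit Types p q r : loop.

Definition loop_homotopic p q := exists H : I * I -> X,
  [/\ continuous H,
      forall t, H (zero, t) = p t,
      forall t, H (one, t) = q t,
      forall s, H (s, zero) = x0 &
      forall s, H (s, one) = x0].

Definition const_loop : loop := cst x0.

Lemma affine_continuous (T : topologicalType) (f : T -> I) (a b : R) :
  continuous f -> continuous (fun t => a * Ival (f t) + b).
Proof.
move=> cf t; apply: cvgD; last exact: cvg_cst.
apply: cvgM; first exact: cvg_cst.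
by apply: continuous_comp; [exact: cf|exact: Ival_continuous].
Qed.

Lemma clip_comp_continuous (T : topologicalType) (f : T -> R) :
  continuous f -> continuous (fun t => clip (f t)).
Proof.
by move=> cf t; apply: continuous_comp; [exact: cf|exact: clip_continuous].
Qed.

Lemma path_comp_continuous (T : topologicalType) p (f : T -> R) :
  continuous f -> continuous (fun t => p (clip (f t))).
Proof.
move=> cf t.
apply: (@continuous_comp _ _ _ (fun t => clip (f t)) p); last exact: cts_fun.
exact: clip_comp_continuous.
Qed.

Lemma pair_continuous (T U V : topologicalType) (f : T -> U) (g : T -> V) :
  continuous f -> continuous g -> continuous (fun t => (f t, g t)).
Proof. by move=> cf cg t; apply: cvg_pair; [exact: cf|exact: cg]. Qed.

Lemma fst_continuous (T U : topologicalType) : continuous (@fst T U).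
Proof. by move=> t; exact: cvg_fst. Qed.

Lemma snd_continuous (T U : topologicalType) : continuous (@snd T U).
Proof. by move=> t; exact: cvg_snd. Qed.

Definition inv_fun p (t : I) : X := p (clip (-1 * Ival t + 1)).

Fact inv_fun_continuous p : continuous (inv_fun p).
Proof. by apply/path_comp_continuous/affine_continuous => t; exact: cvg_id. Qed.

Fact inv_fun0 p : inv_fun p zero = x0.
Proof. by rewrite /inv_fun Ival0 mulr0 add0r path_one. Qed.

Fact inv_fun1 p : inv_fun p one = x0.
Proof. by rewrite /inv_fun Ival1 mulr1 addNr path_zero. Qed.

Definition inv_loop p : loop :=
  mk_path (@inv_fun_continuous p) (inv_fun0 p) (inv_fun1 p).

(* First [p], then [q]. *)
Definition concat_fun p q (t : I) : X :=
  if Ival t <= 2^-1 then p (clip (2 * Ival t)) else q (clip (2 * Ival t - 1)).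

Fact concat_fun_continuous p q : continuous (concat_fun p q).
Proof.
apply: pasting; first exact: Ival_continuous.
- apply/path_comp_continuous; rewrite (_ : (fun _ => _) =
    (fun t => 2 * @Ival R t + 0)); last by apply/funext => t; rewrite addr0.
  by apply: affine_continuous => t; exact: cvg_id.
- by apply/path_comp_continuous/affine_continuous => t; exact: cvg_id.
- by move=> t ->; rewrite divff// subrr path_one path_zero.
Qed.

Fact concat_fun0 p q : concat_fun p q zero = x0.
Proof. by rewrite /concat_fun Ival0 invr_ge0 ler0n mulr0 path_zero. Qed.

Fact concat_fun1 p q : concat_fun p q one = x0.
Proof.
rewrite /concat_fun Ival1 leNgt invf_lt1 ?ltr0n// ltr1n /= mulr1.
by rewrite (_ : 2 - 1 = 1) ?path_one//; lra.
Qed.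

Definition concat p q : loop :=
  mk_path (@concat_fun_continuous p q) (concat_fun0 p q) (concat_fun1 p q).

Lemma concatE p q t : concat p q t =
  if Ival t <= 2^-1 then p (clip (2 * Ival t)) else q (clip (2 * Ival t - 1)).
Proof. by []. Qed.

Lemma inv_loopE p t : inv_loop p t = p (clip (1 - Ival t)).
Proof. by rewrite /inv_loop /= /mk_path /inv_fun mulN1r addrC. Qed.

Lemma loop_homotopic_refl p : loop_homotopic p p.
Proof.
exists (p \o snd); split=> [|//|//|s|s] /=; rewrite ?path_zero ?path_one//.
by move=> t; apply: continuous_comp; [exact: snd_continuous|exact: cts_fun].
Qed.

Lemma loop_homotopic_sym p q : loop_homotopic p q -> loop_homotopic q p.
Proof.
move=> [H [cH H0 H1 Hz Ho]].
exists (fun u => H (clip (-1 * Ival u.1 + 1), u.2)); split.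
- move=> u; apply: (@continuous_comp _ _ _ _ H); last exact: cH.
  apply: pair_continuous; last exact: snd_continuous.
  by apply/clip_comp_continuous/affine_continuous; exact: fst_continuous.
- by move=> t; rewrite /= Ival0 mulr0 add0r -H1.
- by move=> t; rewrite /= Ival1 mulr1 addNr -H0.
- by move=> s; rewrite /= Hz.
- by move=> s; rewrite /= Ho.
Qed.

Lemma loop_homotopic_trans q p r :
  loop_homotopic p q -> loop_homotopic q r -> loop_homotopic p r.
Proof.
move=> [H [cH H0 H1 Hz Ho]] [K [cK K0 K1 Kz Ko]].
exists (fun u => if Ival u.1 <= 2^-1 then H (clip (2 * Ival u.1 + 0), u.2)
                 else K (clip (2 * Ival u.1 - 1), u.2)); split.
- apply: (@pasting _ _ _ (fun u : I * I => Ival u.1)).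
  + move=> u; apply: continuous_comp; last exact: Ival_continuous.
    exact: fst_continuous.
  + move=> u; apply: (@continuous_comp _ _ _ _ H); last exact: cH.
    apply: pair_continuous; last exact: snd_continuous.
    by apply/clip_comp_continuous/affine_continuous; exact: fst_continuous.
  + move=> u; apply: (@continuous_comp _ _ _ _ K); last exact: cK.
    apply: pair_continuous; last exact: snd_continuous.
    by apply/clip_comp_continuous/affine_continuous; exact: fst_continuous.
  + by move=> u ->; rewrite divff// subrr addr0 H1 K0.
- by move=> t; rewrite /= Ival0 invr_ge0 ler0n mulr0 addr0 H0.
- move=> t; rewrite /= Ival1 leNgt invf_lt1 ?ltr0n// ltr1n /= mulr1.
  by rewrite (_ : 2 - 1 = 1) ?K1//; lra.
- by move=> s /=; case: ifP; rewrite ?Hz ?Kz.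
- by move=> s /=; case: ifP; rewrite ?Ho ?Ko.
Qed.

Lemma concat_homotopic p p' q q' : loop_homotopic p p' ->
  loop_homotopic q q' -> loop_homotopic (concat p q) (concat p' q').
Proof.
move=> [H [cH H0 H1 Hz Ho]] [K [cK K0 K1 Kz Ko]].
exists (fun u => if Ival u.2 <= 2^-1 then H (u.1, clip (2 * Ival u.2 + 0))
                 else K (u.1, clip (2 * Ival u.2 - 1))); split.
- apply: (@pasting _ _ _ (fun u : I * I => Ival u.2)).
  + move=> u; apply: continuous_comp; last exact: Ival_continuous.
    exact: snd_continuous.
  + move=> u; apply: (@continuous_comp _ _ _ _ H); last exact: cH.
    apply: pair_continuous; first exact: fst_continuous.
    by apply/clip_comp_continuous/affine_continuous; exact: snd_continuous.
  + move=> u; apply: (@continuous_comp _ _ _ _ K); last exact: cK.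
    apply: pair_continuous; first exact: fst_continuous.
    by apply/clip_comp_continuous/affine_continuous; exact: snd_continuous.
  + by move=> u ->; rewrite divff// subrr addr0 Ho Kz.
- by move=> t; rewrite concatE /= addr0 H0 K0.
- by move=> t; rewrite concatE /= addr0 H1 K1.
- by move=> s /=; rewrite Ival0 invr_ge0 ler0n mulr0 addr0 Hz.
- move=> s /=; rewrite Ival1 leNgt invf_lt1 ?ltr0n// ltr1n /= mulr1.
  by rewrite (_ : 2 - 1 = 1) ?Ko//; lra.
Qed.

Lemma inv_homotopic p q :
  loop_homotopic p q -> loop_homotopic (inv_loop p) (inv_loop q).
Proof.
move=> [H [cH H0 H1 Hz Ho]].
exists (fun u => H (u.1, clip (-1 * Ival u.2 + 1))); split.
- move=> u; apply: (@continuous_comp _ _ _ _ H); last exact: cH.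
  apply: pair_continuous; first exact: fst_continuous.
  by apply/clip_comp_continuous/affine_continuous; exact: snd_continuous.
- by move=> t; rewrite inv_loopE /= H0 mulN1r addrC.
- by move=> t; rewrite inv_loopE /= H1 mulN1r addrC.
- by move=> s; rewrite /= Ival0 mulr0 add0r Ho.
- by move=> s; rewrite /= Ival1 mulr1 addNr Hz.
Qed.

Lemma reparam_homotopic p (a b : loop) (f g : I -> R) :
  continuous f -> continuous g -> f zero = g zero -> f one = g one ->
  (forall t, a t = p (clip (f t))) -> (forall t, b t = p (clip (g t))) ->
  loop_homotopic a b.
Proof.
move=> cf cg fg0 fg1 af bg.
exists (fun u => p (clip ((1 - Ival u.1) * f u.2 + Ival u.1 * g u.2))); split.
- apply: path_comp_continuous => u.
  have cI : (fun u : I * I => Ival u.1) @ u --> Ival u.1.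
    apply: continuous_comp; last exact: Ival_continuous.
    exact: fst_continuous.
  have cs (h : I -> R) : continuous h -> (fun u : I * I => h u.2) @ u --> h u.2.
    by move=> ch; apply: continuous_comp; [exact: snd_continuous|exact: ch].
  apply: cvgD; apply: cvgM => //; try exact: cs.
  by apply: cvgB => //; exact: cvg_cst.
- by move=> t /=; rewrite Ival0 subr0 mul1r mul0r addr0 af.
- by move=> t /=; rewrite Ival1 subrr mul1r mul0r add0r bg.
- move=> s /=; rewrite -fg0 -mulrDl subrK mul1r -af; exact: path_zero.
- move=> s /=; rewrite -fg1 -mulrDl subrK mul1r -af; exact: path_one.
Qed.

Lemma Ival_itvP (t : I) : 0 <= Ival t /\ Ival t <= 1.
Proof. by apply/andP; exact: Ival_itv. Qed.

Let aff_cont (a b : R) : continuous (fun t : I => a * Ival t + b).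
Proof. by apply: affine_continuous => t; exact: cvg_id. Qed.

Let max_cont (f g : I -> R) : continuous f -> continuous g ->
  continuous (fun t => Num.max (f t) (g t)).
Proof. by move=> cf cg t; apply: continuous_max; [exact: cf|exact: cg]. Qed.

Let min_cont (f g : I -> R) : continuous f -> continuous g ->
  continuous (fun t => Num.min (f t) (g t)).
Proof. by move=> cf cg t; apply: continuous_min; [exact: cf|exact: cg]. Qed.

Lemma concat1l p : loop_homotopic (concat const_loop p) p.
Proof.
apply: (@reparam_homotopic p _ _
  (fun t => Num.max (0 * Ival t + 0) (2 * Ival t + -1)) (fun t => 1 * Ival t + 0)).
- exact: max_cont.
- exact: aff_cont.
- by rewrite Ival0 !mulr0 !add0r maxEle; case: leP => //; lra.
- by rewrite Ival1 !mulr1 maxEle; case: leP => //; lra.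
- move=> t; rewrite concatE mul0r addr0 maxEle; have [t0 t1] := Ival_itvP t.
  have [ht|ht] := leP (Ival t) 2^-1; last by rewrite ifT//; lra.
  case: ifPn => h; last by rewrite path_zero.
  by rewrite (_ : 2 * Ival t + -1 = 0) ?path_zero//; lra.
- by move=> t; rewrite mul1r addr0 IvalK.
Qed.

Lemma concat1r p : loop_homotopic (concat p const_loop) p.
Proof.
apply: (@reparam_homotopic p _ _
  (fun t => Num.min (2 * Ival t + 0) (0 * Ival t + 1)) (fun t => 1 * Ival t + 0)).
- exact: min_cont.
- exact: aff_cont.
- by rewrite Ival0 !mulr0 !add0r minEle; case: leP => //; lra.
- by rewrite Ival1 !mulr1 minEle; case: leP => //; lra.
- move=> t; rewrite concatE mul0r addr0 minEle; have [t0 t1] := Ival_itvP t.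
  have [ht|ht] := leP (Ival t) 2^-1; first by rewrite ifT//; lra.
  by rewrite ifF ?add0r ?path_one//; lra.
- by move=> t; rewrite mul1r addr0 IvalK.
Qed.

Lemma concatVl p : loop_homotopic (concat (inv_loop p) p) const_loop.
Proof.
apply: (@reparam_homotopic p _ _
  (fun t => Num.max (-2 * Ival t + 1) (2 * Ival t + -1)) (fun t => 0 * Ival t + 1)).
- exact: max_cont.
- exact: aff_cont.
- by rewrite Ival0 !mulr0 !add0r maxEle; case: leP => //; lra.
- by rewrite Ival1 !mulr1 maxEle; case: leP => //; lra.
- move=> t; rewrite concatE maxEle; have [t0 t1] := Ival_itvP t.
  have [ht|ht] := leP (Ival t) 2^-1; last by rewrite ifT//; lra.
  rewrite inv_loopE clipK; last by lra.
  by case: ifPn => h; congr (p (clip _)); lra.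
- by move=> t; rewrite mul0r add0r path_one.
Qed.

Lemma concatVr p : loop_homotopic (concat p (inv_loop p)) const_loop.
Proof.
apply: (@reparam_homotopic p _ _
  (fun t => Num.min (2 * Ival t + 0) (-2 * Ival t + 2)) (fun t => 0 * Ival t + 0)).
- exact: min_cont.
- exact: aff_cont.
- by rewrite Ival0 !mulr0 !add0r minEle; case: leP => //; lra.
- by rewrite Ival1 !mulr1 minEle; case: leP => //; lra.
- move=> t; rewrite concatE minEle; have [t0 t1] := Ival_itvP t.
  have [ht|ht] := leP (Ival t) 2^-1; first by rewrite ifT ?addr0//; lra.
  rewrite inv_loopE clipK; last by lra.
  by rewrite ifF; [congr (p (clip _)); lra | lra].
- by move=> t; rewrite mul0r add0r path_zero.
Qed.

Lemma concatA p q r :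
  loop_homotopic (concat p (concat q r)) (concat (concat p q) r).
Proof.
apply: (@reparam_homotopic (concat (concat p q) r) _ _
  (fun t => Num.max (2^-1 * Ival t + 0)
    (Num.max (1 * Ival t + - 4^-1) (2 * Ival t + -1)))
  (fun t => 1 * Ival t + 0)).
- by apply: max_cont; [|exact: max_cont].
- exact: aff_cont.
- by rewrite Ival0; case: (leP (1 * 0 + _)) => ?; case: leP => ?; lra.
- by rewrite Ival1; case: (leP (1 * 1 + _)) => ?; case: leP => ?; lra.
- move=> t; have [t0 t1] := Ival_itvP t; set m := Num.max _ _.
  have [ht|ht] := leP (Ival t) 2^-1.
    have -> : m = 2^-1 * Ival t.
      by rewrite /m; case: (leP (1 * _ + _)) => ?; case: leP => ?; lra.
    rewrite concatE ht concatE clipK; last by lra.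
    rewrite ifT; last by lra.
    rewrite concatE clipK; last by lra.
    by rewrite ifT; [congr (p (clip _)); lra|lra].
  rewrite concatE leNgt ht /= concatE clipK; last by lra.
  have [ht'|ht'] := leP (2 * Ival t - 1) 2^-1.
    have -> : m = Ival t - 4^-1.
      by rewrite /m; case: (leP (1 * _ + _)) => ?; case: leP => ?; lra.
    rewrite concatE clipK; last by lra.
    rewrite ifT; last by lra.
    rewrite concatE clipK; last by lra.
    have [h|h] := leP (2 * (Ival t - 4^-1)) 2^-1; last by congr (q (clip _)); lra.
    exfalso; lra.
  have -> : m = 2 * Ival t - 1.
    by rewrite /m; case: (leP (1 * _ + _)) => ?; case: leP => ?; lra.
  rewrite concatE clipK; last by lra.
  by rewrite ifF //; lra.
- by move=> t; rewrite mul1r addr0 IvalK.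
Qed.

Definition loop_homotopicb p q : bool := `[< loop_homotopic p q >].

Fact loop_homotopicb_refl : reflexive loop_homotopicb.
Proof. by move=> p; apply/asboolP; exact: loop_homotopic_refl. Qed.

Fact loop_homotopicb_sym : symmetric loop_homotopicb.
Proof.
by move=> p q; apply/asboolP/asboolP => /loop_homotopic_sym.
Qed.

Fact loop_homotopicb_trans : transitive loop_homotopicb.
Proof.
move=> q p r /asboolP pq /asboolP qr; apply/asboolP.
exact: loop_homotopic_trans qr.
Qed.

Canonical loop_homotopicb_equiv := EquivRel loop_homotopicb
  loop_homotopicb_refl loop_homotopicb_sym loop_homotopicb_trans.

End loops.

Section fundamental_group.
Local Open Scope quotient_scope.
Context (R : realType) (X : topologicalType) (x0 : X).

Definition pi1 := {eq_quot (@loop_homotopicb R X x0)}.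

HB.instance Definition _ := Choice.on pi1.
HB.instance Definition _ := EqQuotient.on pi1.

Definition loop_class (p : {path unit_interval R from x0 to x0 in X}) : pi1 :=
  \pi p.

Lemma loop_classP p q : loop_class p = loop_class q <-> loop_homotopic p q.
Proof. by rewrite /loop_class; split=> [/eqquotP/asboolP|h]; [|exact/eqquotP/asboolP]. Qed.

Lemma loop_class_repr (a : pi1) : loop_class (repr a) = a.
Proof. exact: reprK. Qed.

Definition pi1_mul (a b : pi1) := loop_class (concat (repr a) (repr b)).
Definition pi1_one := loop_class (const_loop x0).
Definition pi1_inv (a : pi1) := loop_class (inv_loop (repr a)).

Lemma repr_loop_class p : loop_homotopic (repr (loop_class p)) p.
Proof. by apply/loop_classP; rewrite loop_class_repr. Qed.

Lemma pi1_mulE p q :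
  pi1_mul (loop_class p) (loop_class q) = loop_class (concat p q).
Proof. by apply/loop_classP/concat_homotopic; exact: repr_loop_class. Qed.

Lemma pi1_invE p : pi1_inv (loop_class p) = loop_class (inv_loop p).
Proof. by apply/loop_classP/inv_homotopic; exact: repr_loop_class. Qed.

Fact pi1_mulA : associative pi1_mul.
Proof.
move=> a b c; rewrite -[a]loop_class_repr -[b]loop_class_repr.
by rewrite -[c]loop_class_repr !pi1_mulE; apply/loop_classP/concatA.
Qed.

Fact pi1_mul1 : left_id pi1_one pi1_mul.
Proof.
move=> a; rewrite -[a]loop_class_repr pi1_mulE.
by apply/loop_classP/concat1l.
Qed.

Fact pi1_mulr1 : right_id pi1_one pi1_mul.
Proof.
move=> a; rewrite -[a]loop_class_repr pi1_mulE.
by apply/loop_classP/concat1r.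
Qed.

Fact pi1_mulV : left_inverse pi1_one pi1_inv pi1_mul.
Proof.
move=> a; rewrite -[a]loop_class_repr pi1_invE pi1_mulE.
by apply/loop_classP/concatVl.
Qed.

Fact pi1_mulrV : right_inverse pi1_one pi1_inv pi1_mul.
Proof.
move=> a; rewrite -[a]loop_class_repr pi1_invE pi1_mulE.
by apply/loop_classP/concatVr.
Qed.

HB.instance Definition _ :=
  isGroup.Build pi1 pi1_mulA pi1_mul1 pi1_mulr1 pi1_mulV pi1_mulrV.

End fundamental_group.

Section presentation.
Variable S : Type.

(* A letter [(s, false)] stands for the generator [s], and [(s, true)] for its
   inverse. *)
Definition word := seq (S * bool).

Definition commw (u v : S) : word :=
  [:: (u, false); (v, false); (u, true); (v, true)].

Definition posw (s : seq S) : word := [seq (x, false) | x <- s].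

(* Equality of words in the group <S | rel>, where [rel u v] is the relation
   u = v: the least congruence containing free reduction and [rel]. *)
Inductive word_eq (rel : word -> word -> Prop) : word -> word -> Prop :=
| word_eq_refl u : word_eq rel u u
| word_eq_sym u v : word_eq rel u v -> word_eq rel v u
| word_eq_trans u v w : word_eq rel u v -> word_eq rel v w -> word_eq rel u w
| word_eq_cat u u' v v' :
    word_eq rel u u' -> word_eq rel v v' -> word_eq rel (u ++ v) (u' ++ v')
| word_eq_cancel x b : word_eq rel [:: (x, b); (x, ~~ b)] [::]
| word_eq_rel u v : rel u v -> word_eq rel u v.

Variables (G : groupType) (g : S -> G).

Definition word_val (w : word) : G :=
  (\prod_(x <- w) (if x.2 then (g x.1)^-1 else g x.1))%g.

(* The map <S | rel> -> G sending each generator [s] to [g s] is well defined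
   and injective (second clause) and surjective (first clause). *)
Definition has_presentation (rel : word -> word -> Prop) : Prop :=
  (forall a : G, exists w, word_val w = a) /\
  (forall u v, word_val u = word_val v <-> word_eq rel u v).

End presentation.

Section rings.
Local Open Scope quotient_scope.
Variable R : realType.

(* A ring in a plane perpendicular to the x-axis: its centre and its radius. *)
Local Notation ring := (R * R * R * R)%type.

Definition cx (C : ring) : R := C.1.1.1.
Definition cy (C : ring) : R := C.1.1.2.
Definition cz (C : ring) : R := C.1.2.
Definition radius (C : ring) : R := C.2.

Definition circle (C : ring) : set (R * R * R) :=
  [set p | p.1.1 = cx C /\
    (p.1.2 - cy C) ^+ 2 + (p.2 - cz C) ^+ 2 = radius C ^+ 2].

Definition inner_disc (C : ring) : set (R * R * R) :=
  [set p | p.1.1 = cx C /\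
    (p.1.2 - cy C) ^+ 2 + (p.2 - cz C) ^+ 2 < radius C ^+ 2].

Definition unit_disc : set (R * R) := [set p | p.1 ^+ 2 + p.2 ^+ 2 <= 1].
Definition unit_circle : set (R * R) := [set p | p.1 ^+ 2 + p.2 ^+ 2 = 1].

Definition spanning_disc (f : R * R -> R * R * R) (C : ring) : Prop :=
  [/\ {within unit_disc, continuous f},
      {in unit_disc &, injective f} &
      f @` unit_circle = circle C].

(* The two rings form a trivial link: they bound disjoint embedded discs. *)
Definition unlinked (C D : ring) : Prop :=
  exists f g, [/\ spanning_disc f C, spanning_disc g D &
    (f @` unit_disc) `&` (g @` unit_disc) = set0].

Definition nested (C D : ring) : Prop := circle C `<=` inner_disc D.

Variable n : nat.

(* Labelled configurations, topologized as a subspace of the n-th power of [ring],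
   that is, by centres and radii. *)
Definition ordered_rings : set 'rV[ring]_n :=
  [set c : 'rV[ring]_n | (forall i, 0 < radius (c 0 i)) /\
    forall i j, i != j ->
      circle (c 0 i) `&` circle (c 0 j) = set0 /\
      unlinked (c 0 i) (c 0 j)].

Definition ringj (c : ordered_rings) (j : 'I_n) : ring := (set_val c) ord0 j.

Definition same_rings (c d : ordered_rings) : bool :=
  [exists s : {perm 'I_n}, [forall j, ringj d j == ringj c (s j)]].

Fact same_rings_refl : reflexive same_rings.
Proof.
move=> c; apply/existsP; exists 1%g; apply/forallP => j.
by rewrite perm1.
Qed.

Fact same_rings_sym : symmetric same_rings.
Proof.
have h c d : same_rings c d -> same_rings d c.
  move=> /existsP[s /forallP cd]; apply/existsP; exists s^-1%g.
  apply/forallP => j; move/eqP: (cd (s^-1%g j)) => ->.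
  by rewrite permKV.
by move=> c d; apply/idP/idP; exact: h.
Qed.

Fact same_rings_trans : transitive same_rings.
Proof.
move=> d c e /existsP[s /forallP cd] /existsP[t /forallP de].
apply/existsP; exists (t * s)%g; apply/forallP => j.
by move/eqP: (de j) => ->; move/eqP: (cd (t j)) => ->; rewrite permM.
Qed.

Canonical same_rings_equiv := EquivRel same_rings
  same_rings_refl same_rings_sym same_rings_trans.

Definition UR : topologicalType :=
  quotient_topology {eq_quot same_rings}.

Definition unordered (c : ordered_rings) : UR := \pi_UR c.

Definition flat_disc (C : ring) (p : R * R) : R * R * R :=
  (cx C, cy C + radius C * p.1, cz C + radius C * p.2).

Lemma flat_disc_spanning (C : ring) :
  0 < radius C -> spanning_disc (flat_disc C) C.
Proof.
move=> r0; have rn0 : radius C != 0 by rewrite gt_eqF.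
split.
- apply: continuous_subspaceT.
  apply: pair_continuous; first apply: pair_continuous.
  + by move=> p; exact: cvg_cst.
  + move=> p; apply: cvgD; first exact: cvg_cst.
    by apply: cvgM; [exact: cvg_cst|exact: cvg_fst].
  + move=> p; apply: cvgD; first exact: cvg_cst.
    by apply: cvgM; [exact: cvg_cst|exact: cvg_snd].
- move=> p q _ _; rewrite /flat_disc => pq.
  have e1 : radius C * p.1 = radius C * q.1.
    by apply: (addrI (cy C)); exact: (congr1 (fun u : R * R * R => u.1.2) pq).
  have e2 : radius C * p.2 = radius C * q.2.
    by apply: (addrI (cz C)); exact: (congr1 (fun u : R * R * R => u.2) pq).
  rewrite (surjective_pairing p) (surjective_pairing q).
  by rewrite (mulfI rn0 e1) (mulfI rn0 e2).
- apply/seteqP; split=> [_ [q uv <-]|p [xC yz]].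
    split=> //=; rewrite !(addrC (cy C)) !(addrC (cz C)) !addrK !exprMn -mulrDr.
    by rewrite [X in _ * X]uv mulr1.
  exists ((p.1.2 - cy C) / radius C, (p.2 - cz C) / radius C).
    rewrite /unit_circle /= !expr_div_n -mulrDl yz divff//.
    by rewrite expf_neq0.
  rewrite /flat_disc /= ![radius C * _]mulrC !divfK// -xC.
  by rewrite !(addrC (cy C)) !(addrC (cz C)) !subrK; case: p {xC yz} => [[]].
Qed.

(* Indices start at [0], hence the shift. *)
Definition base_ring (j : 'I_n) : ring := ((4 * j.+1)%:R, 0, 0, 1).

Fact base_subproof : (\row_j base_ring j) \in ordered_rings.
Proof.
rewrite inE; split=> [i|i j ij]; first by rewrite mxE ltr01.
rewrite !mxE.
have xij : cx (base_ring i) <> cx (base_ring j).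
  rewrite /cx /= => /eqP; rewrite eqr_nat eqn_pmul2l// eqSS => /eqP/val_inj/eqP.
  by rewrite (negPf ij).
split.
  by apply/seteqP; split=> // p [[pi _] [pj _]]; apply: xij; rewrite -pi -pj.
exists (flat_disc (base_ring i)), (flat_disc (base_ring j)).
split; try by apply: flat_disc_spanning; rewrite ltr01.
apply/seteqP; split=> // _ [[p _ <-] [q _]] [/esym xE _ _].
exact: xij.
Qed.

Definition base_ordered : ordered_rings :=
  @exist _ (fun c => c \in ordered_rings) _ base_subproof.

Definition UR_base : UR := unordered base_ordered.

Definition UR_group := pi1 R UR_base.

Local Notation I := (unit_interval R).
Local Notation loop := {path I from UR_base to UR_base in UR}.

Definition left_ring (i : 'I_n.-1) : 'I_n := widen_ord (leq_pred n) i.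

Fact right_ring_subproof (i : 'I_n.-1) : (i.+1 < n)%N.
Proof. by rewrite -ltn_predRL. Qed.

Definition right_ring (i : 'I_n.-1) : 'I_n := Ordinal (right_ring_subproof i).

(* [c] is a motion of labelled rings from the base configuration to itself,
   exchanging the [i]-th and [i+1]-st rings and fixing the others; the planes of
   the two moving rings coincide at the time [t0] only and never coincide with
   the plane of another ring. *)
Definition exchange (i : 'I_n.-1) (c : I -> ordered_rings) (t0 : I) : Prop :=
  let l := left_ring i in let r := right_ring i in
  [/\ continuous c,
      c zero = base_ordered,
      ringj (c one) l = base_ring r /\ ringj (c one) r = base_ring l,
      forall j t, j != l -> j != r ->
        [/\ ringj (c t) j = base_ring j,
            cx (ringj (c t) l) <> cx (base_ring j) &
            cx (ringj (c t) r) <> cx (base_ring j)] &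
      forall t, cx (ringj (c t) l) = cx (ringj (c t) r) <-> t = t0].

(* [p] lifts to a motion of labelled rings as above, during which the [i]-th ring
   passes through the [i+1]-st. *)
Definition rho_loop (i : 'I_n.-1) (p : loop) : Prop :=
  exists c t0, [/\ exchange i c t0, forall t, p t = unordered (c t) &
    nested (ringj (c t0) (left_ring i)) (ringj (c t0) (right_ring i))].

(* Likewise, with the [i]-th ring passing around the [i+1]-st, on the side of
   larger y-coordinate. *)
Definition sigma_loop (i : 'I_n.-1) (p : loop) : Prop :=
  exists c t0, [/\ exchange i c t0, forall t, p t = unordered (c t) &
    let C := ringj (c t0) (left_ring i) in
    let D := ringj (c t0) (right_ring i) in
    [/\ ~ nested C D, ~ nested D C & cy D < cy C]].

End rings.

Section relations.
Variable m : nat.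

Variant generator := Sigma of 'I_m | Rho of 'I_m.

Local Notation pos := (@posw generator).

Variant UR_rel : word generator -> word generator -> Prop :=
| UR_rho_rho (i j : 'I_m) : (i.+1 < j)%N || (j.+1 < i)%N ->
    UR_rel (commw (Rho i) (Rho j)) [::]
| UR_sigma_sigma (i j : 'I_m) : (i.+1 < j)%N || (j.+1 < i)%N ->
    UR_rel (commw (Sigma i) (Sigma j)) [::]
| UR_rho_sigma (i j : 'I_m) : (i.+1 < j)%N || (j.+1 < i)%N ->
    UR_rel (commw (Rho i) (Sigma j)) [::]
| UR_braid_rho (i j : 'I_m) : j = i.+1 :> nat ->
    UR_rel (pos [:: Rho i; Rho j; Rho i]) (pos [:: Rho j; Rho i; Rho j])
| UR_braid_sigma (i j : 'I_m) : j = i.+1 :> nat ->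
    UR_rel (pos [:: Sigma i; Sigma j; Sigma i]) (pos [:: Sigma j; Sigma i; Sigma j])
| UR_mixed1 (i j : 'I_m) : j = i.+1 :> nat ->
    UR_rel (pos [:: Rho i; Sigma j; Sigma i]) (pos [:: Sigma j; Sigma i; Rho j])
| UR_mixed2 (i j : 'I_m) : j = i.+1 :> nat ->
    UR_rel (pos [:: Sigma i; Sigma j; Rho i]) (pos [:: Rho j; Sigma i; Sigma j])
| UR_mixed3 (i j : 'I_m) : j = i.+1 :> nat ->
    UR_rel (pos [:: Sigma i; Rho j; Rho i]) (pos [:: Rho j; Rho i; Sigma j])
| UR_sigma_square (i : 'I_m) : UR_rel (pos [:: Sigma i; Sigma i]) [::].

End relations.

(* Main.v *)
(** Two disjoint rings are related in at least one of five ways: along the x-axis one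
    comes before or after the other, or their projections to the yz-plane are nested
    either way or separated by a line.  Each is an open and convex condition.  Hence the space of labelled
    configurations is locally convex, and straight segments between configurations
    whose pairs of rings can be related in the same way stay inside it; three such
    configurations span a triangle.

    Reading the labels along the x-axis, a segment amounts to a word in adjacent
    exchanges, the letter of each exchange being [rho], its inverse or [sigma]
    according to the nesting of the two circles.  The relations hold in the
    fundamental group because three rings with pairwise disjoint projections to the
    yz-plane may be permuted freely, so that the two ways around a hexagon agree; and
    a subdivision of a loop into short pieces shows that the exchanges generate.

    Conversely, the same words define a function of two nearby configurations with
    values in the presented group.  It is a local cocycle, since the hexagons for all
    nestings of three disjoint circles follow from the relations, so its holonomy is a
    morphism from the fundamental group to the presented group.  It sends a loop
    exchanging two neighbours to the corresponding generator, whence it is inverse to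
    the obvious map, and the class of such a loop depends only on the generator. *)

From HB Require Import structures.
From mathcomp Require Import all_boot all_order all_algebra perm.
From mathcomp Require Import all_classical all_reals all_analysis.
From mathcomp Require Import wedge_sigT continuous_path.
From mathcomp Require Import lra ring zify.
Require Import Defs.

Set Implicit Arguments.
Unset Strict Implicit.
Unset Printing Implicit Defensive.
Set SsrOldRewriteGoalsOrder.

Import Order.TTheory GRing.Theory Num.Theory.
Import numFieldNormedType.Exports.

Local Open Scope group_scope.

(** * Words of adjacent exchanges *)

(** Labels and ties are the obstacles. The space is a quotient by relabelling and planes may
    coincide, so a configuration has neither canonical labels nor a canonical order from left to
    right. The order is chosen once for each unlabelled configuration, which makes it equivariant
    under relabelling. Ties do no harm, because a configuration with ties is still joined by a
    straight segment to the strictly sorted ones of the same order. Closing every path by such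
    segments puts all straight paths into one group. The word calculus [transition] serves twice,
    with opposite logic. In the fundamental group composition is known geometrically, from filled
    triangles, and forces the class of a path to be its word ([ell_transition]). In the presented
    group the word is the definition, and composition has to be derived from the relations
    ([transition_mul]). Two exchange loops of the same type are not compared by an explicit
    homotopy: their holonomies are computed, and injectivity of the evaluation identifies their
    classes. *)

Section inversions.
Variable L : eqType.
Implicit Types (w u v p : seq L) (a b x y : L).

(** [index] sends an absent label to [size w], so every label of [w] is before every label outside
    it. *)
Definition before w a b := (index a w < index b w)%N.

(** [fr] marks the pairs that may change places; a pair in the same order in both words is not
    tested, since nothing has to exchange it. *)
Definition free_inversions (fr : rel L) w w' :=
  forall a b, a \in w -> b \in w -> before w a b -> before w' b a -> fr a b.

Lemma before_cons c w a b :
  before (c :: w) a b = (b != c) && ((a == c) || before w a b).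
Proof.
rewrite /before /= (eq_sym c a) (eq_sym c b).
by case: (b == c); case: (a == c) => //=; rewrite ltnS.
Qed.

Lemma beforexx w a : before w a a = false.
Proof. by rewrite /before ltnn. Qed.

Lemma before_neq w a b : before w a b -> a != b.
Proof. by apply: contraTneq => ->; rewrite beforexx. Qed.

Lemma before_rem w x a b : uniq w -> a != x -> b != x ->
  before (rem x w) a b = before w a b.
Proof.
move=> + ax bx; elim: w => [|c w IH] //= /andP[cw uw].
case: eqP => [->|_]; rewrite !before_cons; first by rewrite bx (negPf ax).
by rewrite IH.
Qed.

Lemma before_total w a b : a \in w -> a != b -> ~~ before w a b -> before w b a.
Proof.
move=> aw ab; rewrite /before -leqNgt leq_eqVlt => /orP[/eqP e|//].
have bw : b \in w by rewrite -index_mem e index_mem.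
by case/eqP: ab; rewrite -(nth_index a aw) -e nth_index.
Qed.

Lemma before_asym w a b : before w a b -> before w b a -> false.
Proof. by rewrite /before => /ltnW; rewrite leqNgt => /negPf ->. Qed.

Lemma before_mem w a b : before w a b -> a \in w.
Proof. by move=> h; rewrite -index_mem (leq_trans h)// index_size. Qed.

Lemma before_cat_mem u v a b : a \in u -> b \notin u -> before (u ++ v) a b.
Proof.
by move=> au bu; rewrite /before !index_cat au (negPf bu) ltn_addr ?index_mem.
Qed.

Lemma before_cat u v a b : uniq (u ++ v) -> before (u ++ v) a b =
  if b \in u then before u a b else (a \in u) || before v a b.
Proof.
elim: u => [|c u IH] //= /andP[cu uu]; rewrite before_cons !inE IH// before_cons.
by case: (b == c) => //=; case: (a == c) => //=; case: (b \in u).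
Qed.

Lemma perm_move p u x v : perm_eq (p ++ u ++ x :: v) (p ++ x :: u ++ v).
Proof. by rewrite perm_cat2l -[x :: v]cat1s -[x :: u ++ v]cat1s perm_catCA. Qed.

Lemma rem_comm w x y : rem x (rem y w) = rem y (rem x w).
Proof.
elim: w => [|c w IH] //=; case: (eqVneq c y) => [cy|cy]; case: (eqVneq c x) => [cx|cx] //=.
- by rewrite -cx -cy.
- by rewrite cy eqxx.
- by rewrite cx eqxx.
- by rewrite (negPf cy) (negPf cx) IH.
Qed.

Lemma perm_rem_cons w w' x : x \in w ->
  perm_eq (rem x w) w' = perm_eq w (x :: w').
Proof. by move=> xw; rewrite (permPl (perm_to_rem xw)) perm_cons. Qed.

Lemma perm_rem2 w w' x : x \in w -> perm_eq w w' -> perm_eq (rem x w) (rem x w').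
Proof.
move=> xw ww'; rewrite perm_rem_cons// (perm_trans ww')// perm_to_rem//.
by rewrite -(perm_mem ww').
Qed.

(** Reduces the freeness conditions in the inductions below to pairs formed by the jumping letter
    [x] and a letter of [u]. *)
Lemma before_move p u x v a b : uniq (p ++ u ++ x :: v) ->
  before (p ++ u ++ x :: v) a b -> before (p ++ x :: u ++ v) b a ->
  b = x /\ a \in u.
Proof.
move=> U; have U' : uniq (p ++ x :: u ++ v).
  by rewrite -(perm_uniq (perm_move p u x v)).
elim: p U U' => [|c p IH] /=.
  move=> U /= /andP[xN U']; rewrite before_cons => + /andP[ax].
  rewrite !before_cat// before_cons; case: eqP => [->|bx] /=.
    move: U; rewrite cat_uniq /= => /and3P[_ /norP[/negPf -> _] _] /=.
    by rewrite orbF.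
  rewrite (negPf ax) /=; case: ifP => bu; case: ifP => au //=.
  - by move=> /before_asym h /h.
  - by move=> h; move: (before_mem h); rewrite au.
  - by move=> _ h; move: (before_mem h); rewrite bu.
  - by move=> /before_asym h /h.
move=> /andP[cp U] /andP[_ U']; rewrite !before_cons.
by case: eqP => //= bc; case: eqP => //= ac; exact: IH.
Qed.

End inversions.

Section transition.
Variables (L : eqType) (Gm : groupType).
Implicit Types (w u v p : seq L) (a b x y : L) (s : nat -> L -> L -> Gm).

(* Moves [x] to the front of [w], crossing its predecessors one by one; [s o a x]
   is the cost of exchanging [a] and [x], which sit in positions [o] and [o.+1]. *)
Fixpoint front s o w x : Gm :=
  if w is a :: w' then if a == x then 1 else front s o.+1 w' x * s o a x else 1.

Fixpoint transition s o w w' : Gm :=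
  if w' is x :: w'' then front s o w x * transition s o.+1 (rem x w) w'' else 1.

Lemma front_eq s s' o w x :
  (forall i a, before w a x -> s i a x = s' i a x) ->
  front s o w x = front s' o w x.
Proof.
elim: w o => [|c w IH] o //= h; case: eqP => // /eqP cx.
rewrite h; last by rewrite before_cons eq_sym cx eqxx.
by congr (_ * _); apply: IH => i a ax; apply: h; rewrite before_cons eq_sym cx ax orbT.
Qed.

(** Bringing the letters of [w'] to the front one after the other exchanges a pair only if its order
    differs in [w] and [w'], so no other cost is read. *)
Lemma transition_eq s s' o w w' : uniq w -> perm_eq w w' ->
  (forall i a b, before w a b -> before w' b a -> s i a b = s' i a b) ->
  transition s o w w' = transition s' o w w'.
Proof.
elim: w' w o => [|x w' IH] w o uw ww' h //=.
have xw : x \in w by rewrite (perm_mem ww') inE eqxx.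
have uw' : uniq (x :: w') by rewrite -(perm_uniq ww').
congr (_ * _).
  apply: front_eq => i a ax; apply: h => //; rewrite before_cons eqxx andbT.
  exact: before_neq ax.
apply: IH; first exact: rem_uniq.
  by rewrite perm_rem_cons.
move=> i a b ab ba.
have bx : b != x.
  apply: contraTneq (before_mem ba) => ->.
  by case/andP: uw'.
have ax : a != x.
  apply: contraTneq (before_mem ab) => ->; by rewrite mem_rem_uniqF.
rewrite before_rem// in ab; apply: h => //.
by rewrite before_cons ax ba orbT.
Qed.

Lemma transition_id s o w : transition s o w w = 1.
Proof. by elim: w o => [|x w IH] o //=; rewrite eqxx mul1g IH. Qed.

Lemma transition_swap s o u a b v : uniq (u ++ a :: b :: v) ->
  transition s o (u ++ a :: b :: v) (u ++ b :: a :: v) = s (o + size u) a b.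
Proof.
elim: u o => [|c u IH] o /= /andP[cu uu].
  move: cu; rewrite inE negb_or => /andP[ab _].
  by rewrite (negPf ab) !eqxx /= eqxx !mul1g transition_id mulg1 addn0.
by rewrite eqxx mul1g IH// addSnnS.
Qed.

Section realize.
Variables (s : nat -> L -> L -> Gm) (fr : rel L) (E : seq L).
Variable ell : seq L -> seq L -> Gm.
Hypothesis uE : uniq E.
Hypothesis ell_mul : forall w1 w2 w3, perm_eq w1 E -> perm_eq w2 E ->
  perm_eq w3 E -> free_inversions fr w1 w2 -> free_inversions fr w2 w3 ->
  ell w1 w2 * ell w2 w3 = ell w1 w3.
Hypothesis ell_swap : forall u a b v, perm_eq (u ++ a :: b :: v) E -> fr a b ->
  ell (u ++ a :: b :: v) (u ++ b :: a :: v) = s (size u) a b.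

Lemma ell_id w : perm_eq w E -> ell w w = 1.
Proof.
have h v : free_inversions fr v v by move=> a b _ _ /before_asym H /H.
by move=> wE; apply: (mulgI (ell w w)); rewrite mulg1 ell_mul.
Qed.

(** The first letter of [u] is the last one to be passed: it joins the prefix while [x] crosses the
    others, as in the recursion of [front]. *)
Lemma ell_front p u x v : perm_eq (p ++ u ++ x :: v) E ->
  {in u, forall a, fr a x} ->
  ell (p ++ u ++ x :: v) (p ++ x :: u ++ v) = front s (size p) (u ++ x :: v) x.
Proof.
elim: u p => [|a u IH] p pE h /=; first by rewrite eqxx ell_id.
have U : uniq (p ++ a :: u ++ x :: v) by rewrite (perm_uniq pE).
have ax : a != x.
  move: U; rewrite cat_uniq /= => /and3P[_ _ /andP[+ _]].
  by rewrite mem_cat inE !negb_or => /and3P[].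
rewrite (negPf ax).
have E1 : perm_eq (p ++ a :: x :: u ++ v) E.
  apply: perm_trans pE; rewrite perm_sym -!(cat_rcons a); exact: perm_move.
have E2 : perm_eq (p ++ x :: a :: u ++ v) E.
  by apply: perm_trans E1; exact: (perm_move p [:: x] a (u ++ v)).
rewrite -(ell_mul _ E1 E2)//.
- rewrite (ell_swap E1) ?h ?mem_head//; congr (_ * _).
  rewrite -!(cat_rcons a) IH ?size_rcons// ?cat_rcons//.
  by move=> b bu; apply: h; rewrite inE bu orbT.
- move=> b c _ _; rewrite -!(cat_rcons a) => hb hc.
  have [] := before_move _ hb hc; first by rewrite cat_rcons.
  by move=> -> bu; apply: h; rewrite inE bu orbT.
- move=> b c _ _ hb hc.
  have := @before_move _ p [:: a] x (u ++ v) b c _ hb hc.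
  rewrite inE => -[|-> /eqP ->]; last by apply: h; rewrite mem_head.
  by rewrite (perm_uniq E1).
Qed.

(** The prefix [p] is the part already sorted; it grows by one letter at each step of the
    induction. *)
Lemma ell_transition_suffix p w w' : perm_eq (p ++ w) E -> perm_eq w w' ->
  free_inversions fr (p ++ w) (p ++ w') ->
  ell (p ++ w) (p ++ w') = transition s (size p) w w'.
Proof.
elim: w' w p => [|x w' IH] w p pE ww' h /=.
  have e : w = [::] by apply/perm_nilP.
  by subst w; rewrite ell_id.
have xw : x \in w by rewrite (perm_mem ww') inE eqxx.
have U : uniq (p ++ w) by rewrite (perm_uniq pE).
have pE' : perm_eq (p ++ x :: w') E.
  by apply: perm_trans pE; rewrite perm_cat2l perm_sym.
have U' : uniq (p ++ x :: w') by rewrite (perm_uniq pE').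
have xp : x \notin p.
  by move: U'; rewrite cat_uniq /= negb_or => /and3P[_ /andP[]].
case/splitPr: xw ww' pE h U => u v ww' pE h U.
have uv : perm_eq (u ++ v) w'.
  by rewrite -(perm_cons x) -(permPr ww') perm_sym (perm_move [::] u x v).
have xu : x \notin u.
  by move: U; rewrite !cat_uniq /= negb_or => /and3P[_ _ /and3P[_ /andP[]]].
have rm : rem x (u ++ x :: v) = u ++ v.
  elim: (u) xu => /= [|c u' IHu]; first by rewrite eqxx.
  by rewrite inE negb_or eq_sym => /andP[/negPf -> /IHu ->].
have E1 : perm_eq (p ++ x :: u ++ v) E.
  by apply: perm_trans pE; rewrite perm_sym; exact: perm_move.
have hu : {in u, forall a, fr a x}.
  move=> a au; apply: h; rewrite ?mem_cat ?inE ?eqxx ?au ?orbT//.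
    rewrite catA; apply: before_cat_mem; first by rewrite mem_cat au orbT.
    by rewrite mem_cat negb_or xp.
  rewrite -cat_rcons; apply: before_cat_mem; first by rewrite mem_rcons mem_head.
  rewrite mem_rcons inE negb_or; apply/andP; split.
    by apply: contraNneq xu => <-.
  move: U; rewrite cat_uniq => /and3P[_ /hasPn + _].
  by move=> /(_ a); rewrite mem_cat au; apply.
(* A remaining inversion was one before the jump of [x]: the pairs reversed by the jump now have [x]
   first, where the target word wants it too. *)
have h2 : free_inversions fr (p ++ x :: u ++ v) (p ++ x :: w').
  move=> b c; rewrite -!(perm_mem (perm_move p u x v)) => bw cw hb hc.
  have [hbc|nbc] := boolP (before (p ++ u ++ x :: v) b c); first exact: h.
  have bc := before_neq hb.
  have [bx cu] := before_move U (before_total bw bc nbc) hb.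
  exfalso; subst b; have cp : c \in p.
    by move: hc; rewrite before_cat// (negPf xp) before_cons eqxx /= orbF.
  by move: U; rewrite cat_uniq => /and3P[_ /hasPn /(_ c)]; rewrite mem_cat cu /= cp => /(_ isT).
rewrite -(ell_mul pE E1 pE')//.
- rewrite ell_front// rm; congr (_ * _).
  by rewrite -!(cat_rcons x) IH ?size_rcons ?cat_rcons.
- move=> b c _ _ hb hc; have [-> bu] := before_move U hb hc.
  exact: hu.
Qed.

(** Applied below with [ell w w'] the class of the straight path between two arrangements:
    composition and the values on adjacent exchanges determine it. *)
Lemma ell_transition w w' : perm_eq w E -> perm_eq w w' ->
  free_inversions fr w w' -> ell w w' = transition s 0 w w'.
Proof. exact: (@ell_transition_suffix [::]). Qed.

End realize.

End transition.

Lemma transition_map (L L' : eqType) (Gm : groupType) (f : L' -> L)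
    (s : nat -> L -> L -> Gm) o (w w' : seq L') : injective f ->
  transition s o (map f w) (map f w') =
  transition (fun p a b => s p (f a) (f b)) o w w'.
Proof.
move=> finj; elim: w' w o => [|x w' IH] w o //=.
have rm v y : rem (f y) (map f v) = map f (rem y v).
  by elim: v => //= a v ->; rewrite (inj_eq finj); case: eqP.
rewrite rm IH; congr (_ * _).
by elim: w o {IH} => //= a w IH o; rewrite (inj_eq finj) IH.
Qed.

(** * The cocycle law for words, from the hexagon identity *)

Section cocycle.
Variables (L : eqType) (Gm : groupType) (s : nat -> L -> L -> Gm) (N : nat).
Variable fr : rel L.
Implicit Types (w u v p : seq L) (a b x y : L).
Hypothesis fr_sym : symmetric fr.
Hypothesis sV : forall o a b, a != b -> s o a b * s o b a = 1.
Hypothesis sC : forall o o' a b c d, o.+1 < o' -> commute (s o a b) (s o' c d).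
(** Both sides reverse [a y x] in three consecutive positions; the bound [N] keeps these positions
    within the range of the generators. *)
Hypothesis hex : forall o a x y, o.+2 < N -> uniq [:: a; x; y] ->
  fr a x -> fr a y -> fr x y ->
  s o a y * s o.+1 a x * s o y x = s o.+1 y x * s o a x * s o.+1 a y.
Local Notation front := (front s).
Local Notation transition := (transition s).

Lemma front_commute o o' a b w x : o.+1 < o' -> commute (s o a b) (front o' w x).
Proof.
elim: w o' => [|c w IH] o' lo /=; first exact: commute1.
case: eqP => _; first exact: commute1.
by apply: commuteM; [apply: IH; exact: ltnW|exact: sC].
Qed.

Lemma transition_commute o o' a b w w' :
  o.+1 < o' -> commute (s o a b) (transition o' w w').
Proof.
elim: w' w o' => [|c w' IH] w o' lo /=; first exact: commute1.
by apply: commuteM; [exact: front_commute|apply: IH; exact: ltnW].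
Qed.

(** Both sides bring [x y] to the front. When a letter [a] stands ahead of both, the hexagon carries
    the final exchange of [y] and [x] across [a]. *)
Lemma front_front o w x y : o + size w <= N -> uniq w -> x \in w -> y \in w ->
  x != y -> fr x y ->
  (forall a, before w a x -> before w a y -> fr a x /\ fr a y) ->
  front o w y * front o.+1 (rem y w) x * s o y x =
  front o w x * front o.+1 (rem x w) y.
Proof.
elim: w o => [|a w IH] o //= sz /andP[aw uw]; rewrite !inE => xw yw xy fxy h.
case: (eqVneq a x) xw => [ax|ax] xw.
  (* [x] heads the word: [y] passes it and is then passed back. *)
  subst a; rewrite (negPf xy) /= eqxx mulg1 mul1g -mulgA sV ?mulg1//.
case: (eqVneq a y) yw => [ay|ay] yw.
  by subst a; rewrite /= eqxx mul1g mulg1.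
rewrite /= in xw yw; rewrite /= (negPf ax) (negPf ay).
have [fx fy] : fr a x /\ fr a y.
  by apply: h; rewrite before_cons eqxx andbT eq_sym.
rewrite -!mulgA (mulgA (s o a y)) (front_commute a y (rem y w) x (ltnSn o.+1)).
rewrite -(mulgA _ (s o a y)) (mulgA (s o a y)) hex//; last 2 first.
- have : 2 <= size w.
    case: w xw yw {IH aw uw h sz} => [|c [|d w]] //; rewrite !inE => /eqP e /eqP e'.
    by rewrite e e' eqxx in xy.
  move=> s2; apply: leq_trans sz; rewrite addnS ltnS -addn2 leq_add2l//.
- by rewrite /= !inE negb_or ax ay xy.
rewrite !mulgA IH//; last 2 first.
- by rewrite addSnnS.
- by move=> b bx bY; apply: h; rewrite before_cons eq_sym ?ax ?ay ?bx ?bY orbT.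
rewrite -!mulgA; congr (_ * _); rewrite !mulgA; congr (_ * _).
by apply/esym/front_commute.
Qed.

(** Both sides lead from [w] to [x :: rem x w']. With [y] the head of [w'], the exchange of [y] and
    [x] commutes with the rest of the sorting, which starts two positions later. *)
Lemma transition_front o w w' x : o + size w <= N -> uniq w -> perm_eq w w' ->
  x \in w -> free_inversions fr w w' -> (forall a, before w' a x -> fr a x) ->
  transition o w w' * front o w' x =
  front o w x * transition o.+1 (rem x w) (rem x w').
Proof.
elim: w' w o => [|y w' IH] w o sz uw ww' xw h hx.
  by move: xw; rewrite (perm_mem ww').
rewrite /=; case: eqP => [->|/eqP yx]; first by rewrite mulg1.
have yw : y \in w by rewrite (perm_mem ww') inE eqxx.
have uw' : uniq (y :: w') by rewrite -(perm_uniq ww').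
have rww' : perm_eq (rem y w) w'.
  by rewrite perm_rem_cons.
have fyx : fr y x by apply: hx; rewrite before_cons eqxx andbT eq_sym.
have hw a : before w a x -> fr a x.
  move=> ax; have [/hx//|ax'] := boolP (before (y :: w') a x).
  have aw := before_mem ax.
  apply: h => //; apply: before_total ax'; first by rewrite -(perm_mem ww').
  exact: before_neq ax.
have hy a : before w a y -> fr a y.
  move=> ay; apply: h => //; first exact: before_mem ay.
  by rewrite before_cons eqxx andbT; exact: before_neq ay.
rewrite /= -!mulgA (mulgA (transition _ _ _)) IH; last 6 first.
- by rewrite addSnnS (leq_trans _ sz)// leq_add2l size_rem// ltn_predL; case: (w) yw.
- exact: rem_uniq.
- exact: rww'.
- by rewrite mem_rem_uniq// inE eq_sym yx.
- move=> a b; rewrite !mem_rem_uniq// !inE => /andP[ay aw] /andP[bY bw].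
  rewrite before_rem// => ab ba; apply: h => //.
  by rewrite before_cons ay ba orbT.
- by move=> a ax; apply: hx; rewrite before_cons eq_sym yx ax orbT.
rewrite -[_ * transition o.+2 _ _ * _]mulgA.
rewrite -(transition_commute y x _ _ (ltnSn o.+1)) !mulgA.
rewrite front_front//; last by move=> a /hw ax /hy ay.
- by rewrite rem_comm.
- by rewrite eq_sym.
- by rewrite fr_sym.
Qed.

(** By [transition_front] the head of [w3] may be brought forward in [w1] already instead of in
    [w2]; it then disappears from all three words. *)
Lemma transition_mul o w1 w2 w3 : o + size w1 <= N -> uniq w1 ->
  perm_eq w1 w2 -> perm_eq w1 w3 ->
  free_inversions fr w1 w2 -> free_inversions fr w2 w3 ->
  transition o w1 w2 * transition o w2 w3 = transition o w1 w3.
Proof.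
elim: w3 w1 w2 o => [|x w3 IH] w1 w2 o sz u1 p2 p3 h12 h23.
  have e1 : w1 = [::] by apply/perm_nilP.
  by move: p2; rewrite perm_sym e1 => /perm_nilP -> /=; rewrite mulg1.
have x1 : x \in w1 by rewrite (perm_mem p3) inE eqxx.
have x2 : x \in w2 by rewrite -(perm_mem p2).
have u2 : uniq w2 by rewrite -(perm_uniq p2).
have u3 : uniq (x :: w3) by rewrite -(perm_uniq p3).
have fx a : before w2 a x -> fr a x.
  move=> ax; apply: h23 => //; first exact: before_mem ax.
  by rewrite before_cons eqxx andbT; exact: before_neq ax.
rewrite /= mulgA transition_front// -mulgA; congr (_ * _).
apply: IH.
- by rewrite addSnnS (leq_trans _ sz)// leq_add2l size_rem// ltn_predL; case: (w1) x1.
- exact: rem_uniq.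
- exact: perm_rem2.
- by rewrite perm_rem_cons.
- move=> a b; rewrite !mem_rem_uniq// !inE => /andP[ax aw] /andP[bx bw].
  by rewrite !before_rem//; exact: h12.
- move=> a b; rewrite !mem_rem_uniq// !inE => /andP[ax aw] /andP[bx bw].
  rewrite !before_rem// => ab ba; apply: h23 => //.
  by rewrite before_cons ax ba orbT.
Qed.

End cocycle.

Local Close Scope group_scope.
Local Open Scope classical_set_scope.
Local Open Scope ring_scope.

(** * Holonomy of a local cocycle *)

(** Continuous induction by a supremum, in place of a Lebesgue number: the relation is checked only
    on short intervals around each point. The radius is quantified by [near] so that applications
    may shrink it at will. *)
Lemma interval_chain (R : realType) (Q : R -> R -> Prop) (a b : R) : a <= b ->
  (forall s t u, a <= s -> s <= t -> t <= u -> u <= b -> Q s t -> Q t u -> Q s u) ->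
  (forall t, a <= t <= b -> \forall e \near 0^'+, forall s u, a <= s -> t - e < s ->
     s <= t -> t <= u -> u < t + e -> u <= b -> Q s u) ->
  Q a b.
Proof.
move=> ab Qtrans Qloc.
have {}Qloc t : a <= t <= b -> exists2 e, 0 < e & forall s u, a <= s -> t - e < s ->
     s <= t -> t <= u -> u < t + e -> u <= b -> Q s u.
  move=> /Qloc near_e.
  have /filter_ex [e [e0 h]] : \forall e \near 0^'+, 0 < e /\ forall s u, a <= s -> t - e < s ->
     s <= t -> t <= u -> u < t + e -> u <= b -> Q s u.
    by near=> e; split; [near: e; exact: nbhs_right_gt|near: e].
  by exists e.
pose S := [set t | a <= t <= b /\ Q a t].
have Sa : S a.
  split; first by rewrite lexx.
  have [|e e0 h] := Qloc a; first by rewrite lexx.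
  by apply: h; rewrite ?lexx//; lra.
have supS : has_sup S.
  by split; [exists a|exists b => x [/andP[_ ]]].
set c := sup S.
have ac : a <= c by exact: ub_le_sup supS.2 _ Sa.
have cb : c <= b by apply: ge_sup => [|x [/andP[_ ]]//]; exists a.
have [|e e0 h] := Qloc c; first by rewrite ac cb.
have [t [/andP[ta tb] Qt] tc] := sup_adherent e0 supS.
have tlec : t <= c by apply: ub_le_sup supS.2 _ _; split => //; rewrite ta tb.
have Qc : Q a c.
  by apply: (Qtrans _ t) => //; apply: h => //; lra.
have [<-//|cb'] := eqVneq c b.
have cltb : c < b by rewrite lt_neqAle cb' cb.
pose u := Num.min b (c + e / 2).
have cu : c < u by rewrite lt_min cltb /=; lra.
have ub : u <= b by rewrite ge_min lexx.
have uc : u < c + e by rewrite gt_min; apply/orP; right; lra.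
have : S u.
  split; first by rewrite ub andbT (le_trans ac)// ltW.
  by apply: (Qtrans _ c) => //; [exact: ltW|apply: h => //; [lra|exact: ltW]].
by move=> /(ub_le_sup supS.2); rewrite leNgt cu.
Unshelve. all: by end_near. Qed.

Section holonomy.
Context {R : realType} {Y : topologicalType} {Gm : groupType}.
Variable T : Y -> Y -> Gm.

Definition cocycle_on (V : set Y) :=
  forall a b c, V a -> V b -> V c -> (T a b * T b c)%g = T a c.

Hypothesis T_cocycle : forall y : Y, exists2 V, nbhs y V & cocycle_on V.

(** A multiplicative primitive of [T] along [p]; left translation of [g] leaves the quotient of its
    end values, the holonomy, unchanged. *)
Definition transport (p : R -> Y) (a b : R) (g : R -> Gm) :=
  forall t, a <= t <= b -> \forall s \near t, a <= s <= b ->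
    g s = (g t * T (p t) (p s))%g.

Definition holonomy (p : R -> Y) (a b : R) (x : Gm) :=
  exists2 g, transport p a b g & x = ((g a)^-1 * g b)%g.

Lemma cocycle_id y : T y y = 1%g.
Proof.
have [V /nbhs_singleton Vy cV] := T_cocycle y.
by apply: (mulgI (T y y)); rewrite mulg1 cV.
Qed.

Lemma holonomy_ext p q a b x : (forall t, a <= t <= b -> p t = q t) -> a <= b ->
  holonomy p a b x -> holonomy q a b x.
Proof.
move=> pq ab [g gp ->]; exists g => // t tab.
by apply: filterS (gp _ tab) => s + sab; rewrite -!pq//; exact.
Qed.

Lemma holonomy_local p a b V : cocycle_on V ->
  (forall t, a <= t <= b -> V (p t)) -> a <= b ->
  holonomy p a b (T (p a) (p b)).
Proof.
move=> cV pV ab; have Va : V (p a) by apply: pV; rewrite lexx.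
exists (fun t => T (p a) (p t)); last by rewrite cocycle_id invg1 mul1g.
by move=> t tab; apply: (@filterE _ (nbhs t)) => s sab; rewrite cV//; exact: pV.
Qed.

(** The second primitive is translated on the left so as to agree with the first at [b]. *)
Lemma holonomy_cat p a b c x y : a <= b -> b <= c ->
  holonomy p a b x -> holonomy p b c y -> holonomy p a c (x * y)%g.
Proof.
move=> ab bc [g gp ->] [h hp ->].
pose k t := if t <= b then g t else (g b * (h b)^-1 * h t)%g.
exists k; last first.
  rewrite /k ab; case: ifP => cb; last by rewrite -!mulgA.
  have -> : c = b by apply/eqP; rewrite eq_le cb bc.
  by rewrite mulVg mulg1.
move=> t /andP[ta tc]; rewrite /k.
have [tb|tb|tb] := ltgtP t b.
- have tab : a <= t <= b by rewrite ta ltW.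
  apply: filterS2 (gp _ tab) (lt_nbhsl tb) => s gs sb /andP[sa _].
  by rewrite (ltW sb) gs// sa (ltW sb).
- have tbc : b <= t <= c by rewrite tc ltW.
  apply: filterS2 (hp _ tbc) (lt_nbhsr tb) => s hs sb /andP[_ sc].
  by rewrite leNgt sb /= hs ?mulgA// sc (ltW sb).
- subst t; have bab : a <= b <= b by rewrite ab lexx.
  have bbc : b <= b <= c by rewrite bc lexx.
  apply: filterS2 (hp _ bbc) (gp _ bab) => s hs gs /andP[sa sc].
  case: ifPn => sb; first by rewrite gs// sa sb.
  by rewrite hs ?mulgA ?mulgVK// sc ltW// ltNge.
Qed.

Lemma holonomy_exists p a b : continuous p -> a <= b ->
  exists x, holonomy p a b x.
Proof.
move=> cp ab; apply: (@interval_chain _ (fun s u => exists x, holonomy p s u x)) => //.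
  move=> s t u _ st tu _ [x px] [y py]; exists (x * y)%g.
  exact: holonomy_cat px py.
move=> t tab; have [V Vt cV] := T_cocycle (p t).
have /nbhs_ballP [e /= e0 eV] : nbhs t (p @^-1` V) by exact: cp.
near=> d => s u sa ts st tu ut ub; exists (T (p s) (p u)).
apply: (holonomy_local cV); last exact: le_trans tu.
move=> x /andP[sx xu]; apply: eV; rewrite /ball /= ltr_norml.
have : d <= e by near: d; apply: nbhs_right_le.
by lra.
Unshelve. all: by end_near. Qed.

(** Near each point both primitives have the quotients prescribed by [T], and [interval_chain]
    propagates the equality of quotients. *)
Lemma holonomy_unique p a b x y : a <= b ->
  holonomy p a b x -> holonomy p a b y -> x = y.
Proof.
move=> ab [g gp ->] [h hp ->].
apply: (@interval_chain _ (fun s u => ((g s)^-1 * g u = (h s)^-1 * h u)%g)) => //.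
  move=> s t u _ _ _ _ e1 e2.
  by rewrite -(mulVKg (g t) (g u)) mulgA e1 e2 -mulgA mulVKg.
move=> t tab; have := gp _ tab; have := hp _ tab.
move=> /nbhs_ballP[e /= e0 he] /nbhs_ballP[f /= f0 hf].
near=> d => s u sa ts st tu ut ub.
have de : d <= e by near: d; apply: nbhs_right_le.
have df : d <= f by near: d; apply: nbhs_right_le.
have sab : a <= s <= b by lra.
have uab : a <= u <= b by lra.
have ball_d z : t - d < z -> z < t + d -> ball t d z.
  by move=> ? ?; rewrite /ball /= ltr_norml; lra.
have bs : ball t d s by apply: ball_d; lra.
have bu : ball t d u by apply: ball_d; lra.
rewrite (hf s)//; last exact: le_ball df _ bs.
rewrite (hf u)//; last exact: le_ball df _ bu.
rewrite (he s)//; last exact: le_ball de _ bs.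
rewrite (he u)//; last exact: le_ball de _ bu.
by rewrite !invgM -!mulgA !mulKg.
Unshelve. all: by end_near. Qed.

Lemma holonomy_affine p a b k m x : 0 < k ->
  holonomy p (k * a + m) (k * b + m) x ->
  holonomy (fun t => p (k * t + m)) a b x.
Proof.
move=> k0 [g gp ->]; exists (fun t => g (k * t + m)) => // t /andP[ta tb].
have aff_in s : a <= s <= b -> k * a + m <= k * s + m <= k * b + m.
  by move=> /andP[? ?]; rewrite !lerD2r !ler_pM2l//; apply/andP.
have c : (fun s => k * s + m) @ t --> k * t + m.
  by apply: cvgD; [apply: cvgM; [exact: cvg_cst|exact: cvg_id]|exact: cvg_cst].
have tab : a <= t <= b by rewrite ta.
have := c _ (gp _ (aff_in _ tab)); rewrite /fmap /= -/(nbhs t).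
apply: (@filterS _ (nbhs t)) => s /= + sab; apply; exact: aff_in.
Qed.

(** Compactness of the unit interval gives one neighbourhood of [s0] for all [t], while the sets [V]
    still vary with [t]. *)
Let tube (H : R * R -> Y) (s0 : R) : continuous H ->
  \forall s \near s0, forall t : R, 0 <= t <= 1 -> \forall u \near t,
   exists2 V, cocycle_on V &
     [/\ V (H (s0, t)), V (H (s0, u)), V (H (s, t)) & V (H (s, u))].
Proof.
move=> cH.
have /compact_near_coveringP cov := @segment_compact R 0 1.
suff : \forall s \near s0, `[0, 1]%classic `<=` (fun t : R => \forall u \near t,
   exists2 V, cocycle_on V &
     [/\ V (H (s0, t)), V (H (s0, u)), V (H (s, t)) & V (H (s, u))]).
  by apply: filterS => s h t t01; apply: h; rewrite /= in_itv.
apply: (cov R (nbhs s0) (fun s t => \forall u \near t,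
   exists2 V, cocycle_on V &
     [/\ V (H (s0, t)), V (H (s0, u)), V (H (s, t)) & V (H (s, u))])).
  move=> t _; have [V Vt cV] := T_cocycle (H (s0, t)).
  have [[A B] /= [A0 Bt] ABV] : nbhs (s0, t) (H @^-1` V) by exact: cH.
  exists (B^° , A) => /=; first by split => //; exact: nbhs_interior.
  move=> [t' s] /= [Bt' As]; apply: filterS (Bt') => u Bu; exists V => //.
  have A0' := nbhs_singleton A0.
  have Bt'' := nbhs_singleton Bt'.
  by split; apply: ABV.
Qed.

Lemma holonomy_homotopy (H : R * R -> Y) y0 y1 x : continuous H ->
  (forall s, 0 <= s <= 1 -> H (s, 0) = y0) ->
  (forall s, 0 <= s <= 1 -> H (s, 1) = y1) ->
  holonomy (fun t => H (0, t)) 0 1 x -> holonomy (fun t => H (1, t)) 0 1 x.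
Proof.
move=> cH H0 H1; have cHs s : continuous (fun t => H (s, t)).
  move=> t; apply: (@continuous_comp _ _ _ (fun t => (s, t)) H); last exact: cH.
  by move: t; apply: (@pair_continuous R R R (cst s) id) => t; [exact: cvg_cst|exact: cvg_id].
have h01 : (0 : R) <= 1 by exact: ler01.
suff : forall x, holonomy (fun t => H (0, t)) 0 1 x <->
  holonomy (fun t => H (1, t)) 0 1 x by move=> h /h.
apply: (@interval_chain _ (fun s u => forall x, holonomy (fun t => H (s, t)) 0 1 x <->
  holonomy (fun t => H (u, t)) 0 1 x)) => //.
  by move=> s t u _ _ _ _ e1 e2 y; apply: iff_trans (e1 y) (e2 y).
move=> s0 s01; have /nbhs_ballP [e /= e0 he] := tube s0 cH.
have key s y : 0 <= s <= 1 -> ball s0 e s -> holonomy (fun t => H (s0, t)) 0 1 y ->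
    holonomy (fun t => H (s, t)) 0 1 y.
  move=> ss /he {}he [g gp ->].
  (* The primitive is corrected by the short displacement from [H (s0, t)] to [H (s, t)], which is
     trivial at both ends because the homotopy fixes them. *)
  exists (fun t => g t * T (H (s0, t)) (H (s, t)))%g; last first.
    by rewrite !H0// !H1// !cocycle_id !mulg1.
  move=> t t01; apply: filterS2 (he t t01) (gp t t01) => u [V cV [V1 V2 V3 V4]] gu u01.
  by rewrite gu// -!mulgA !cV.
(* The converse comes from existence at [s0] and uniqueness at [s]. *)
have key' s y : 0 <= s <= 1 -> ball s0 e s -> holonomy (fun t => H (s, t)) 0 1 y ->
    holonomy (fun t => H (s0, t)) 0 1 y.
  move=> ss bs hy; have [z hz] := holonomy_exists (cHs s0) h01.
  by rewrite (holonomy_unique h01 hy (key _ _ ss bs hz)).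
near=> d => s u sa ts st tu ut ub y.
have de : d <= e by near: d; apply: nbhs_right_le.
have bs : ball s0 e s by rewrite /ball /= ltr_norml; lra.
have bu : ball s0 e u by rewrite /ball /= ltr_norml; lra.
have ss : 0 <= s <= 1 by lra.
have uu : 0 <= u <= 1 by lra.
by split=> [/(key' _ _ ss bs)/(key _ _ uu bu)|/(key' _ _ uu bu)/(key _ _ ss bs)].
Unshelve. all: by end_near. Qed.

End holonomy.

(** * Paths up to homotopy *)

Section continuity.
Context {R : realType}.

Lemma affineR_cts (a b : R) : continuous (fun t : R => a * t + b).
Proof.
move=> t; apply: cvgD; last exact: cvg_cst.
by apply: cvgM; [exact: cvg_cst|exact: cvg_id].
Qed.

Lemma comp_cts (Z V W : topologicalType) (f : Z -> V) (g : V -> W) :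
  continuous f -> continuous g -> continuous (g \o f).
Proof. by move=> cf cg t; apply: continuous_comp; [exact: cf|exact: cg]. Qed.

Lemma aff_cts (Z : topologicalType) (f : Z -> R) (a b : R) : continuous f ->
  continuous (fun z => a * f z + b).
Proof. by move=> cf; apply: (@comp_cts _ _ _ f (fun t => a * t + b)) => //; exact: affineR_cts. Qed.

Lemma id_cts (Z : topologicalType) : continuous (@id Z).
Proof. by move=> z; exact: cvg_id. Qed.

Lemma max_cts (Z : topologicalType) (f g : Z -> R) : continuous f ->
  continuous g -> continuous (fun z => Num.max (f z) (g z)).
Proof. by move=> cf cg z; apply: continuous_max; [exact: cf|exact: cg]. Qed.

Lemma min_cts (Z : topologicalType) (f g : Z -> R) : continuous f ->
  continuous g -> continuous (fun z => Num.min (f z) (g z)).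
Proof. by move=> cf cg z; apply: continuous_min; [exact: cf|exact: cg]. Qed.

Definition clamp (t : R) : R := Num.max 0 (Num.min t 1).

Lemma clampK t : 0 <= t <= 1 -> clamp t = t.
Proof. by move=> /andP[t0 t1]; rewrite /clamp (min_idPl t1) (max_idPr t0). Qed.

Lemma clamp_itv t : 0 <= clamp t <= 1.
Proof. by rewrite /clamp le_max lexx ge_max ler01 ge_min lexx orbT. Qed.

Lemma clamp_cts : continuous clamp.
Proof.
apply: max_cts; first by move=> u; exact: cvg_cst.
by apply: min_cts; [exact: id_cts|move=> u; exact: cvg_cst].
Qed.

End continuity.

Section arcs.
Context {R : realType} {Y : topologicalType}.
Implicit Types x y z w : Y.

(* Only the values on the interval from [0] to [1] matter. *)
Record arc x y := Arc {
  arc_fun :> R -> Y;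
  arc_cts : continuous arc_fun;
  arc0 : arc_fun 0 = x;
  arc1 : arc_fun 1 = y }.

Definition arc_homotopic x y (p q : arc x y) := exists H : R * R -> Y,
  [/\ continuous H,
      forall t, 0 <= t <= 1 -> H (0, t) = p t,
      forall t, 0 <= t <= 1 -> H (1, t) = q t,
      forall s, 0 <= s <= 1 -> H (s, 0) = x &
      forall s, 0 <= s <= 1 -> H (s, 1) = y].

(** The parameters are joined by an affine homotopy. Associativity, units and inverses below are
    instances. *)
Lemma arc_homotopic_reparam x y (p q : arc x y) (F : R -> Y) (f g : R -> R) :
  continuous F -> continuous f -> continuous g -> f 0 = g 0 -> f 1 = g 1 ->
  (forall t, 0 <= t <= 1 -> p t = F (f t)) ->
  (forall t, 0 <= t <= 1 -> q t = F (g t)) -> arc_homotopic p q.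
Proof.
move=> cF cf cg fg0 fg1 pf qg.
exists (fun u => F ((1 - u.1) * f u.2 + u.1 * g u.2)).
have i0 : 0 <= (0 : R) <= 1 by rewrite lexx ler01.
have i1 : 0 <= (1 : R) <= 1 by rewrite lexx ler01.
split.
- apply: comp_cts cF => u.
  have cs (h : R -> R) : continuous h -> (fun u : R * R => h u.2) @ u --> h u.2.
    by move=> ch; apply: continuous_comp; [exact: snd_continuous|exact: ch].
  have c1 : (fun u : R * R => u.1) @ u --> u.1 by exact: fst_continuous.
  apply: cvgD; apply: cvgM => //; try exact: cs.
  by apply: cvgB => //; exact: cvg_cst.
- by move=> t t01 /=; rewrite subr0 mul1r mul0r addr0 pf.
- by move=> t t01 /=; rewrite subrr mul1r mul0r add0r qg.
- by move=> s _ /=; rewrite -fg0 -mulrDl subrK mul1r -pf// arc0.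
- by move=> s _ /=; rewrite -fg1 -mulrDl subrK mul1r -pf// arc1.
Qed.

Lemma arc_homotopic_ext x y (p q : arc x y) :
  (forall t, 0 <= t <= 1 -> p t = q t) -> arc_homotopic p q.
Proof.
move=> pq; apply: (@arc_homotopic_reparam _ _ p q p id id) => //.
- exact: arc_cts.
- exact: id_cts.
- exact: id_cts.
- by move=> t t01; rewrite pq.
Qed.

Lemma arc_homotopic_sym x y (p q : arc x y) :
  arc_homotopic p q -> arc_homotopic q p.
Proof.
move=> [H [cH H0 H1 Hz Ho]]; exists (fun u => H (-1 * u.1 + 1, u.2)).
split => [|t t01|t t01|s s01|s s01] /=.
- apply: comp_cts cH; apply: pair_continuous; last exact: snd_continuous.
  by apply: aff_cts; exact: fst_continuous.
- by rewrite mulr0 add0r H1.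
- by rewrite mulr1 addNr H0.
- by rewrite Hz//; lra.
- by rewrite Ho//; lra.
Qed.

Lemma arc_homotopic_trans x y (q p r : arc x y) :
  arc_homotopic p q -> arc_homotopic q r -> arc_homotopic p r.
Proof.
move=> [H [cH H0 H1 Hz Ho]] [K [cK K0 K1 Kz Ko]].
(* [H] and [K] are known to agree at the seam only for times in the unit interval, whence
   [clamp]. *)
exists (fun u => if u.1 <= 2^-1 then H (2 * u.1 + 0, clamp u.2) else K (2 * u.1 - 1, clamp u.2)).
split => [|t t01|t t01|s s01|s s01] /=.
- have c2 : continuous (fun u : R * R => clamp u.2).
    by apply: comp_cts clamp_cts; exact: snd_continuous.
  apply: (@pasting _ _ _ (fun u : R * R => u.1)).
  + exact: fst_continuous.
  + apply: comp_cts cH; apply: pair_continuous c2.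
    by apply: aff_cts; exact: fst_continuous.
  + apply: comp_cts cK; apply: pair_continuous c2.
    by apply: aff_cts; exact: fst_continuous.
  + by move=> u ->; have ? := clamp_itv u.2; rewrite divff// subrr addr0 H1// K0.
- by rewrite invr_ge0 ler0n mulr0 addr0 clampK// H0.
- rewrite leNgt invf_lt1 ?ltr0n// ltr1n /= mulr1 clampK//.
  by rewrite (_ : 2 - 1 = 1) ?K1//; lra.
- by rewrite clampK ?lexx ?ler01//; case: ifP => h; [rewrite Hz|rewrite Kz] => //; lra.
- by rewrite clampK ?lexx ?ler01//; case: ifP => h; [rewrite Ho|rewrite Ko] => //; lra.
Qed.

Definition arc_cat_fun (f g : R -> Y) (t : R) : Y :=
  if t <= 2^-1 then f (2 * t + 0) else g (2 * t - 1).

Lemma arc_cat_cts x y z (p : arc x y) (q : arc y z) :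
  continuous (arc_cat_fun p q).
Proof.
apply: (@pasting _ _ _ id); first exact: id_cts.
- by apply: comp_cts (@arc_cts _ _ p); exact: affineR_cts.
- by apply: comp_cts (@arc_cts _ _ q); exact: affineR_cts.
- by move=> t ->; rewrite divff// addr0 subrr arc1 arc0.
Qed.

Lemma arc_cat0 x y z (p : arc x y) (q : arc y z) : arc_cat_fun p q 0 = x.
Proof. by rewrite /arc_cat_fun invr_ge0 ler0n mulr0 addr0 arc0. Qed.

Lemma arc_cat1 x y z (p : arc x y) (q : arc y z) : arc_cat_fun p q 1 = z.
Proof.
rewrite /arc_cat_fun leNgt invf_lt1 ?ltr0n// ltr1n /= mulr1.
by rewrite (_ : 2 - 1 = 1) ?arc1//; lra.
Qed.

Definition arc_cat x y z (p : arc x y) (q : arc y z) : arc x z :=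
  Arc (@arc_cat_cts _ _ _ p q) (arc_cat0 p q) (arc_cat1 p q).

Lemma arc_inv_cts x y (p : arc x y) : continuous (fun t : R => p (-1 * t + 1)).
Proof. by apply: comp_cts (@arc_cts _ _ p); exact: affineR_cts. Qed.

Lemma arc_inv0 x y (p : arc x y) : p (-1 * 0 + 1) = y.
Proof. by rewrite mulr0 add0r arc1. Qed.

Lemma arc_inv1 x y (p : arc x y) : p (-1 * 1 + 1) = x.
Proof. by rewrite mulr1 addNr arc0. Qed.

Definition arc_inv x y (p : arc x y) : arc y x :=
  Arc (@arc_inv_cts _ _ p) (arc_inv0 p) (arc_inv1 p).

Definition arc_cst x : arc x x :=
  @Arc x x (cst x) (fun t => @cvg_cst _ x _ _ _) erefl erefl.

Lemma arc_cat_homotopic x y z (p p' : arc x y) (q q' : arc y z) :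
  arc_homotopic p p' -> arc_homotopic q q' ->
  arc_homotopic (arc_cat p q) (arc_cat p' q').
Proof.
move=> [H [cH H0 H1 Hz Ho]] [K [cK K0 K1 Kz Ko]].
exists (fun u => if u.2 <= 2^-1 then H (clamp u.1, 2 * u.2 + 0) else K (clamp u.1, 2 * u.2 - 1)).
have c1 : continuous (fun u : R * R => clamp u.1).
  by apply: comp_cts clamp_cts; exact: fst_continuous.
split => [|t t01|t t01|s s01|s s01] /=.
- apply: (@pasting _ _ _ (fun u : R * R => u.2)).
  + exact: snd_continuous.
  + apply: comp_cts cH; apply: pair_continuous => //.
    by apply: aff_cts; exact: snd_continuous.
  + apply: comp_cts cK; apply: pair_continuous => //.
    by apply: aff_cts; exact: snd_continuous.
  + by move=> u ->; have ? := clamp_itv u.1; rewrite divff// subrr addr0 Ho// Kz.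
- by rewrite /arc_cat_fun clampK ?lexx ?ler01//; case: ifPn => h; [rewrite H0|rewrite K0] => //; lra.
- by rewrite /arc_cat_fun clampK ?lexx ?ler01//; case: ifPn => h; [rewrite H1|rewrite K1] => //; lra.
- by rewrite clampK// invr_ge0 ler0n mulr0 addr0 Hz.
- rewrite leNgt invf_lt1 ?ltr0n// ltr1n /= mulr1.
  by rewrite clampK// (_ : 2 - 1 = 1) ?Ko//; lra.
Qed.

Lemma arc_catA x y z w (p : arc x y) (q : arc y z) (r : arc z w) :
  arc_homotopic (arc_cat p (arc_cat q r)) (arc_cat (arc_cat p q) r).
Proof.
(* The slopes [1/2], [1], [2] compare the durations that the two bracketings assign to [p], [q],
   [r]. *)
apply: (@arc_homotopic_reparam _ _ _ _ (arc_cat (arc_cat p q) r)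
  (fun t => Num.max (2^-1 * t + 0) (Num.max (1 * t - 4^-1) (2 * t - 1))) id).
- exact: arc_cts.
- by apply: max_cts; [|apply: max_cts]; exact: affineR_cts.
- exact: id_cts.
- by case: (leP (1 * _ - _)) => ?; case: leP => ?; lra.
- by case: (leP (1 * _ - _)) => ?; case: leP => ?; lra.
- move=> t /andP[t0 t1]; set m := Num.max _ _.
  have [ht|ht] := leP t 2^-1.
    have -> : m = 2^-1 * t by rewrite /m; case: (leP (1 * _ - _)) => ?; case: leP => ?; lra.
    rewrite /= /arc_cat_fun ht ifT; last by lra.
    by rewrite ifT; [congr (p _); lra|lra].
  have [ht'|ht'] := leP (2 * t - 1) 2^-1.
    have -> : m = t - 4^-1 by rewrite /m; case: (leP (1 * _ - _)) => ?; case: leP => ?; lra.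
    rewrite /= /arc_cat_fun leNgt ht /= ht' ifT; last by lra.
    by rewrite ifF; [congr (q _); lra|apply/negbTE; rewrite -ltNge; lra].
  have -> : m = 2 * t - 1 by rewrite /m; case: (leP (1 * _ - _)) => ?; case: leP => ?; lra.
  by rewrite /= /arc_cat_fun [t <= _]leNgt ht /= leNgt ht'.
- by [].
Qed.

Lemma arc_cat1l x y (p : arc x y) : arc_homotopic (arc_cat (arc_cst x) p) p.
Proof.
apply: (@arc_homotopic_reparam _ _ _ _ p
  (fun t => Num.max (0 * t + 0) (2 * t - 1)) id).
- exact: arc_cts.
- by apply: max_cts; exact: affineR_cts.
- exact: id_cts.
- by case: leP => ?; lra.
- by case: leP => ?; lra.
- move=> t /andP[t0 t1]; rewrite /= /arc_cat_fun mul0r.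
  have [ht|ht] := leP t 2^-1; last by rewrite (max_idPr _)//; lra.
  by rewrite (max_idPl _); [rewrite (addr0 0) arc0|lra].
- by [].
Qed.

Lemma arc_cat1r x y (p : arc x y) : arc_homotopic (arc_cat p (arc_cst y)) p.
Proof.
apply: (@arc_homotopic_reparam _ _ _ _ p
  (fun t => Num.min (2 * t + 0) (0 * t + 1)) id).
- exact: arc_cts.
- by apply: min_cts; exact: affineR_cts.
- exact: id_cts.
- by case: leP => ?; lra.
- by case: leP => ?; lra.
- move=> t /andP[t0 t1]; rewrite /= /arc_cat_fun mul0r add0r.
  have [ht|ht] := leP t 2^-1; first by rewrite (min_idPl _)//; lra.
  by rewrite (min_idPr _); [rewrite arc1|lra].
- by [].
Qed.

Lemma arc_catVl x y (p : arc x y) :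
  arc_homotopic (arc_cat (arc_inv p) p) (arc_cst y).
Proof.
apply: (@arc_homotopic_reparam _ _ _ _ p
  (fun t => Num.max (-2 * t + 1) (2 * t - 1)) (cst 1)).
- exact: arc_cts.
- by apply: max_cts; exact: affineR_cts.
- by move=> u; exact: cvg_cst.
- by rewrite /=; case: leP => ?; lra.
- by rewrite /=; case: leP => ?; lra.
- move=> t /andP[t0 t1]; rewrite /= /arc_cat_fun.
  have [ht|ht] := leP t 2^-1; last by rewrite (max_idPr _)//; lra.
  by rewrite (max_idPl _) /=; [congr (p _); lra|lra].
- by move=> t _; rewrite /= arc1.
Qed.

Lemma arc_catVr x y (p : arc x y) :
  arc_homotopic (arc_cat p (arc_inv p)) (arc_cst x).
Proof.
apply: (@arc_homotopic_reparam _ _ _ _ p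
  (fun t => Num.min (2 * t + 0) (-2 * t + 2)) (cst 0)).
- exact: arc_cts.
- by apply: min_cts; exact: affineR_cts.
- by move=> u; exact: cvg_cst.
- by rewrite /=; case: leP => ?; lra.
- by rewrite /=; case: leP => ?; lra.
- move=> t /andP[t0 t1]; rewrite /= /arc_cat_fun.
  have [ht|ht] := leP t 2^-1; first by rewrite (min_idPl _)//; lra.
  by rewrite (min_idPr _) /=; [congr (p _); lra|lra].
- by move=> t _; rewrite /= arc0.
Qed.

Definition loop_of_fun y0 (p : arc y0 y0) (t : unit_interval R) : Y := p (Ival t).

Lemma loop_of_cts y0 (p : arc y0 y0) : continuous (loop_of_fun p).
Proof. by apply: comp_cts (@arc_cts _ _ p); exact: Ival_continuous. Qed.

Lemma loop_of0 y0 (p : arc y0 y0) : loop_of_fun p zero = y0.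
Proof. by rewrite /loop_of_fun Ival0 arc0. Qed.

Lemma loop_of1 y0 (p : arc y0 y0) : loop_of_fun p one = y0.
Proof. by rewrite /loop_of_fun Ival1 arc1. Qed.

Definition loop_of y0 (p : arc y0 y0) : {path unit_interval R from y0 to y0 in Y} :=
  mk_path (@loop_of_cts _ p) (loop_of0 p) (loop_of1 p).

Definition arc_class y0 (p : arc y0 y0) : pi1 R y0 := loop_class (loop_of p).

Lemma loop_homotopic_ext y0 (p q : {path unit_interval R from y0 to y0 in Y}) :
  (forall t, p t = q t) -> loop_homotopic p q.
Proof.
move=> pq; have [H [cH H0 H1 Hz Ho]] := loop_homotopic_refl p.
by exists H; split => // t; rewrite H1 pq.
Qed.

Lemma arc_class_homotopic y0 (p q : arc y0 y0) :
  arc_homotopic p q -> arc_class p = arc_class q.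
Proof.
move=> [H [cH H0 H1 Hz Ho]]; apply/loop_classP.
exists (fun u => H (Ival u.1, Ival u.2)); split => [|t|t|s|s] /=.
- apply: comp_cts cH; apply: pair_continuous.
    by apply: comp_cts (@Ival_continuous R); exact: fst_continuous.
  by apply: comp_cts (@Ival_continuous R); exact: snd_continuous.
- by rewrite Ival0 H0//; exact: Ival_itv.
- by rewrite Ival1 H1//; exact: Ival_itv.
- by rewrite Ival0 Hz//; exact: Ival_itv.
- by rewrite Ival1 Ho//; exact: Ival_itv.
Qed.

Lemma arc_class_cat y0 (p q : arc y0 y0) :
  arc_class (arc_cat p q) = (arc_class p * arc_class q)%g.
Proof.
rewrite [RHS]pi1_mulE; apply/loop_classP/loop_homotopic_ext => t.
rewrite concatE /loop_of /= /mk_path /= /loop_of_fun /= /arc_cat_fun.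
have /andP[t0 t1] := Ival_itv t.
by case: ifPn => h; rewrite clipK ?addr0//; lra.
Qed.

Lemma arc_class_cst y0 : arc_class (arc_cst y0) = 1%g.
Proof. by apply/loop_classP/loop_homotopic_ext. Qed.

Lemma arc_of_loop_cts y0 (p : {path unit_interval R from y0 to y0 in Y}) :
  continuous (p \o clip).
Proof. by apply: path_comp_continuous; exact: id_cts. Qed.

Lemma arc_of_loop0 y0 (p : {path unit_interval R from y0 to y0 in Y}) :
  p (clip 0) = y0.
Proof. exact: path_zero. Qed.

Lemma arc_of_loop1 y0 (p : {path unit_interval R from y0 to y0 in Y}) :
  p (clip 1) = y0.
Proof. exact: path_one. Qed.

Definition arc_of_loop y0 (p : {path unit_interval R from y0 to y0 in Y}) : arc y0 y0 :=
  Arc (@arc_of_loop_cts _ p) (arc_of_loop0 p) (arc_of_loop1 p).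

Lemma arc_of_loopE y0 (p : {path unit_interval R from y0 to y0 in Y}) :
  arc_class (arc_of_loop p) = loop_class p.
Proof.
by apply/loop_classP/loop_homotopic_ext => t; rewrite /loop_of /= /mk_path /= /loop_of_fun /= IvalK.
Qed.

Section closing.
Variables (y0 : Y) (tl : forall y, arc y0 y).

(** Arcs with arbitrary ends acquire classes in one group; in a product the middle tail is run back
    and forth and cancels. *)
Definition closed_class x y (p : arc x y) : pi1 R y0 :=
  arc_class (arc_cat (arc_cat (tl x) p) (arc_inv (tl y))).

Lemma closed_class_homotopic x y (p q : arc x y) :
  arc_homotopic p q -> closed_class p = closed_class q.
Proof.
move=> pq; apply/arc_class_homotopic/arc_cat_homotopic; last exact: arc_homotopic_ext.
by apply: arc_cat_homotopic => //; exact: arc_homotopic_ext.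
Qed.

Lemma closed_class_cat x y z (p : arc x y) (q : arc y z) :
  (closed_class p * closed_class q)%g = closed_class (arc_cat p q).
Proof.
rewrite -arc_class_cat; apply: arc_class_homotopic.
apply: arc_homotopic_trans (arc_homotopic_sym (arc_catA _ _ _)) _.
apply: (@arc_homotopic_trans _ _
  (arc_cat (arc_cat (tl x) p) (arc_cat q (arc_inv (tl z))))).
  apply: arc_cat_homotopic; first exact: arc_homotopic_ext.
  apply: arc_homotopic_trans (arc_catA _ _ _) _.
  apply: arc_cat_homotopic; last exact: arc_homotopic_ext.
  apply: arc_homotopic_trans (arc_catA _ _ _) _.
  apply: arc_homotopic_trans (arc_cat1l _).
  by apply: arc_cat_homotopic; [exact: arc_catVl|exact: arc_homotopic_ext].
apply: arc_homotopic_trans (arc_catA _ _ _) _.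
apply: arc_cat_homotopic; last exact: arc_homotopic_ext.
exact/arc_homotopic_sym/arc_catA.
Qed.

Hypothesis tl0 : arc_homotopic (tl y0) (arc_cst y0).

Lemma closed_class_tail y : closed_class (tl y) = 1%g.
Proof.
rewrite -(@arc_class_cst y0); apply: arc_class_homotopic.
apply: arc_homotopic_trans (arc_catVr (tl y)).
apply: arc_cat_homotopic; last exact: arc_homotopic_ext.
apply: arc_homotopic_trans (arc_cat1l _).
by apply: arc_cat_homotopic => //; exact: arc_homotopic_ext.
Qed.

Lemma closed_class_loop (p : arc y0 y0) : closed_class p = arc_class p.
Proof.
apply: arc_class_homotopic; apply: arc_homotopic_trans (arc_cat1r p).
apply: arc_cat_homotopic.
  apply: arc_homotopic_trans (arc_cat1l _).
  by apply: arc_cat_homotopic => //; exact: arc_homotopic_ext.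
apply: arc_homotopic_trans (arc_catVl (tl y0)).
apply: arc_homotopic_trans (arc_homotopic_sym (arc_cat1r _)) _.
by apply: arc_cat_homotopic; [exact: arc_homotopic_ext|exact: arc_homotopic_sym].
Qed.

End closing.

End arcs.

(** * Relative positions of two rings *)

Section pairs.
Variable R : realType.
Local Notation ring := (R * R * R * R)%type.
Implicit Types (C D E : ring) (u v p q a b c : R).

(** The direction of separation is part of the type: for a fixed direction the condition is convex,
    whereas being separated along some direction is not. Its norm is only bounded by [1], so simple
    directions need no square roots. *)
Variant pair_type := Before | After | Inside | Outside | Apart of R & R.

Definition nest C D : bool :=
  (radius C < radius D) &&
  ((cy C - cy D) ^+ 2 + (cz C - cz D) ^+ 2 < (radius D - radius C) ^+ 2).

(* Each condition is open and convex in the pair of rings. *)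
Definition sat (t : pair_type) C D : Prop :=
  match t with
  | Before => cx C < cx D
  | After => cx D < cx C
  | Inside => nest C D
  | Outside => nest D C
  | Apart u v => u ^+ 2 + v ^+ 2 <= 1 /\
      radius C + radius D < (cy C - cy D) * u + (cz C - cz D) * v
  end.

Lemma sum_sqr_le0 p q : p ^+ 2 + q ^+ 2 <= 0 -> p = 0 /\ q = 0.
Proof.
have := sqr_ge0 p; have := sqr_ge0 q => q0 p0 h.
by split; apply/eqP; rewrite -sqrf_eq0; apply/eqP; lra.
Qed.

Lemma cauchy_schwarz_le p q u v (k : R) : 0 <= k -> p ^+ 2 + q ^+ 2 <= k ^+ 2 ->
  u ^+ 2 + v ^+ 2 <= 1 -> p * u + q * v <= k.
Proof.
move=> k0 pq uv; rewrite leNgt; apply/negP => h.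
have h1 : (p * u + q * v) ^+ 2 <= p ^+ 2 + q ^+ 2.
  have e : (p * u + q * v) ^+ 2 + (p * v - q * u) ^+ 2 =
           (p ^+ 2 + q ^+ 2) * (u ^+ 2 + v ^+ 2) by ring.
  have s : 0 <= (p * v - q * u) ^+ 2 by exact: sqr_ge0.
  have t : (p ^+ 2 + q ^+ 2) * (u ^+ 2 + v ^+ 2) <= p ^+ 2 + q ^+ 2.
    by rewrite ler_piMr// addr_ge0// sqr_ge0.
  lra.
have h2 : k ^+ 2 < (p * u + q * v) ^+ 2 by rewrite ltr_pXn2r// nnegrE; lra.
lra.
Qed.

Lemma unit_direction p q : 0 < p ^+ 2 + q ^+ 2 ->
  let m := Num.sqrt (p ^+ 2 + q ^+ 2) in
  [/\ 0 < m, m ^+ 2 = p ^+ 2 + q ^+ 2, (p / m) ^+ 2 + (q / m) ^+ 2 <= 1 &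
      p * (p / m) + q * (q / m) = m].
Proof.
move=> pq m; have m0 : 0 < m by rewrite sqrtr_gt0.
have m2 : m ^+ 2 = p ^+ 2 + q ^+ 2 by rewrite sqr_sqrtr// ltW.
have mn : m != 0 by rewrite gt_eqF.
split=> //; first by rewrite !expr_div_n -mulrDl -m2 divff// expf_neq0.
by rewrite !mulrA -!expr2 -mulrDl -m2 expr2 mulfK.
Qed.

(** Nesting as a family of linear inequalities, one for each direction; convexity ([mix_nest]) and
    transitivity ([nest_trans]) are immediate in this form. *)
Lemma nestP C D : nest C D <-> forall u v, u ^+ 2 + v ^+ 2 <= 1 ->
  (cy C - cy D) * u + (cz C - cz D) * v < radius D - radius C.
Proof.
set p := cy C - cy D; set q := cz C - cz D; set k := radius D - radius C.
have -> : nest C D = (0 < k) && (p ^+ 2 + q ^+ 2 < k ^+ 2) by rewrite subr_gt0.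
split=> [/andP[k0 pq] u v uv|h].
  set m := Num.sqrt (p ^+ 2 + q ^+ 2).
  have pq0 : 0 <= p ^+ 2 + q ^+ 2 by rewrite addr_ge0// sqr_ge0.
  apply: (@le_lt_trans _ _ m).
    apply: cauchy_schwarz_le uv; first exact: sqrtr_ge0.
    by rewrite sqr_sqrtr.
  by rewrite -(@ltr_pXn2r _ 2)// ?nnegrE ?sqrtr_ge0 ?(ltW k0)// sqr_sqrtr.
have k0 : 0 < k by move: (h 0 0); rewrite !mulr0 addr0 !expr2 !mulr0 addr0; apply; exact: ler01.
rewrite k0 /=; have [|] := ltP 0 (p ^+ 2 + q ^+ 2); last first.
  by move=> le0; apply: le_lt_trans le0 _; rewrite exprn_gt0.
move=> /unit_direction; set m := Num.sqrt _ => -[m0 m2 /h + e].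
by rewrite e -m2 => mk; rewrite ltr_pXn2r// nnegrE ltW.
Qed.

(** If the point were not inside [D], the inequality of [nestP] in the direction from the centre of
    [D] to the point would fail. *)
Lemma nest_inside C D p q : 0 <= radius C -> nest C D ->
  (p - cy C) ^+ 2 + (q - cz C) ^+ 2 <= radius C ^+ 2 ->
  (p - cy D) ^+ 2 + (q - cz D) ^+ 2 < radius D ^+ 2.
Proof.
move=> r0 CD pC; have rCD : radius C < radius D by case/andP: CD.
move/nestP in CD; rewrite ltNge; apply/negP => h.
have d0 : 0 < (p - cy D) ^+ 2 + (q - cz D) ^+ 2.
  by apply: lt_le_trans h; rewrite exprn_gt0// (le_lt_trans r0).
have := unit_direction d0; set m := Num.sqrt _ => -[m0 m2 uv e].
have h1 := CD _ _ uv.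
have h2 := cauchy_schwarz_le r0 pC uv.
have h3 : radius D <= m.
  by rewrite -(@ler_pXn2r _ 2)// ?nnegrE ?(ltW m0)// ?m2//; lra.
have : m = (cy C - cy D) * ((p - cy D) / m) + (cz C - cz D) * ((q - cz D) / m) +
    ((p - cy C) * ((p - cy D) / m) + (q - cz C) * ((q - cz D) / m)).
  by rewrite -[LHS]e; ring.
lra.
Qed.

Lemma apart_disjoint C D u v p q : 0 <= radius C -> 0 <= radius D ->
  sat (Apart u v) C D ->
  (p - cy C) ^+ 2 + (q - cz C) ^+ 2 <= radius C ^+ 2 ->
  (p - cy D) ^+ 2 + (q - cz D) ^+ 2 <= radius D ^+ 2 -> False.
Proof.
move=> rC rD [uv h] pC pD.
have h2 := cauchy_schwarz_le rD pD uv.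
have h1 : (p - cy C) * (- u) + (q - cz C) * (- v) <= radius C.
  by apply: cauchy_schwarz_le => //; rewrite !sqrrN.
have : (cy C - cy D) * u + (cz C - cz D) * v =
  (p - cy C) * (- u) + (q - cz C) * (- v) + ((p - cy D) * u + (q - cz D) * v) by ring.
lra.
Qed.

Lemma sat_disjoint t C D : 0 < radius C -> 0 < radius D -> sat t C D ->
  circle C `&` circle D = set0.
Proof.
move=> rC rD h; apply/seteqP; split => // P [[PxC PC] [PxD PD]]; exfalso.
case: t h => [|||| u v] /=.
- by rewrite -PxC -PxD ltxx.
- by rewrite -PxC -PxD ltxx.
- move=> h; have := @nest_inside C D P.1.2 P.2 (ltW rC) h.
  by rewrite PC PD lexx ltxx => /(_ isT).
- move=> h; have := @nest_inside D C P.1.2 P.2 (ltW rD) h.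
  by rewrite PC PD lexx ltxx => /(_ isT).
- by move=> h; apply: (@apart_disjoint C D u v P.1.2 P.2); rewrite ?PC ?PD//; exact: ltW.
Qed.

(** A paraboloid cap that meets the plane of the ring only in the ring; it leaves room for the flat
    disc of a ring nested inside. *)
Definition domed_disc C (p : R * R) : R * R * R :=
  (cx C + (1 - (p.1 ^+ 2 + p.2 ^+ 2)), cy C + radius C * p.1, cz C + radius C * p.2).

Lemma domed_disc_spanning C : 0 < radius C -> spanning_disc (domed_disc C) C.
Proof.
move=> r0; have [_ _ im] := flat_disc_spanning r0.
have rn0 : radius C != 0 by rewrite gt_eqF.
split.
- apply: continuous_subspaceT.
  apply: pair_continuous; first apply: pair_continuous.
  + move=> p; apply: cvgD; first exact: cvg_cst.
    apply: cvgB; first exact: cvg_cst.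
    by apply: cvgD; apply: cvgM; (exact: cvg_fst || exact: cvg_snd).
  + move=> p; apply: cvgD; first exact: cvg_cst.
    by apply: cvgM; [exact: cvg_cst|exact: cvg_fst].
  + move=> p; apply: cvgD; first exact: cvg_cst.
    by apply: cvgM; [exact: cvg_cst|exact: cvg_snd].
- move=> [p1 p2] [q1 q2] _ _ [_ /addrI/(mulfI rn0) -> /addrI/(mulfI rn0) ->].
  by [].
- rewrite -im; apply: eq_imagel => p /= pu.
  by rewrite /domed_disc pu subrr addr0.
Qed.

Lemma flat_disc_inside C (p : R * R) : 0 < radius C -> unit_disc p ->
  ((flat_disc C p).1.2 - cy C) ^+ 2 + ((flat_disc C p).2 - cz C) ^+ 2 <= radius C ^+ 2.
Proof.
move=> r0 pu; rewrite /flat_disc /= !(addrC (cy C)) !(addrC (cz C)) !addrK.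
by rewrite !exprMn -mulrDr ler_piMr// exprn_ge0// ltW.
Qed.

Lemma unlinked_sym C D : unlinked C D -> unlinked D C.
Proof. by move=> [f [g [fC gD fg]]]; exists g, f; split=> //; rewrite setIC. Qed.

(** Flat discs are disjoint except for coplanar nested rings, where the outer one gets the dome. *)
Lemma sat_unlinked t C D : 0 < radius C -> 0 < radius D -> sat t C D ->
  unlinked C D.
Proof.
have nst C' D' : cx C' = cx D' -> 0 < radius C' -> 0 < radius D' -> nest C' D' -> unlinked C' D'.
  move=> CD r0 s0 h; exists (flat_disc C'), (domed_disc D'); split.
  - exact: flat_disc_spanning.
  - exact: domed_disc_spanning.
  apply/seteqP; split=> // _ [[p pu <-] [q qu e]].
  have := nest_inside (ltW r0) h (flat_disc_inside r0 pu).
  rewrite -e /= => hq; exfalso.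
  have := congr1 (fun w => w.1.1) e; rewrite /= -CD => ex.
  have q1 : q.1 ^+ 2 + q.2 ^+ 2 = 1 by lra.
  move: hq; rewrite !(addrC (cy D')) !(addrC (cz D')) !addrK !exprMn -mulrDr q1.
  by rewrite mulr1 ltxx.
move=> rC rD h; have [e|ne] := eqVneq (cx C) (cx D); last first.
  exists (flat_disc C), (flat_disc D); split; try exact: flat_disc_spanning.
  apply/seteqP; split=> // _ [[p _ <-] [q _ /(congr1 (fun w => w.1.1)) /= e]].
  by rewrite e eqxx in ne.
case: t h => [|||| u v].
- by rewrite /= e ltxx.
- by rewrite /= e ltxx.
- exact: nst.
- by move=> /(nst _ _ (esym e) rD rC)/unlinked_sym.
- move=> h; exists (flat_disc C), (flat_disc D); split; try exact: flat_disc_spanning.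
  apply/seteqP; split=> // P [[p pu pP] [q qu qP]].
  have := flat_disc_inside rC pu; have := flat_disc_inside rD qu.
  rewrite pP qP => hD hC.
  exact: (apart_disjoint (ltW rC) (ltW rD) h hC hD).
Qed.

Lemma circles_meet (p q r s m : R) : 0 < r -> 0 < s -> 0 < m ->
  m ^+ 2 = p ^+ 2 + q ^+ 2 -> m <= r + s -> r - s <= m -> s - r <= m ->
  exists x y, x ^+ 2 + y ^+ 2 = r ^+ 2 /\ (x + p) ^+ 2 + (y + q) ^+ 2 = s ^+ 2.
Proof.
move=> r0 s0 m0 m2 h1 h2 h3; have mn : m != 0 by rewrite gt_eqF.
pose a := (s ^+ 2 - r ^+ 2 - m ^+ 2) / (2 * m ^+ 2).
have am : 2 * a * m ^+ 2 = s ^+ 2 - r ^+ 2 - m ^+ 2 by rewrite /a; field.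
have b0 : 0 <= r ^+ 2 / m ^+ 2 - a ^+ 2.
  have -> : r ^+ 2 / m ^+ 2 - a ^+ 2 =
    ((r + s - m) * (m + s - r) * ((m + r - s) * (m + r + s))) / (2 * m ^+ 2) ^+ 2.
    by rewrite /a; field.
  apply: divr_ge0; last exact: sqr_ge0.
  by apply: mulr_ge0; apply: mulr_ge0; lra.
pose b := Num.sqrt (r ^+ 2 / m ^+ 2 - a ^+ 2).
have b2 : b ^+ 2 = r ^+ 2 / m ^+ 2 - a ^+ 2 by rewrite sqr_sqrtr.
have e1 : (a ^+ 2 + b ^+ 2) * m ^+ 2 = r ^+ 2 by rewrite b2; field.
exists (a * p - b * q), (a * q + b * p); split.
  by rewrite -e1 m2; ring.
transitivity ((a ^+ 2 + b ^+ 2) * m ^+ 2 + 2 * a * m ^+ 2 + m ^+ 2).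
  by rewrite m2; ring.
by rewrite e1 am; ring.
Qed.

(** In a common plane the distance of the centres is compared with the sum and the difference of the
    radii; between these bounds [circles_meet] gives a common point. *)
Lemma disjoint_sat C D : 0 < radius C -> 0 < radius D ->
  circle C `&` circle D = set0 -> exists t, sat t C D.
Proof.
move=> rC rD CD.
have [h|h|xCD] := ltgtP (cx C) (cx D); [by exists Before|by exists After|].
have meet x y : x ^+ 2 + y ^+ 2 = radius C ^+ 2 ->
  (x + (cy C - cy D)) ^+ 2 + (y + (cz C - cz D)) ^+ 2 = radius D ^+ 2 -> False.
  move=> h1 h2; have : set0 (cx C, x + cy C, y + cz C); last by [].
  rewrite -CD; split; split=> //=; first by rewrite !addrK.
  by rewrite -h2 -!addrA.
set p := cy C - cy D in meet; set q := cz C - cz D in meet.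
have [pq|pq] := ltP 0 (p ^+ 2 + q ^+ 2); last first.
  have [p0 q0] := sum_sqr_le0 pq.
  have [h|h|h] := ltgtP (radius C) (radius D).
  - exists Inside; rewrite /= /nest h -/p -/q p0 q0 expr0n /= addr0.
    by rewrite exprn_gt0// subr_gt0.
  - exists Outside; rewrite /= /nest h -(sqrrN (cy D - _)) -(sqrrN (cz D - _)) !opprB -/p -/q p0 q0 expr0n /= addr0.
    by rewrite exprn_gt0// subr_gt0.
  - exfalso; apply: (meet (radius C) 0); first by rewrite expr0n addr0.
    by rewrite p0 q0 !addr0 expr0n addr0 h.
have := unit_direction pq; set m := Num.sqrt _ => -[m0 m2 uv e].
have [h1|h1] := ltP (radius C + radius D) m.
  by exists (Apart (p / m) (q / m)); split => //; rewrite e.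
have [h2|h2] := ltP m (radius D - radius C).
  exists Inside; rewrite /= /nest -/p -/q -m2 ltr_pXn2r ?nnegrE ?(ltW m0)//; last by lra.
  by apply/andP; split => //; lra.
have [h3|h3] := ltP m (radius C - radius D).
  exists Outside; rewrite /= /nest -(sqrrN (cy D - _)) -(sqrrN (cz D - _)) !opprB -/p -/q -m2.
  rewrite ltr_pXn2r ?nnegrE ?(ltW m0)//; last by lra.
  by apply/andP; split => //; lra.
have [x [y [hx hy]]] := circles_meet rC rD m0 m2 h1 h3 h2.
by exfalso; exact: meet hx hy.
Qed.

Lemma nested_nest C D : 0 < radius C -> 0 < radius D -> cx C = cx D ->
  nested C D <-> nest C D.
Proof.
move=> rC rD xCD; split=> [h|h P [Px PC]]; last first.
  by split; [rewrite Px|apply: nest_inside (ltW rC) h _; rewrite PC].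
have {}h x y : x ^+ 2 + y ^+ 2 = radius C ^+ 2 ->
  (x + (cy C - cy D)) ^+ 2 + (y + (cz C - cz D)) ^+ 2 < radius D ^+ 2.
  move=> xy; have /(_ (cx C, x + cy C, y + cz C)) := h.
  by case; [split=> //=; rewrite !addrK|move=> _ /=; rewrite -!addrA].
set p := cy C - cy D in h; set q := cz C - cz D in h.
rewrite /nest -/p -/q.
have [pq|pq] := ltP 0 (p ^+ 2 + q ^+ 2); last first.
  have [p0 q0] := sum_sqr_le0 pq.
  have := h (radius C) 0; rewrite p0 q0 expr0n /= !addr0 expr0n addr0 => /(_ erefl).
  rewrite ltr_pXn2r ?nnegrE ?ltW// => rr; rewrite rr /=.
  by rewrite exprn_gt0// subr_gt0.
have := unit_direction pq; set m := Num.sqrt _ => -[m0 m2 uv e].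
have mn : m != 0 by rewrite gt_eqF.
(* The point of [C] farthest from the centre of [D], relative to the centre of [C]. *)
have := h (radius C * p / m) (radius C * q / m).
have -> : (radius C * p / m) ^+ 2 + (radius C * q / m) ^+ 2 = radius C ^+ 2 * (p ^+ 2 + q ^+ 2) / m ^+ 2 by field.
rewrite -m2 mulfK ?expf_neq0// => /(_ erefl).
have -> : (radius C * p / m + p) ^+ 2 + (radius C * q / m + q) ^+ 2 =
   (radius C / m + 1) ^+ 2 * (p ^+ 2 + q ^+ 2) by field.
rewrite -m2 -exprMn mulrDl mul1r divfK// ltr_pXn2r ?nnegrE ?(ltW rD)//; last by lra.
by move=> rm; rewrite ltr_pXn2r ?nnegrE ?(ltW m0)//; last lra; apply/andP; split; lra.
Qed.

(** Three vertices serve for triangles and, with a weight [0], for segments. *)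
Definition mix a b c C D E : ring :=
  (a * cx C + b * cx D + c * cx E, a * cy C + b * cy D + c * cy E,
   a * cz C + b * cz D + c * cz E, a * radius C + b * radius D + c * radius E).

Definition weights a b c := [/\ 0 <= a, 0 <= b, 0 <= c & a + b + c = 1].

Lemma mix_gt0 a b c (x y z : R) : weights a b c -> 0 < x -> 0 < y -> 0 < z ->
  0 < a * x + b * y + c * z.
Proof.
move=> [a0 b0 c0 s] x0 y0 z0.
have ha : 0 <= a * x by rewrite mulr_ge0// ltW.
have hb : 0 <= b * y by rewrite mulr_ge0// ltW.
have hc : 0 <= c * z by rewrite mulr_ge0// ltW.
have [a1|a1] := ltP 0 a; first by have := mulr_gt0 a1 x0; lra.
have [b1|b1] := ltP 0 b; first by have := mulr_gt0 b1 y0; lra.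
have c1 : 0 < c by lra.
by have := mulr_gt0 c1 z0; lra.
Qed.

Lemma mix_lt a b c (x y z x' y' z' : R) : weights a b c ->
  x < x' -> y < y' -> z < z' -> a * x + b * y + c * z < a * x' + b * y' + c * z'.
Proof.
move=> w; rewrite -(subr_gt0 x) -(subr_gt0 y) -(subr_gt0 z) => h1 h2 h3.
have := mix_gt0 w h1 h2 h3; lra.
Qed.

Lemma mix_nest a b c C D E C' D' E' : weights a b c ->
  nest C C' -> nest D D' -> nest E E' ->
  nest (mix a b c C D E) (mix a b c C' D' E').
Proof.
move=> w /nestP h1 /nestP h2 /nestP h3; apply/nestP => u v uv.
have := mix_lt w (h1 _ _ uv) (h2 _ _ uv) (h3 _ _ uv).
rewrite /mix /cy /cz /radius /=; lra.
Qed.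

Lemma mix_sat t a b c C D E C' D' E' : weights a b c ->
  sat t C C' -> sat t D D' -> sat t E E' ->
  sat t (mix a b c C D E) (mix a b c C' D' E').
Proof.
move=> w; case: t => [|||| u v].
- exact: mix_lt.
- exact: mix_lt.
- exact: mix_nest.
- exact: mix_nest.
- move=> [uv h1] [_ h2] [_ h3]; split=> //.
  have := mix_lt w h1 h2 h3; rewrite /mix /cy /cz /radius /=; lra.
Qed.

End pairs.

Arguments Before {R}.
Arguments After {R}.
Arguments Inside {R}.
Arguments Outside {R}.

(** * The configuration space *)

Section open_pairs.
Variable R : realType.
Local Notation ring := (R * R * R * R)%type.

Lemma cx_cts : continuous (@cx R).
Proof. by do 2 apply: comp_cts (@fst_continuous _ _); exact: fst_continuous. Qed.

Lemma cy_cts : continuous (@cy R).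
Proof.
apply: (@comp_cts _ _ _ (fun C : ring => C.1.1) snd); last exact: snd_continuous.
by apply: comp_cts (@fst_continuous _ _); exact: fst_continuous.
Qed.

Lemma cz_cts : continuous (@cz R).
Proof. by apply: comp_cts (@snd_continuous _ _); exact: fst_continuous. Qed.

Lemma radius_cts : continuous (@radius R).
Proof. exact: snd_continuous. Qed.

Lemma near_lt (T : topologicalType) (f g : T -> R) (x : T) :
  continuous f -> continuous g -> f x < g x -> \forall y \near x, f y < g y.
Proof.
move=> cf cg; rewrite -subr_gt0 => h.
have c : (fun y => g y - f y) @ x --> g x - f x by apply: cvgB; [exact: cg|exact: cf].
have := c _ (lt_nbhsr h); rewrite /fmap /= -/(nbhs x).
by apply: (@filterS _ (nbhs x)) => y /=; rewrite subr_gt0.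
Qed.

Lemma cts2 (f : ring -> R) : continuous f ->
  continuous (fun w : ring * ring => f w.1) /\ continuous (fun w : ring * ring => f w.2).
Proof.
by move=> cf; split; apply: comp_cts cf; [exact: fst_continuous|exact: snd_continuous].
Qed.

Lemma sub_cts (T : topologicalType) (f g : T -> R) : continuous f ->
  continuous g -> continuous (fun x => f x - g x).
Proof. by move=> cf cg x; apply: cvgB; [exact: cf|exact: cg]. Qed.

Lemma add_cts (T : topologicalType) (f g : T -> R) : continuous f ->
  continuous g -> continuous (fun x => f x + g x).
Proof. by move=> cf cg x; apply: cvgD; [exact: cf|exact: cg]. Qed.

Lemma mul_cts (T : topologicalType) (f g : T -> R) : continuous f ->
  continuous g -> continuous (fun x => f x * g x).
Proof. by move=> cf cg x; apply: cvgM; [exact: cf|exact: cg]. Qed.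

Lemma cst_cts (T U : topologicalType) (c : U) : continuous (fun _ : T => c).
Proof. by move=> x; exact: cvg_cst. Qed.

Lemma nest_near (C D : ring) : nest C D -> \forall w \near (C, D), nest w.1 w.2.
Proof.
have [x1 x2] := cts2 cx_cts; have [y1 y2] := cts2 cy_cts.
have [z1 z2] := cts2 cz_cts; have [r1 r2] := cts2 radius_cts.
move=> /andP[h1 h2].
have n1 : \forall w \near (C, D), radius w.1 < radius w.2 by exact: near_lt.
have n2 : \forall w \near (C, D),
   (cy w.1 - cy w.2) ^+ 2 + (cz w.1 - cz w.2) ^+ 2 < (radius w.2 - radius w.1) ^+ 2.
  apply: (@near_lt _ (fun w : ring * ring => (cy w.1 - cy w.2) ^+ 2 + (cz w.1 - cz w.2) ^+ 2)
    (fun w => (radius w.2 - radius w.1) ^+ 2) (C, D) _ _ h2); last by apply: mul_cts; exact: sub_cts.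
  by apply: add_cts; apply: mul_cts; exact: sub_cts.
by apply: filterS2 n1 n2 => w w1 w2; apply/andP.
Qed.

Lemma sat_near t (C D : ring) : sat t C D -> \forall w \near (C, D), sat t w.1 w.2.
Proof.
have [x1 x2] := cts2 cx_cts; have [y1 y2] := cts2 cy_cts.
have [z1 z2] := cts2 cz_cts; have [r1 r2] := cts2 radius_cts.
case: t => [|||| u v].
- by move=> h; exact: near_lt.
- by move=> h; exact: near_lt.
- exact: nest_near.
- move=> /nest_near h.
  have c : (fun w : ring * ring => (w.2, w.1)) @ (C, D) --> (D, C).
    by apply: pair_continuous; [exact: snd_continuous|exact: fst_continuous].
  exact: c _ h.
- move=> [uv h].
  have n : \forall w \near (C, D), radius w.1 + radius w.2 <
     (cy w.1 - cy w.2) * u + (cz w.1 - cz w.2) * v.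
    apply: (@near_lt _ (fun w : ring * ring => radius w.1 + radius w.2)
      (fun w => (cy w.1 - cy w.2) * u + (cz w.1 - cz w.2) * v) (C, D) _ _ h); first exact: add_cts.
    by apply: add_cts; apply: mul_cts; by [exact: sub_cts|exact: cst_cts].
  by apply: filterS n => w; split.
Qed.

End open_pairs.

Section configurations.
Local Open Scope quotient_scope.
Variables (R : realType) (n : nat).
Local Notation ring := (R * R * R * R)%type.
Implicit Types (P Q : 'I_n -> ring).

(** The description by pair types, convex for a fixed choice of types, is the working one; [validP]
    compares it with [ordered_rings]. *)
Definition valid P := (forall a, 0 < radius (P a)) /\
  forall a b, a != b -> exists t, sat t (P a) (P b).

Lemma validP P : valid P <-> (\row_j P j) \in @ordered_rings R n.
Proof.
rewrite inE; split=> [[r0 h]|[r0 h]].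
  split=> [a|a b ab]; rewrite !mxE//.
  by have [t tab] := h _ _ ab; split; [exact: sat_disjoint tab|exact: sat_unlinked tab].
split=> [a|a b ab]; first by have := r0 a; rewrite mxE.
have [+ _] := h _ _ ab; rewrite !mxE; apply: disjoint_sat.
  by have := r0 a; rewrite mxE.
by have := r0 b; rewrite mxE.
Qed.

(** Total, with the base configuration as default, so that families of rings can be handled without
    carrying proofs of validity. *)
Definition to_ordered P : @ordered_rings R n :=
  match pselect (valid P) with
  | left h => exist (fun c => c \in @ordered_rings R n) _ ((validP P).1 h)
  | right _ => base_ordered R n
  end.

Definition config P : UR R n := unordered (to_ordered P).

Lemma ringj_to_ordered P j : valid P -> ringj (to_ordered P) j = P j.
Proof.
move=> vP; rewrite /to_ordered; case: pselect => // h.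
by rewrite /ringj set_valE /= mxE.
Qed.

Lemma ringj_inj (c d : @ordered_rings R n) : (forall j, ringj c j = ringj d j) -> c = d.
Proof.
move=> cd; apply: val_inj; apply/matrixP => i j; rewrite !ord1.
by have := cd j; rewrite /ringj !set_valE.
Qed.

Lemma valid_ringj (c : @ordered_rings R n) : valid (ringj c).
Proof.
apply/validP; rewrite (_ : \row_j _ = set_val c).
  by rewrite set_valE; case: c.
by apply/matrixP => i j; rewrite mxE ord1.
Qed.

Lemma to_orderedK (c : @ordered_rings R n) : to_ordered (ringj c) = c.
Proof. by apply: ringj_inj => j; rewrite ringj_to_ordered//; exact: valid_ringj. Qed.

Lemma unorderedP (c d : @ordered_rings R n) : unordered c = unordered d <->
  exists s : {perm 'I_n}, forall j, ringj d j = ringj c (s j).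
Proof.
split=> [/eqquotP/existsP[s /forallP h]|[s h]].
  by exists s => j; apply/eqP.
by apply/eqquotP/existsP; exists s; apply/forallP => j; apply/eqP.
Qed.

Lemma valid_perm P (s : {perm 'I_n}) : valid P -> valid (P \o s).
Proof. by move=> [r h]; split=> [a|a b ab] //=; apply: h; rewrite (inj_eq perm_inj). Qed.

Lemma config_perm P (s : {perm 'I_n}) : valid P -> config (P \o s) = config P.
Proof.
move=> vP; apply/esym/unorderedP; exists s => j.
by rewrite !ringj_to_ordered//; exact: valid_perm.
Qed.

Lemma config_eq P Q : valid P -> valid Q -> config P = config Q ->
  exists s : {perm 'I_n}, Q =1 P \o s.
Proof.
move=> vP vQ /unorderedP[s h]; exists s => j.
by have := h j; rewrite !ringj_to_ordered.
Qed.

Lemma configP (y : UR R n) : exists2 P, valid P & config P = y.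
Proof.
exists (ringj (repr y)); first exact: valid_ringj.
by rewrite /config to_orderedK /unordered reprK.
Qed.

Lemma ringj_cts j : continuous (fun c : @ordered_rings R n => ringj c j).
Proof.
apply: (@comp_cts _ _ _ set_val (fun M : 'rV[ring]_n => M ord0 j)).
  exact: initial_continuous.
move=> M U MU; exists (fun i k => if k == j then U else setT) => [i k|N /= h].
  by case: eqP => [->|_]; [rewrite ord1|exact: filterT].
by have := h ord0 j; rewrite eqxx.
Qed.

Lemma to_ordered_cts (Z : topologicalType) (F : Z -> 'I_n -> ring) :
  (forall z, valid (F z)) -> (forall a, continuous (fun z => F z a)) ->
  continuous (fun z => to_ordered (F z)).
Proof.
move=> vF cF; apply: (@continuous_comp_initial).
have -> : set_val \o (fun z => to_ordered (F z)) = fun z => \row_j F z j.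
  apply/funext => z; apply/matrixP => i j; rewrite mxE ord1.
  exact: (ringj_to_ordered j (vF z)).
move=> z U [A /= zA sA]; apply: (@filterS _ (nbhs z) _ (fun z' => forall j, A ord0 j (F z' j))).
  by move=> z' h; apply: sA => i j; rewrite ord1 mxE.
apply: filter_forall => j; apply: cF; have := zA ord0 j; by rewrite mxE.
Qed.

Lemma config_cts (Z : topologicalType) (F : Z -> 'I_n -> ring) :
  (forall z, valid (F z)) -> (forall a, continuous (fun z => F z a)) ->
  continuous (fun z => config (F z)).
Proof.
move=> vF cF; apply: (@comp_cts _ _ _ (fun z => to_ordered (F z)) (\pi_(UR R n))).
  exact: to_ordered_cts.
exact: pi_continuous.
Qed.

Definition within_dist (e : R) P Q := forall a, `|P a - Q a| < e.

(** The quotient map is open: a relabelling [s] that brings one representative [c] near to [P] also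
    brings the neighbours of [c] near to [P]. *)
Lemma config_nbhs P (e : R) : valid P -> 0 < e ->
  nbhs (config P) [set config Q | Q in [set Q | valid Q /\ within_dist e P Q]].
Proof.
move=> vP e0; apply: open_nbhs_nbhs; split; last first.
  by exists P => //; split=> // a; rewrite subrr normr0.
rewrite /open /= /quotient_open openE => c /= [Q [vQ PQ] Qc].
have /unorderedP [s sc] : unordered c = unordered (to_ordered Q) by exact: esym Qc.
have {}sc j : Q j = ringj c (s j) by rewrite -sc ringj_to_ordered.
rewrite /interior /=.
have : nbhs c [set d : @ordered_rings R n | forall a, `|P a - ringj d (s a)| < e].
  suff h : forall a, nbhs c [set d : @ordered_rings R n | `|P a - ringj d (s a)| < e].
    exact: (@filter_forall _ _ _ _ _ h).
  move=> a.
  have c1 : continuous (fun d : @ordered_rings R n => `|P a - ringj d (s a)|).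
    apply: (@comp_cts _ _ _ (fun d => ringj d (s a)) (fun C : ring => `|P a - C|)).
      exact: ringj_cts.
    by move=> C; apply: cvg_norm; apply: cvgB; [exact: cvg_cst|exact: cvg_id].
  have h : `|P a - ringj c (s a)| < e by rewrite -sc.
  exact: (near_lt c1 (@cst_cts _ _ e) h).
apply: filterS => d hd; exists (ringj d \o s) => /=.
  by split; [apply: valid_perm; exact: valid_ringj|exact: hd].
by rewrite config_perm ?/config ?to_orderedK//; exact: valid_ringj.
Qed.

Lemma valid_neq P a b : valid P -> a != b -> P a != P b.
Proof.
move=> [r h] /h [t]; apply: contraPN => /eqP ->.
case: t => [|||| u v] /=; rewrite /nest ?ltxx//= => -[uv].
by rewrite !subrr !mul0r addr0; have := r b; lra.
Qed.

Lemma coherent_near P : valid P ->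
  \forall e \near 0^'+, forall a b, a != b ->
    exists t, forall Q, within_dist e P Q -> sat t (Q a) (Q b).
Proof.
move=> [r h]; apply: filter_forall => a; apply: filter_forall => b.
have [->|ab] := eqVneq a b; first by near=> e.
have [t tab] := h _ _ ab.
have [[U V] /= [/nbhs_ballP[d /= d0 dU] /nbhs_ballP[f /= f0 fV]] UV] := sat_near tab.
near=> e => _; exists t => Q PQ; apply: (UV (Q a, Q b)); split=> /=.
  apply: dU; rewrite -ball_normE /ball_ /=; apply: lt_le_trans (PQ a) _.
  by near: e; exact: nbhs_right_le.
apply: fV; rewrite -ball_normE /ball_ /=; apply: lt_le_trans (PQ b) _.
by near: e; exact: nbhs_right_le.
Unshelve. all: by end_near. Qed.

End configurations.

(** * Presented groups *)

Section presented_group.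
Local Open Scope quotient_scope.
Variables (S : choiceType) (rel : word S -> word S -> Prop).

Definition word_eqb (u v : word S) : bool := `[< word_eq rel u v >].

Fact word_eqb_refl : reflexive word_eqb.
Proof. by move=> u; apply/asboolP; exact: word_eq_refl. Qed.

Fact word_eqb_sym : symmetric word_eqb.
Proof. by move=> u v; apply/asboolP/asboolP => /word_eq_sym. Qed.

Fact word_eqb_trans : transitive word_eqb.
Proof. by move=> v u w /asboolP uv /asboolP vw; apply/asboolP; exact: word_eq_trans vw. Qed.

Canonical word_eqb_equiv := EquivRel word_eqb word_eqb_refl word_eqb_sym word_eqb_trans.

Definition presented := {eq_quot word_eqb}.

HB.instance Definition _ := Choice.on presented.
HB.instance Definition _ := EqQuotient.on presented.

Definition word_class (u : word S) : presented := \pi u.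

Lemma word_classP u v : word_class u = word_class v <-> word_eq rel u v.
Proof. by split=> [/eqquotP/asboolP|h]; [|apply/eqquotP/asboolP]. Qed.

Definition word_repr (x : presented) : word S := repr x.

Lemma word_reprK x : word_class (word_repr x) = x.
Proof. exact: reprK. Qed.

Definition word_inv (u : word S) : word S := rev [seq (x.1, ~~ x.2) | x <- u].

Lemma word_inv_cat u v : word_inv (u ++ v) = word_inv v ++ word_inv u.
Proof. by rewrite /word_inv map_cat rev_cat. Qed.

Lemma word_invK u : word_inv (word_inv u) = u.
Proof.
rewrite /word_inv map_rev revK -map_comp; elim: u => [|[x b] u IH] //=.
by rewrite negbK IH.
Qed.

Lemma word_mulV u : word_eq rel (u ++ word_inv u) [::].
Proof.
elim: u => [|[x b] u IH]; first exact: word_eq_refl.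
rewrite -cat1s word_inv_cat /= -cat_cons catA -(cat1s (x, b)) -!catA.
apply: word_eq_trans (word_eq_cancel _ x b).
rewrite -[X in word_eq _ _ X]/([:: (x, b)] ++ [::] ++ [:: (x, ~~ b)]).
apply: word_eq_cat; first exact: word_eq_refl.
by rewrite catA; apply: word_eq_cat => //; exact: word_eq_refl.
Qed.

(** By uniqueness of inverses, which spares an induction over the congruence. *)
Lemma word_eq_inv u v : word_eq rel u v -> word_eq rel (word_inv u) (word_inv v).
Proof.
move=> uv.
have h : word_eq rel (word_inv u ++ (v ++ word_inv v)) (word_inv u).
  rewrite -[X in word_eq _ _ X]cats0; apply: word_eq_cat; [exact: word_eq_refl|exact: word_mulV].
apply: word_eq_trans (word_eq_sym h) _; rewrite catA -[X in word_eq _ _ X]cat0s.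
apply: word_eq_cat; last exact: word_eq_refl.
apply: word_eq_trans (word_mulV (word_inv u)).
rewrite word_invK; apply: word_eq_cat; first exact: word_eq_refl.
exact: word_eq_sym.
Qed.

Definition presented_mul (x y : presented) := word_class (word_repr x ++ word_repr y).
Definition presented_one := word_class [::].
Definition presented_inv (x : presented) := word_class (word_inv (word_repr x)).

Lemma word_class_cat u v : word_class (u ++ v) = presented_mul (word_class u) (word_class v).
Proof.
by apply/word_classP/word_eq_cat; apply/word_classP; rewrite word_reprK.
Qed.

Lemma word_class_inv u : word_class (word_inv u) = presented_inv (word_class u).
Proof. by apply/word_classP/word_eq_inv/word_classP; rewrite word_reprK. Qed.

Fact presented_mulA : associative presented_mul.
Proof.
move=> x y z; rewrite -[x]word_reprK -[y]word_reprK -[z]word_reprK.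
by rewrite -!word_class_cat catA.
Qed.

Fact presented_mul1 : left_id presented_one presented_mul.
Proof. by move=> x; rewrite -[x]word_reprK -word_class_cat. Qed.

Fact presented_mulr1 : right_id presented_one presented_mul.
Proof. by move=> x; rewrite -[x]word_reprK -word_class_cat cats0. Qed.

Fact presented_mulrV : right_inverse presented_one presented_inv presented_mul.
Proof.
move=> x; rewrite -[x]word_reprK -word_class_inv -word_class_cat.
exact/word_classP/word_mulV.
Qed.

Fact presented_mulV : left_inverse presented_one presented_inv presented_mul.
Proof.
move=> x; rewrite -[x]word_reprK -word_class_inv -word_class_cat.
by apply/word_classP; have := word_mulV (word_inv (word_repr x)); rewrite word_invK.
Qed.

HB.instance Definition _ := isGroup.Build presented presented_mulA presented_mul1
  presented_mulr1 presented_mulV presented_mulrV.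

Lemma word_classM u v : word_class (u ++ v) = (word_class u * word_class v)%g.
Proof. exact: word_class_cat. Qed.

Lemma word_classV x : word_class [:: (x, true)] = ((word_class [:: (x, false)])^-1)%g.
Proof. exact: (word_class_inv [:: (x, false)]). Qed.

Lemma word_val_class u : word_val (fun x => word_class [:: (x, false)]) u = word_class u.
Proof.
elim: u => [|[x b] u IH]; first by rewrite /word_val big_nil.
have := IH; rewrite /word_val big_cons => -> /=.
have -> : word_class ((x, b) :: u) = (word_class [:: (x, b)] * word_class u)%g.
  exact: (word_classM [:: (x, b)] u).
by case: b => //=; rewrite word_classV.
Qed.

End presented_group.

Section word_values.
Variables (S : Type) (Gm : groupType) (g : S -> Gm).

Lemma word_val_nil : word_val g [::] = 1%g.
Proof. by rewrite /word_val big_nil. Qed.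

Lemma word_val_cons x b u : word_val g ((x, b) :: u) =
  ((if b then (g x)^-1 else g x) * word_val g u)%g.
Proof. by rewrite /word_val big_cons. Qed.

Lemma word_val_cat u v : word_val g (u ++ v) = (word_val g u * word_val g v)%g.
Proof. by rewrite /word_val big_cat. Qed.

Lemma word_val_morph (Gm' : groupType) (f : Gm -> Gm') u :
  {morph f : x y / (x * y)%g >-> (x * y)%g} ->
  f (word_val g u) = word_val (f \o g) u.
Proof.
move=> fM; have f1 : f 1%g = 1%g by apply: (mulgI (f 1%g)); rewrite -fM !mulg1.
have fV x : f (x^-1)%g = ((f x)^-1)%g by apply: (mulgI (f x)); rewrite -fM !mulgV.
elim: u => [|[x b] u IH]; first by rewrite !/word_val !big_nil.
by rewrite word_val_cons fM IH /word_val big_cons /=; case: b => //; rewrite fV.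
Qed.

Lemma word_val_eq rel u v : (forall u v, rel u v -> word_val g u = word_val g v) ->
  word_eq rel u v -> word_val g u = word_val g v.
Proof.
move=> h; elim=> //.
- by move=> u1 v1 w1 _ -> _ ->.
- by move=> u1 u2 v1 v2 _ e1 _ e2; rewrite !word_val_cat e1 e2.
- move=> x b; rewrite !word_val_cons word_val_nil mulg1.
  by case: b => /=; rewrite ?mulVg ?mulgV.
Qed.

End word_values.

(** * Letters of exchanges and the hexagon identities *)

Variant kind := Inner | Outer | Separate.

Definition opp_kind k := match k with Inner => Outer | Outer => Inner | Separate => Separate end.

(* [p], [q], [r] are the kinds of the pairs (a, y), (a, x) and (y, x) for three
   pairwise disjoint circles a, x, y in a plane; the other eleven combinations
   contradict transitivity of nesting, or put a circle inside two separate ones. *)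
Definition consistent p q r : bool :=
  match p, q, r with
  | Separate, _, Separate | _, Separate, Separate | Separate, Separate, _ => true
  | Separate, Inner, Inner | Inner, Separate, Outer | Outer, Outer, Separate => true
  | Inner, Inner, Inner | Inner, Inner, Outer | Outer, Inner, Inner => true
  | Outer, Outer, Inner | Inner, Outer, Outer | Outer, Outer, Outer => true
  | _, _, _ => false
  end.

Section letters.
Local Open Scope group_scope.
Variable Gm : groupType.

(** When the left ring is the outer one, the motion is a passage through run backwards, hence the
    inverse of [rh]. *)
Definition letter (sg rh : Gm) k : Gm :=
  match k with Inner => rh | Outer => rh^-1 | Separate => sg end.

Lemma letter_opp sg rh k : sg * sg = 1 -> letter sg rh k * letter sg rh (opp_kind k) = 1.
Proof. by move=> s2; case: k => //=; rewrite ?mulgV ?mulVg. Qed.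

Lemma letter_commute sg rh sg' rh' k k' : commute sg sg' -> commute rh rh' ->
  commute rh sg' -> commute sg rh' -> commute (letter sg rh k) (letter sg' rh' k').
Proof.
move=> c1 c2 c3 c4; case: k; case: k' => //=.
- exact: commuteV.
- exact/commute_sym/commuteV/commute_sym.
- exact/commuteV/commute_sym/commuteV/commute_sym.
- exact/commute_sym/commuteV/commute_sym.
- exact: commuteV.
Qed.

Lemma intertwineV (x y w : Gm) : x * w = w * y -> x^-1 * w = w * y^-1.
Proof. by move=> h; apply: (mulgI x); rewrite mulVKg mulgA h mulgK. Qed.

Lemma intertwine_conj (x y w : Gm) : x * w = w * y -> w^-1 * x = y * w^-1.
Proof. by move=> h; apply: (mulgI w); rewrite mulVKg mulgA -h mulgK. Qed.

(** Each of the sixteen consistent cases is one of the given relations, possibly inverted or with a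
    letter carried to the other side. *)
Lemma letter_hexagon (si ri sj rj : Gm) p q r :
  si * si = 1 -> sj * sj = 1 ->
  ri * rj * ri = rj * ri * rj -> si * sj * si = sj * si * sj ->
  ri * sj * si = sj * si * rj -> si * sj * ri = rj * si * sj ->
  si * rj * ri = rj * ri * sj -> consistent p q r ->
  letter si ri p * letter sj rj q * letter si ri r =
  letter sj rj r * letter si ri q * letter sj rj p.
Proof.
move=> s2 t2 br bs m1 m2 m3.
have siV : si^-1 = si by apply: (mulgI si); rewrite mulgV s2.
have sjV : sj^-1 = sj by apply: (mulgI sj); rewrite mulgV t2.
(* The hexagon in which only the pair (a, x) is nested; it is not among the relations but follows
   from [m1] because the [sigma] letters are involutions. *)
have m1' : si * rj * si = sj * ri * sj.
  have := congr1 (fun x => sj * x) m1; rewrite !mulgA t2 mul1g => <-.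
  by rewrite -(mulgA _ si si) s2 mulg1.
have b1 : ri * rj * ri^-1 = rj^-1 * ri * rj.
  by apply: (mulgI rj); rewrite !mulgA mulgV mul1g -br mulgK.
have b2 : ri^-1 * rj * ri = rj * ri * rj^-1.
  by apply: (mulgI ri); rewrite !mulgA mulgV mul1g br mulgK.
case: p; case: q; case: r => //= _.
- by have := congr1 (fun x => x^-1) b1; rewrite !invgM !invgK !mulgA.
- by apply: (mulgI rj); rewrite !mulgA mulgV mul1g -m3 mulgK.
- by have := congr1 (fun x => x^-1) b2; rewrite !invgM !invgK !mulgA.
- by have := congr1 (fun x => x^-1) br; rewrite !invgM !mulgA.
- by have := @intertwine_conj si sj (rj * ri); rewrite !mulgA !invgM !mulgA; apply.
- by have := @intertwineV ri rj (sj * si); rewrite !mulgA; apply.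
- by have := congr1 (fun x => x^-1) m1'; rewrite !invgM siV sjV !mulgA.
- have := @intertwineV rj ri (si * sj); rewrite !mulgA m2 => /(_ erefl) ->.
  by [].
Qed.

End letters.

(** * Orders and straight paths *)

Section orders.
Variables (R : realType) (n : nat).
Local Notation ring := (R * R * R * R)%type.
Implicit Types (P Q S : 'I_n -> ring) (w : seq 'I_n).

Lemma index_map_perm (s : {perm 'I_n}) (a : 'I_n) :
  index a [seq s i | i <- enum 'I_n] = (s^-1)%g a :> nat.
Proof.
by rewrite -{1}(permKV s a) index_map ?index_enum_ord//; exact: perm_inj.
Qed.

Lemma perm_eq_map_perm (s : {perm 'I_n}) :
  perm_eq [seq s i | i <- enum 'I_n] (enum 'I_n).
Proof.
apply: uniq_perm; last first; [|exact: enum_uniq|by rewrite map_inj_uniq ?enum_uniq//; exact: perm_inj].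
by move=> a; rewrite mem_enum -{1}(permKV s a) mem_map ?mem_enum//; exact: perm_inj.
Qed.

Lemma before_map_perm (s : {perm 'I_n}) (a b : 'I_n) :
  before [seq s i | i <- enum 'I_n] a b = ((s^-1)%g a < (s^-1)%g b)%N.
Proof. by rewrite /before !index_map_perm. Qed.

Lemma perm_of_order w : perm_eq w (enum 'I_n) ->
  exists s : {perm 'I_n}, w = [seq s i | i <- enum 'I_n].
Proof.
move=> wE; have sw : size w = n by rewrite (perm_size wE) size_enum_ord.
have uw : uniq w by rewrite (perm_uniq wE) enum_uniq.
have inj : injective (fun i : 'I_n => nth i w i).
  move=> i j /= e; apply: val_inj => /=; apply/eqP.
  rewrite -(@nth_uniq _ i w)// ?sw ?ltn_ord// e; apply/eqP.
  by apply: set_nth_default; rewrite sw.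
exists (perm inj); case: n w sw {uw wE} inj => [|m] w sw inj.
  by apply: etrans (size0nil sw) _; apply/esym/size0nil; rewrite size_map size_enum_ord.
apply: (@eq_from_nth _ ord0) => [|i]; first by rewrite sw size_map size_enum_ord.
rewrite sw => im.
rewrite (nth_map ord0) ?size_enum_ord// permE.
rewrite (_ : nth ord0 (enum 'I_m.+1) i = Ordinal im); last first.
  by apply: val_inj; rewrite /= nth_enum_ord.
by apply: set_nth_default; rewrite sw.
Qed.

Definition sorted_by w P := forall a b, before w a b -> cx (P a) <= cx (P b).
Definition ssorted_by w P := forall a b, before w a b -> cx (P a) < cx (P b).

Lemma before_cases w (a b : 'I_n) : perm_eq w (enum 'I_n) -> a != b ->
  before w a b \/ before w b a.
Proof.
move=> wE ab; have [h|h] := boolP (before w a b); [by left|right].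
by apply: before_total h => //; rewrite (perm_mem wE) mem_enum.
Qed.

Lemma ssorted_by_valid w P : perm_eq w (enum 'I_n) -> ssorted_by w P ->
  (forall a, 0 < radius (P a)) -> valid P.
Proof.
move=> wE sP r; split=> // a b ab.
by have [/sP|/sP] := before_cases wE ab; [exists Before|exists After].
Qed.

Lemma sorted_lift_exists (y : UR R n) :
  exists P, [/\ valid P, config P = y & sorted_by (enum 'I_n) P].
Proof.
have [P vP Py] := configP y.
pose le a b := cx (P a) <= cx (P b).
have le_tot : total le by move=> a b; exact: le_total.
have le_tr : transitive le by move=> a b c; exact: le_trans.
have wE : perm_eq (sort le (enum 'I_n)) (enum 'I_n) by rewrite perm_sort.
have [s ws] := perm_of_order wE.
exists (P \o s); split; [exact: valid_perm|by rewrite config_perm|].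
move=> a b; rewrite /before !index_enum_ord => ab /=.
have := sort_sorted le_tot (enum 'I_n); rewrite ws.
move=> so.
have := sorted_ltn_index le_tr so; move=> /(_ (s a) (s b)).
rewrite !index_map_perm !permK => h; apply: h => //.
- by rewrite (perm_mem (perm_eq_map_perm s)) mem_enum.
- by rewrite (perm_mem (perm_eq_map_perm s)) mem_enum.
Qed.

Definition sorted_lift (y : UR R n) : 'I_n -> ring := projT1 (cid (sorted_lift_exists y)).

Lemma sorted_liftP y : [/\ valid (sorted_lift y), config (sorted_lift y) = y &
  sorted_by (enum 'I_n) (sorted_lift y)].
Proof. exact: projT2 (cid (sorted_lift_exists y)). Qed.

(** [valid P] stands under the quantifier so that [order_perm] is a total function. *)
Lemma order_perm_exists P : exists s : {perm 'I_n}, valid P ->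
  sorted_lift (config P) =1 P \o s.
Proof.
have [vP|nvP] := pselect (valid P); last by exists 1%g.
have [v e _] := sorted_liftP (config P).
by have [s h] := config_eq vP v (esym e); exists s.
Qed.

Definition order_perm P : {perm 'I_n} := projT1 (cid (order_perm_exists P)).

Lemma order_permP P : valid P -> sorted_lift (config P) =1 P \o order_perm P.
Proof. exact: projT2 (cid (order_perm_exists P)). Qed.

(* The labels of [P] from left to right; ties are broken by the choice of
   [sorted_lift], hence in the same way for all labellings of a configuration. *)
Definition order P : seq 'I_n := [seq order_perm P i | i <- enum 'I_n].

Lemma order_perm_eq P : perm_eq (order P) (enum 'I_n).
Proof. exact: perm_eq_map_perm. Qed.

Lemma order_sorted P : valid P -> sorted_by (order P) P.
Proof.
move=> vP a b; rewrite before_map_perm => ab.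
have [_ _ /(_ ((order_perm P)^-1 a)%g ((order_perm P)^-1 b)%g)] := sorted_liftP (config P).
rewrite /before !index_enum_ord => /(_ ab).
by rewrite !order_permP//= !permKV.
Qed.

Lemma valid_inj P a b : valid P -> P a = P b -> a = b.
Proof.
by move=> vP e; apply/eqP; apply: contraTT isT => /(valid_neq vP); rewrite e eqxx.
Qed.

Lemma order_comp P (s : {perm 'I_n}) : valid P ->
  order (P \o s) = [seq (s^-1)%g a | a <- order P].
Proof.
move=> vP; suff e : order_perm (P \o s) =1 (s^-1)%g \o order_perm P.
  by rewrite /order -[RHS]map_comp; exact: eq_map.
move=> i /=.
have vPs := valid_perm s vP.
have h1 := order_permP vPs i; have h2 := order_permP vP i.
rewrite config_perm// in h1; rewrite h1 /= in h2.
by rewrite -(valid_inj vP h2) permK.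
Qed.

Lemma order_ssorted P w : valid P -> perm_eq w (enum 'I_n) -> ssorted_by w P ->
  order P = w.
Proof.
move=> vP wE sP; have [s ws] := perm_of_order wE.
pose lt a b := cx (P a) < cx (P b).
have tr : transitive lt by move=> a b c; exact: lt_trans.
have irr : irreflexive lt by move=> a; exact: ltxx.
have so v : perm_eq v (enum 'I_n) -> ssorted_by v P -> sorted lt v.
  move=> vE sv; have [a0|no] := pselect (exists a : 'I_n, True); last first.
    by case: v vE sv => // c v _ _; case: no; exists c.
  case: a0 => a0 _.
  apply/(sortedP a0) => i iv; apply: sv.
  have uv : uniq v by rewrite (perm_uniq vE) enum_uniq.
  by rewrite /before !index_uniq// ltnW.
apply: (irr_sorted_eq tr irr); last first.
- by move=> a; rewrite (perm_mem wE) (perm_mem (order_perm_eq P)).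
- exact: so.
- apply: so; first exact: order_perm_eq.
  move=> a b ab; rewrite lt_neqAle order_sorted// andbT.
  have neq := before_neq ab.
  by have [/sP h|/sP h] := before_cases wE neq; rewrite neq_lt h ?orbT.
Qed.

(** Of [P] only the projections to the yz-plane survive; the planes are those of the base
    configuration, taken in the order [w]. *)
Definition arrange w P : 'I_n -> ring :=
  fun a => ((4 * (index a w).+1)%:R, cy (P a), cz (P a), radius (P a)).

Definition standard w := arrange w (fun=> (0, 0, 0, 1)).

Lemma arrange_ssorted w P : ssorted_by w (arrange w P).
Proof. by move=> a b ab; rewrite /arrange /cx /= ltr_nat ltn_pmul2l. Qed.

Lemma arrange_valid w P : perm_eq w (enum 'I_n) -> (forall a, 0 < radius (P a)) ->
  valid (arrange w P).
Proof. by move=> wE r; apply: (ssorted_by_valid wE (@arrange_ssorted w P)). Qed.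

Lemma standard_valid w : perm_eq w (enum 'I_n) -> valid (standard w).
Proof. by move=> wE; apply: arrange_valid => // a; exact: ltr01. Qed.

Lemma order_arrange w P : perm_eq w (enum 'I_n) -> (forall a, 0 < radius (P a)) ->
  order (arrange w P) = w.
Proof.
move=> wE r; apply: order_ssorted => //; first exact: arrange_valid.
exact: arrange_ssorted.
Qed.

Lemma base_standard : base_ring R (n := n) = standard (enum 'I_n).
Proof. by apply/funext => j; rewrite /standard /arrange index_enum_ord. Qed.

Lemma config_base : config (standard (enum 'I_n)) = UR_base R n.
Proof.
rewrite /config /UR_base; congr unordered; apply: ringj_inj => j.
rewrite ringj_to_ordered; last exact: standard_valid.
by rewrite -base_standard /ringj set_valE /= mxE.
Qed.

Lemma standard_comp (s : {perm 'I_n}) :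
  standard [seq s i | i <- enum 'I_n] \o s = standard (enum 'I_n).
Proof.
apply/funext => i /=; rewrite /standard /arrange index_map_perm permK.
by rewrite index_enum_ord.
Qed.

Lemma config_standard w : perm_eq w (enum 'I_n) -> config (standard w) = UR_base R n.
Proof.
move=> wE; have [s ws] := perm_of_order wE.
by rewrite -config_base -(standard_comp s) config_perm -?ws//; exact: standard_valid.
Qed.

Definition mixc (a b c : R) P Q S : 'I_n -> ring := fun i => mix a b c (P i) (Q i) (S i).

Definition fill P Q S := forall a b c, weights a b c -> valid (mixc a b c P Q S).

Lemma mix100 (C D E : ring) : mix 1 0 0 C D E = C.
Proof. by case: C => [[[x y] z] r]; rewrite /mix /cx /cy /cz /radius /= !mul1r !mul0r !addr0. Qed.

Lemma mix010 (C D E : ring) : mix 0 1 0 C D E = D.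
Proof. by case: D => [[[x y] z] r]; rewrite /mix /cx /cy /cz /radius /= !mul1r !mul0r !addr0 !add0r. Qed.

Lemma mix001 (C D E : ring) : mix 0 0 1 C D E = E.
Proof. by case: E => [[[x y] z] r]; rewrite /mix /cx /cy /cz /radius /= !mul1r !mul0r !add0r. Qed.

Lemma mix_swap a b c (C D E : ring) : mix a b c C D E = mix a c b C E D.
Proof. by rewrite /mix; congr (_, _, _, _); rewrite addrAC. Qed.

Lemma mix_rot a b c (C D E : ring) : mix a b c C D E = mix b c a D E C.
Proof. by rewrite /mix; congr (_, _, _, _); rewrite [RHS]addrC addrA. Qed.

Lemma weights_swap (a b c : R) : weights a b c -> weights a c b.
Proof. by move=> [? ? ? s]; split=> //; rewrite addrAC. Qed.

Lemma weights_rot (a b c : R) : weights a b c -> weights b c a.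
Proof. by move=> [? ? ? s]; split=> //; rewrite addrC addrA. Qed.

Lemma fill_swap P Q S : fill P Q S -> fill P S Q.
Proof.
move=> h a b c /weights_swap /h; rewrite /mixc.
by under eq_fun do rewrite mix_swap.
Qed.

Lemma fill_rot P Q S : fill P Q S -> fill Q S P.
Proof.
move=> h a b c /weights_rot/weights_rot /h; rewrite /mixc.
by under eq_fun do rewrite mix_rot.
Qed.

Lemma fill_coherent P Q S : (forall a, [/\ 0 < radius (P a), 0 < radius (Q a) & 0 < radius (S a)]) ->
  (forall a b, a != b -> exists t, [/\ sat t (P a) (P b), sat t (Q a) (Q b) & sat t (S a) (S b)]) ->
  fill P Q S.
Proof.
move=> r h a b c w; split=> [i|i j ij].
  by have [r1 r2 r3] := r i; exact: mix_gt0.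
by have [t [h1 h2 h3]] := h _ _ ij; exists t; exact: mix_sat.
Qed.

Lemma mixc_sorted w a b c P Q S : weights a b c -> a < 1 ->
  sorted_by w P -> ssorted_by w Q -> ssorted_by w S -> ssorted_by w (mixc a b c P Q S).
Proof.
move=> [a0 b0 c0 s] a1 hP hQ hS i j ij; have {}hP := hP _ _ ij.
have {}hQ := hQ _ _ ij; have {}hS := hS _ _ ij.
rewrite /mixc /mix {1 5}/cx /=.
have e1 : a * cx (P i) <= a * cx (P j) by rewrite ler_wpM2l.
have [b1|b1] := ltP 0 b.
  have e2 : b * cx (Q i) < b * cx (Q j) by rewrite ltr_pM2l.
  have e3 : c * cx (S i) <= c * cx (S j) by rewrite ler_wpM2l// ltW.
  by rewrite ltr_leD// ler_ltD.
have c1 : 0 < c by lra.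
have e2 : b * cx (Q i) <= b * cx (Q j) by rewrite ler_wpM2l// ltW.
have e3 : c * cx (S i) < c * cx (S j) by rewrite ltr_pM2l.
by rewrite ler_ltD// lerD.
Qed.

(** [P] may have ties. Any weight off [P] makes the order strict, and with all the weight on [P] the
    point is [P] itself, valid by assumption. *)
Lemma fill_sorted w P Q S : perm_eq w (enum 'I_n) -> valid P -> sorted_by w P ->
  (forall a, 0 < radius (Q a)) -> ssorted_by w Q ->
  (forall a, 0 < radius (S a)) -> ssorted_by w S -> fill P Q S.
Proof.
move=> wE vP hP rQ hQ rS hS a b c W; have [a0 b0 c0 s] := W.
have [a1|a1] := ltP a 1.
  apply: ssorted_by_valid (mixc_sorted W a1 hP hQ hS) _ => // i.
  by have [r _] := vP; exact: mix_gt0.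
have -> : mixc a b c P Q S = P; last by [].
have ea : a = 1 by lra.
have eb : b = 0 by lra.
have ec : c = 0 by lra.
by apply/funext => i; rewrite /mixc ea eb ec mix100.
Qed.

End orders.

Section segments.
Variables (R : realType) (n : nat).
Local Notation ring := (R * R * R * R)%type.
Local Notation Y := (UR R n).
Implicit Types (P Q S : 'I_n -> ring) (w : seq 'I_n).

Lemma mixc_cts (Z : topologicalType) (a b c : Z -> R) (F G H : Z -> 'I_n -> ring) i :
  continuous a -> continuous b -> continuous c ->
  (forall i, continuous (fun z => F z i)) -> (forall i, continuous (fun z => G z i)) ->
  (forall i, continuous (fun z => H z i)) ->
  continuous (fun z => mixc (a z) (b z) (c z) (F z) (G z) (H z) i).
Proof.
move=> ca cb cc cF cG cH; rewrite /mixc /mix.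
have coord (f : ring -> R) : continuous f ->
    continuous (fun z => a z * f (F z i) + b z * f (G z i) + c z * f (H z i)).
  move=> cf; have cfF (K : Z -> 'I_n -> ring) : (forall i, continuous (fun z => K z i)) -> continuous (fun z => f (K z i)).
    by move=> cK; exact: (comp_cts (cK i) cf).
  by apply: add_cts; [apply: add_cts|]; apply: mul_cts => //; exact: cfF.
apply: pair_continuous; last exact/coord/radius_cts.
apply: pair_continuous; last exact/coord/cz_cts.
by apply: pair_continuous; [exact/coord/cx_cts|exact/coord/cy_cts].
Qed.

Definition segment P Q (t : R) : 'I_n -> ring := mixc (1 - clamp t) (clamp t) 0 P Q Q.

Lemma weights2 t : weights (1 - clamp t) (clamp t) (0 : R).
Proof. by have /andP[? ?] := @clamp_itv R t; split=> //; lra. Qed.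

Lemma segment0 P Q : segment P Q 0 = P.
Proof.
apply/funext => i; rewrite /segment clampK ?lexx ?ler01// subr0.
exact: mix100.
Qed.

Lemma segment1 P Q : segment P Q 1 = Q.
Proof.
apply/funext => i; rewrite /segment clampK ?lexx ?ler01// subrr.
exact: mix010.
Qed.

Lemma segment_cts P Q i : continuous (fun t => segment P Q t i).
Proof.
apply: (@mixc_cts _ (fun t => 1 - clamp t) clamp (cst 0) (cst P) (cst Q) (cst Q)).
- by apply: sub_cts; [exact: cst_cts|exact: clamp_cts].
- exact: clamp_cts.
- exact: cst_cts.
- by move=> j; exact: cst_cts.
- by move=> j; exact: cst_cts.
- by move=> j; exact: cst_cts.
Qed.

Lemma config_segment_cts P Q : (forall t, valid (segment P Q t)) ->
  continuous (fun t => config (segment P Q t)).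
Proof. by move=> v; apply: config_cts => // a; exact: segment_cts. Qed.

Lemma mix_coef0 a b (C D E E' : ring) : mix a b 0 C D E = mix a b 0 C D E'.
Proof. by rewrite /mix !mul0r. Qed.

Lemma mixcc a b c P : weights a b c -> mixc a b c P P P = P.
Proof.
move=> [_ _ _ s]; apply/funext => i; rewrite /mixc /mix -!mulrDl s !mul1r.
by case: (P i) => [[[x y] z] r].
Qed.

Lemma segment_valid P Q S : fill P Q S -> forall t, valid (segment P Q t).
Proof.
move=> h t; have -> : segment P Q t = mixc (1 - clamp t) (clamp t) 0 P Q S.
  by apply/funext => i; exact: mix_coef0.
by apply: h; exact: weights2.
Qed.

Lemma tail_valid y t : valid (segment (standard R (enum 'I_n)) (sorted_lift y) t).
Proof.
have [v _ so] := sorted_liftP y.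
apply: (@segment_valid _ _ (standard R (enum 'I_n))); apply/fill_swap/fill_rot.
apply: (@fill_sorted _ _ (enum 'I_n)) => //; try exact: arrange_ssorted;
  by move=> a; exact: ltr01.
Qed.

Lemma tail0 y : config (segment (standard R (enum 'I_n)) (sorted_lift y) 0) = UR_base R n.
Proof. by rewrite segment0 config_base. Qed.

Lemma tail1 y : config (segment (standard R (enum 'I_n)) (sorted_lift y) 1) = y.
Proof. by rewrite segment1; have [] := sorted_liftP y. Qed.

(** Before its end the segment has pairwise distinct planes, hence it is valid even if planes of [y]
    coincide. *)
Definition tail y : arc (UR_base R n) y :=
  Arc (config_segment_cts (tail_valid y)) (tail0 y) (tail1 y).

(** The base configuration has no ties, so its sorted labelling is forced; its tail is therefore
    constant. *)
Lemma sorted_lift_base : sorted_lift (UR_base R n) = standard R (enum 'I_n).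
Proof.
have vE : valid (standard R (enum 'I_n)) by exact: standard_valid.
apply/funext => i; rewrite -config_base order_permP//=; congr (standard _ _ _).
have : order (standard R (enum 'I_n)) = enum 'I_n.
  by apply: order_arrange => // a; exact: ltr01.
move=> /(congr1 (fun w => nth i w i)); rewrite (nth_map i) ?size_enum_ord//.
by rewrite nth_ord_enum.
Qed.

Lemma tail_base : arc_homotopic (tail (UR_base R n)) (arc_cst (UR_base R n)).
Proof.
apply: arc_homotopic_ext => t _ /=.
by rewrite sorted_lift_base /segment mixcc ?config_base//; exact: weights2.
Qed.

(** A total function of the bare path: [closed_class] has the endpoints in its type, which would
    obstruct rewriting. *)
Definition path_class (F : R -> Y) : UR_group R n :=
  match pselect (continuous F) with
  | left c => closed_class tail (@Arc R Y (F 0) (F 1) F c erefl erefl)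
  | right _ => 1%g
  end.

Lemma path_class_arc x y (p : arc x y) : path_class p = closed_class tail p.
Proof.
case: p => f c e0 e1; subst x y; rewrite /path_class /=; case: pselect => // c'.
exact/closed_class_homotopic/arc_homotopic_ext.
Qed.

Definition edge P Q : UR_group R n := path_class (fun t => config (segment P Q t)).

Definition edge_arc P Q (h : forall t, valid (segment P Q t)) :
    arc (config P) (config Q) :=
  Arc (config_segment_cts h) (congr1 (@config R n) (segment0 P Q)) (congr1 (@config R n) (segment1 P Q)).

(** Inside the triangle the broken path from [P] by [Q] to [S] is moved straight onto the side from
    [P] to [S]. *)
Lemma edge_mul P Q S : fill P Q S -> (edge P Q * edge Q S)%g = edge P S.
Proof.
move=> h; have hPQ := segment_valid h; have hQS := segment_valid (fill_rot h).
have hPS := segment_valid (fill_swap h).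
rewrite /edge -[X in (path_class X * _)%g]/(arc_fun (edge_arc hPQ)).
rewrite -[X in (_ * path_class X)%g]/(arc_fun (edge_arc hQS)).
rewrite -[X in _ = path_class X]/(arc_fun (edge_arc hPS)).
rewrite !path_class_arc closed_class_cat; apply: closed_class_homotopic.
(* On the broken path the weights of [P], [Q], [S] are [a], [1 - a - c], [c]; on the side they are
   [1 - t], [0], [t]. *)
pose a t : R := Num.max 0 (1 - 2 * clamp t); pose c t : R := Num.max 0 (2 * clamp t - 1).
have aW t : [/\ 0 <= a t, 0 <= c t & a t + c t <= 1].
  have /andP[t0 t1] := @clamp_itv R t; rewrite /a /c.
  by case: (leP 0 (1 - _)) => ?; case: (leP 0 (_ - 1)) => ?; split; lra.
have cc : continuous (fun u : R * R => clamp u.2).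
  by apply: comp_cts clamp_cts; exact: snd_continuous.
have cs : continuous (fun u : R * R => clamp u.1).
  by apply: comp_cts clamp_cts; exact: fst_continuous.
have ca : continuous (fun u : R * R => a u.2).
  apply: max_cts; first exact: cst_cts.
  by apply: sub_cts; [exact: cst_cts|apply: mul_cts => //; exact: cst_cts].
have ck : continuous (fun u : R * R => c u.2).
  apply: max_cts; first exact: cst_cts.
  by apply: sub_cts; [apply: mul_cts => //; exact: cst_cts|exact: cst_cts].
pose A (u : R * R) := (1 - clamp u.1) * a u.2 + clamp u.1 * (1 - clamp u.2).
pose B (u : R * R) := (1 - clamp u.1) * (1 - a u.2 - c u.2).
pose C (u : R * R) := (1 - clamp u.1) * c u.2 + clamp u.1 * clamp u.2.
have W u : weights (A u) (B u) (C u).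
  have [a0 c0 ac] := aW u.2; have /andP[s0 s1] := @clamp_itv R u.1.
  have /andP[t0 t1] := @clamp_itv R u.2.
  rewrite /A /B /C; split; last by ring.
  - by rewrite addr_ge0// mulr_ge0//; lra.
  - by rewrite mulr_ge0//; lra.
  - by rewrite addr_ge0// mulr_ge0//; lra.
have c1s : continuous (fun u : R * R => 1 - clamp u.1) by apply: sub_cts => //; exact: cst_cts.
exists (fun u => config (mixc (A u) (B u) (C u) P Q S)); split.
- apply: config_cts => [u|i]; first exact: h.
  apply: mixc_cts; try by move=> j; exact: cst_cts.
  + apply: add_cts; apply: mul_cts => //.
    by apply: sub_cts => //; exact: cst_cts.
  + apply: mul_cts => //; apply: sub_cts => //; apply: sub_cts => //; exact: cst_cts.
  + by apply: add_cts; apply: mul_cts.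
- move=> t t01; rewrite /A /B /C /= (@clampK _ 0) ?lexx ?ler01// !subr0 !mul1r !mul0r !addr0.
  have /andP[t0 t1] := t01; rewrite /arc_cat_fun /= /a /c clampK//; case: ifPn => t2.
    rewrite (max_idPr _); last by lra.
    rewrite (max_idPl _); last by lra.
    rewrite addr0 /segment clampK; last by lra.
    by congr config; apply/funext => i; rewrite /mixc (mix_coef0 _ _ _ _ _ (Q i)); congr mix; lra.
  rewrite -ltNge in t2.
  rewrite (max_idPl _); last by lra.
  rewrite (max_idPr _); last by lra.
  rewrite /segment clampK; last by lra.
  congr config; apply/funext => i; rewrite /mixc mix_rot (mix_coef0 _ _ _ _ _ (S i)).
  by rewrite subr0.
- move=> t t01; rewrite /A /B /C /= (@clampK _ 1) ?lexx ?ler01// !subrr !mul1r !mul0r !add0r.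
  rewrite /segment; congr config; apply/funext => i.
  by rewrite /mixc mix_swap (mix_coef0 _ _ _ _ _ (S i)).
- move=> s s01; rewrite /A /B /C /a /c /= (@clampK _ 0) ?lexx ?ler01// mulr0 !subr0 sub0r.
  rewrite (max_idPr _) ?ler01// (max_idPl _); last by lra.
  rewrite !mulr1 subrK !subrr !mulr0 addr0; congr config.
  by apply/funext => i; rewrite /mixc mix100.
- move=> s s01; rewrite /A /B /C /a /c /= (@clampK _ 1) ?lexx ?ler01// mulr1 subrr.
  rewrite (max_idPl _); last by lra.
  rewrite (max_idPr _); last by lra.
  have -> : 2 - 1 = 1 :> R by lra.
  rewrite !mulr0 addr0 subr0 subrr !mulr1 mulr0 subrK; congr config.
  by apply/funext => i; rewrite /mixc mix001.
Qed.

Lemma edge_comp P Q (s : {perm 'I_n}) : (forall t, valid (segment P Q t)) ->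
  edge (P \o s) (Q \o s) = edge P Q.
Proof.
move=> h; rewrite /edge; congr path_class; apply/funext => t.
exact: (config_perm s (h t)).
Qed.

(** Relabelled by [order_perm P], this segment is the tail of [config P], whose closed class is
    trivial. *)
Lemma edge_tail P : valid P -> edge (standard R (order P)) P = 1%g.
Proof.
move=> vP; have <- : path_class (tail (config P)) = 1%g.
  rewrite path_class_arc closed_class_tail//; exact: tail_base.
rewrite /edge; congr path_class; apply/funext => t /=.
have h : valid (segment (standard R (order P)) P t).
  apply: (@segment_valid _ _ (standard R (order P))); apply/fill_swap/fill_rot.
  apply: (@fill_sorted _ _ (order P)) => //; try exact: arrange_ssorted;
    try (by move=> a; exact: ltr01); [exact: order_perm_eq|exact: order_sorted].
rewrite -(config_perm (order_perm P) h); congr config; apply/funext => i /=.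
rewrite /segment /mixc order_permP//=.
by rewrite -[standard R (order P) (order_perm P i)]/((standard R (order P) \o order_perm P) i) standard_comp.
Qed.

(** [P], [Q] and the standard configuration of the same order span a filled triangle, two sides of
    which are tails. *)
Lemma edge_sorted P Q : valid P -> (forall a, 0 < radius (Q a)) ->
  ssorted_by (order P) Q -> edge P Q = 1%g /\ edge Q P = 1%g.
Proof.
move=> vP rQ sQ; have wE := order_perm_eq P.
have vQ : valid Q by exact: ssorted_by_valid wE sQ rQ.
have oQ : order Q = order P by exact: order_ssorted.
have f : fill P (standard R (order P)) Q.
  apply: (fill_sorted wE) => //; try exact: arrange_ssorted;
    try (by move=> a; exact: ltr01); exact: order_sorted.
have tP := edge_tail vP; have tQ := edge_tail vQ; rewrite oQ in tQ.
have h1 := edge_mul (fill_swap (fill_rot f)).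
have h2 := edge_mul (fill_rot f).
by move: h1 h2; rewrite tP tQ !mul1g.
Qed.

End segments.

(** * Exchanges of neighbours *)

Section kinds.
Variable R : realType.
Local Notation ring := (R * R * R * R)%type.
Implicit Types C D E : ring.

Definition planar (t : pair_type R) : bool :=
  match t with Before | After => false | _ => true end.

Definition disjoint_profiles C D : bool := `[< exists2 t, planar t & sat t C D >].

(** [Separate] is also the value for circles that meet; it describes their position only under
    [disjoint_profiles]. *)
Definition kind_of C D : kind :=
  if nest C D then Inner else if nest D C then Outer else Separate.

Lemma nest_asym C D : nest C D -> nest D C = false.
Proof. by move=> /andP[/ltW h _]; rewrite /nest ltNge h. Qed.

Lemma nest_trans C D E : nest C D -> nest D E -> nest C E.
Proof.
move=> /nestP h1 /nestP h2; apply/nestP => u v uv.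
have := h1 _ _ uv; have := h2 _ _ uv; lra.
Qed.

Lemma apart_nest u v C D : 0 < radius C -> sat (Apart u v) C D -> nest C D = false.
Proof.
by move=> r [uv h]; apply/negbTE/negP => /nestP/(_ _ _ uv); lra.
Qed.

Lemma apart_opp u v C D : sat (Apart u v) C D -> sat (Apart (- u) (- v)) D C.
Proof. by move=> [uv h]; split; rewrite ?sqrrN//; lra. Qed.

Lemma disjoint_profiles_sym C D : disjoint_profiles C D -> disjoint_profiles D C.
Proof.
move=> /asboolP[[|||| u v]] // _ h; apply/asboolP.
- by exists Outside.
- by exists Inside.
- by exists (Apart (- u) (- v)) => //; exact: apart_opp.
Qed.

Lemma kind_of_opp C D : kind_of D C = opp_kind (kind_of C D).
Proof.
rewrite /kind_of; case: (boolP (nest C D)) => [/nest_asym ->//|_].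
by case: (nest D C).
Qed.

Variant kind_spec C D : kind -> Prop :=
  | KindInner of nest C D : kind_spec C D Inner
  | KindOuter of nest D C : kind_spec C D Outer
  | KindSeparate u v of ~~ nest C D & ~~ nest D C & sat (Apart u v) C D :
      kind_spec C D Separate.

Lemma kind_ofP C D : 0 < radius C -> 0 < radius D -> disjoint_profiles C D ->
  kind_spec C D (kind_of C D).
Proof.
move=> rC rD /asboolP[[|||| u v]] // _ h; rewrite /kind_of.
- by rewrite (h : nest C D); constructor.
- by rewrite (nest_asym (h : nest D C)) (h : nest D C); constructor.
- have n1 := apart_nest rC h; have n2 := apart_nest rD (apart_opp h).
  by rewrite n1 n2; apply: (KindSeparate (u := u) (v := v)); rewrite ?n1 ?n2.
Qed.

(** The centre of [C] would lie in both of the separated discs. *)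
Lemma nest_apart C D E u v : 0 < radius C -> 0 < radius D -> 0 < radius E ->
  nest C D -> nest C E -> sat (Apart u v) D E -> False.
Proof.
move=> rC rD rE h1 h2 h3.
have hC : (cy C - cy C) ^+ 2 + (cz C - cz C) ^+ 2 <= radius C ^+ 2.
  by rewrite !subrr expr0n addr0 sqr_ge0.
have k1 := ltW (nest_inside (ltW rC) h1 hC).
have k2 := ltW (nest_inside (ltW rC) h2 hC).
exact: (apart_disjoint (ltW rD) (ltW rE) h3 k1 k2).
Qed.

(** The goals left after the case analysis are the eleven excluded combinations: eight contradict
    transitivity or asymmetry of nesting, three contradict [nest_apart]. *)
Lemma kinds_consistent A X Y : 0 < radius A -> 0 < radius X -> 0 < radius Y ->
  disjoint_profiles A X -> disjoint_profiles A Y -> disjoint_profiles Y X ->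
  consistent (kind_of A Y) (kind_of A X) (kind_of Y X).
Proof.
move=> rA rX rY dAX dAY dYX.
have tr C D E : nest C D -> nest D E -> nest C E = true := @nest_trans C D E.
case: (kind_ofP rA rY dAY) => [a1|a1|u1 v1 a1 a1' b1];
  case: (kind_ofP rA rX dAX) => [a2|a2|u2 v2 a2 a2' b2];
  case: (kind_ofP rY rX dYX) => [a3|a3|u3 v3 a3 a3' b3] //=; exfalso.
- exact: (nest_apart rA rY rX a1 a2 b3).
- by have := nest_asym (tr _ _ _ a1 a3); rewrite a2.
- by have := tr _ _ _ a2 a1; rewrite (negPf a3').
- by have := tr _ _ _ a1 a3; rewrite (negPf a2).
- by have := nest_asym (tr _ _ _ a1 a2); rewrite a3.
- by have := tr _ _ _ a1 a2; rewrite (negPf a3).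
- exact: (nest_apart rY rA rX a1 a3 b2).
- by have := tr _ _ _ a3 a1; rewrite (negPf a2').
- by have := tr _ _ _ a2 a3; rewrite (negPf a1).
- by have := tr _ _ _ a3 a2; rewrite (negPf a1').
- exact: (nest_apart rX rA rY a2 a3 b1).
Qed.

End kinds.

Section elementary.
Variables (R : realType) (n : nat).
Local Notation ring := (R * R * R * R)%type.
Implicit Types (P Q S f g : 'I_n -> ring) (w u v : seq 'I_n) (i : 'I_n.-1).

Lemma sat_arrange t w f a b : planar t ->
  sat t (arrange w f a) (arrange w f b) = sat t (f a) (f b).
Proof. by case: t. Qed.

Lemma arrange_before w f a b : before w a b -> sat Before (arrange w f a) (arrange w f b).
Proof. exact: arrange_ssorted. Qed.

Lemma arrange_after w f a b : before w b a -> sat After (arrange w f a) (arrange w f b).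
Proof. exact: arrange_ssorted. Qed.

Lemma same_order w w' fr (a b : 'I_n) : perm_eq w (enum 'I_n) -> perm_eq w' (enum 'I_n) ->
  a != b -> free_inversions fr w w' -> symmetric fr -> ~~ fr a b ->
  before w a b = before w' a b.
Proof.
move=> wE wE' ab h sfr nfr.
have mw c : c \in w by rewrite (perm_mem wE) mem_enum.
have nba : ~~ fr b a by rewrite sfr.
have ba : b != a by rewrite eq_sym.
have [h1|h1] := before_cases wE ab; have [h2|h2] := before_cases wE' ab.
- by rewrite h1 h2.
- by have := h _ _ (mw a) (mw b) h1 h2; rewrite (negPf nfr).
- by have := h _ _ (mw b) (mw a) h1 h2; rewrite (negPf nba).
- by apply/idP/idP => [/before_asym/(_ h1)|/before_asym/(_ h2)].
Qed.

Definition free_pairs f : rel 'I_n := fun a b => disjoint_profiles (f a) (f b).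

Lemma free_pairs_sym f : symmetric (free_pairs f).
Proof. by move=> a b; apply/idP/idP; exact: disjoint_profiles_sym. Qed.

(** A free pair has the same planar type in every arrangement, and a pair that is not free keeps its
    order; either way one pair type serves all three vertices. *)
Lemma arrange_fill f w1 w2 w3 : (forall a, 0 < radius (f a)) ->
  perm_eq w1 (enum 'I_n) -> perm_eq w2 (enum 'I_n) -> perm_eq w3 (enum 'I_n) ->
  free_inversions (free_pairs f) w1 w2 -> free_inversions (free_pairs f) w2 w3 ->
  fill (arrange w1 f) (arrange w2 f) (arrange w3 f).
Proof.
move=> r e1 e2 e3 h12 h23; apply: fill_coherent => [a|a b ab]; first by split; exact: r.
have [/asboolP[t pt tab]|nfr] := boolP (free_pairs f a b).
  by exists t; rewrite !sat_arrange.
have s12 := same_order e1 e2 ab h12 (@free_pairs_sym f) nfr.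
have s23 := same_order e2 e3 ab h23 (@free_pairs_sym f) nfr.
have [h|h] := before_cases e1 ab.
  by exists Before; split; apply: arrange_before; rewrite -?s23 -?s12.
exists After; split; apply: arrange_after => //.
  have [k|//] := before_cases e2 ab; rewrite -s12 in k.
  by case: (before_asym k h).
have [k|//] := before_cases e3 ab; rewrite -s23 -s12 in k.
by case: (before_asym k h).
Qed.

Lemma edge_id P : valid P -> edge P P = 1%g.
Proof.
move=> vP; apply: (mulgI (edge P P)); rewrite mulg1 edge_mul//.
by move=> a b c w; rewrite mixcc.
Qed.

Lemma edge_inv P Q : fill P Q P -> edge Q P = ((edge P Q)^-1)%g.
Proof.
move=> h; apply: (mulgI (edge P Q)); rewrite edge_mul// mulgV edge_id//.
by have := h 1 0 0; rewrite /mixc; under eq_fun do rewrite mix100; apply; split; lra.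
Qed.

Definition swapped i : seq 'I_n := [seq tperm (left_ring i) (right_ring i) j | j <- enum 'I_n].

Lemma before_swapped i a b :
  before (swapped i) a b = (tperm (left_ring i) (right_ring i) a < tperm (left_ring i) (right_ring i) b)%N.
Proof. by rewrite before_map_perm tpermV. Qed.

Lemma left_right_neq i : left_ring i != right_ring i.
Proof. by apply/eqP => /(congr1 val) /= h; lia. Qed.

Lemma swapped_order i a b : a != b -> before (enum 'I_n) a b -> before (swapped i) b a ->
  a = left_ring i /\ b = right_ring i.
Proof.
have nl c : c <> left_ring i -> val c <> val i by move=> h e; apply: h; exact: val_inj.
have nr c : c <> right_ring i -> val c <> (val i).+1 by move=> h e; apply: h; exact: val_inj.
rewrite before_swapped {1}/before !index_enum_ord => _ H.
case: tpermP => [/(congr1 val) /= e1|/(congr1 val) /= e1|/nl /= e1 /nr /= e2];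
case: tpermP => [/(congr1 val) /= e3|/(congr1 val) /= e3|/nl /= e3 /nr /= e4] /= K;
  by split; apply: val_inj => /=; lia.
Qed.

Lemma swap_free i f : free_pairs f (left_ring i) (right_ring i) ->
  free_inversions (free_pairs f) (enum 'I_n) (swapped i).
Proof.
move=> h a b _ _ ab ba; have neq := before_neq ab.
by have [-> ->] := swapped_order neq ab ba.
Qed.

Definition swap_class i f := edge (arrange (enum 'I_n) f) (arrange (swapped i) f).

(** The diagonal from [M] to [N'] cuts the quadrilateral [M N N' M'] into two filled triangles, and
    the sides between equal orders are trivial. *)
Lemma swap_class_eq i f g t : planar t -> (forall a, 0 < radius (f a)) ->
  (forall a, 0 < radius (g a)) ->
  sat t (f (left_ring i)) (f (right_ring i)) -> sat t (g (left_ring i)) (g (right_ring i)) ->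
  swap_class i f = swap_class i g.
Proof.
move=> pt rf rg hf hg; rewrite /swap_class.
set M := arrange _ f; set M' := arrange _ f; set N := arrange _ g; set N' := arrange _ g.
have wE : perm_eq (enum 'I_n) (enum 'I_n) by [].
have wE' : perm_eq (swapped i) (enum 'I_n) by exact: perm_eq_map_perm.
have [e1 _] : edge M N = 1%g /\ edge N M = 1%g.
  apply: edge_sorted => //; first exact: arrange_valid.
  by rewrite order_arrange//; exact: arrange_ssorted.
have [_ e2] : edge M' N' = 1%g /\ edge N' M' = 1%g.
  apply: edge_sorted => //; first exact: arrange_valid.
  by rewrite order_arrange//; exact: arrange_ssorted.
have coh a b : a != b -> exists t, [/\ sat t (M a) (M b), sat t (N a) (N b),
    sat t (N' a) (N' b) & sat t (M' a) (M' b)].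
  move=> ab; have [[-> ->]|nlr] := pselect (a = left_ring i /\ b = right_ring i).
    by exists t; rewrite !sat_arrange.
  have [[-> ->]|nrl] := pselect (b = left_ring i /\ a = right_ring i).
    case: t pt hf hg => [|||| u v] // _ hf hg; [exists Outside|exists Inside|exists (Apart (- u) (- v))] => //.
    by split; apply: (@apart_opp R u v); rewrite sat_arrange.
  have ba : b != a by rewrite eq_sym.
  have [h|h] := before_cases wE ab.
    have h' : before (swapped i) a b.
      by have [//|k] := before_cases wE' ab; case: nlr; exact: swapped_order k.
    by exists Before; split; exact: arrange_before.
  have h' : before (swapped i) b a.
    by have [k|//] := before_cases wE' ab; case: nrl; exact: swapped_order k.
  by exists After; split; exact: arrange_after.
have f1 : fill M N N'.
  by apply: fill_coherent => [a|a b /coh[t' [? ? ? ?]]]; [split; [exact: rf|exact: rg|exact: rg]|exists t'].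
have f2 : fill M N' M'.
  by apply: fill_coherent => [a|a b /coh[t' [? ? ? ?]]]; [split; [exact: rf|exact: rg|exact: rf]|exists t'].
by rewrite -(edge_mul f2) e2 mulg1 -(edge_mul f1) e1 mul1g.
Qed.

Lemma arrange_comp w f (s : {perm 'I_n}) :
  arrange [seq s j | j <- w] f \o s = arrange w (f \o s).
Proof.
apply/funext => a; rewrite /arrange /= index_map//; exact: perm_inj.
Qed.

Lemma arrange_segment f w w' t : (forall a, 0 < radius (f a)) ->
  perm_eq w (enum 'I_n) -> perm_eq w' (enum 'I_n) ->
  free_inversions (free_pairs f) w w' ->
  valid (segment (arrange w f) (arrange w' f) t).
Proof.
move=> r e e' h; apply: (@segment_valid _ _ _ _ (arrange w' f)).
apply: arrange_fill => // a b _ _ h1 h2; by case: (before_asym h1 h2).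
Qed.

(* Relabelling reduces an exchange in an arbitrary order to the standard one. *)
Lemma edge_swap f u a b v (s : {perm 'I_n}) i : (forall a, 0 < radius (f a)) ->
  u ++ a :: b :: v = [seq s j | j <- enum 'I_n] -> size u = i -> free_pairs f a b ->
  [/\ edge (arrange (u ++ a :: b :: v) f) (arrange (u ++ b :: a :: v) f) =
      swap_class i (f \o s), s (left_ring i) = a & s (right_ring i) = b].
Proof.
move=> r ws su fab.
have sz : size (u ++ a :: b :: v) = n by rewrite ws size_map size_enum_ord.
have nthE (c j : 'I_n) : s j = nth c (u ++ a :: b :: v) j.
  rewrite ws (nth_map c) ?size_enum_ord ?ltn_ord//; congr (s _).
  by apply: val_inj; rewrite /= nth_enum_ord.
have sl : s (left_ring i) = a by rewrite (nthE a) nth_cat su ltnn subnn.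
have sr : s (right_ring i) = b.
  by rewrite (nthE a) nth_cat su /= ltnNge leqnSn /= subSnn.
have wE : perm_eq (u ++ a :: b :: v) (enum 'I_n) by rewrite ws perm_eq_map_perm.
have uw : uniq (u ++ a :: b :: v) by rewrite (perm_uniq wE) enum_uniq.
have wE' : perm_eq (u ++ b :: a :: v) (enum 'I_n).
  by apply: perm_trans wE; rewrite perm_cat2l (perm_catCA [:: b] [:: a]).
have ws' : u ++ b :: a :: v = [seq s j | j <- swapped i].
  apply: (@eq_from_nth _ a) => [|j].
    by rewrite (perm_size wE') !size_map.
  rewrite (perm_size wE') size_enum_ord => jn.
  have nthM (g : 'I_n -> 'I_n) : nth a [seq g k | k <- enum 'I_n] j = g (Ordinal jn).
    rewrite (nth_map a) ?size_enum_ord//; congr g.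
    by apply: val_inj; rewrite /= nth_enum_ord.
  have -> : [seq s k | k <- swapped i] =
     [seq (s \o tperm (left_ring i) (right_ring i)) k | k <- enum 'I_n] by exact: esym (map_comp _ _ _).
  rewrite nthM /=.
  case: tpermP => [e|e|/eqP jl /eqP jr].
  - have -> : j = i by have := congr1 val e.
    by rewrite sr nth_cat su ltnn subnn.
  - have -> : j = i.+1 by have := congr1 val e.
    by rewrite sl nth_cat su ltnNge leqnSn /= subSnn.
  - rewrite (nthE a) /= !nth_cat; case: ifP => // ju.
    rewrite -(inj_eq val_inj) /= in jl; rewrite -(inj_eq val_inj) /= in jr.
    have : (1 < j - size u)%N by move/negbT: ju; rewrite su => ju; lia.
    by case: (j - size u)%N => [|[|k]].
have fi : free_inversions (free_pairs f) (u ++ a :: b :: v) (u ++ b :: a :: v).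
  move=> c d _ _ h1 h2; have := @before_move _ u [:: a] b v c d uw h1 h2.
  by move=> [->]; rewrite inE => /eqP ->.
split=> //; rewrite -(edge_comp s); last by move=> t; exact: arrange_segment.
by rewrite {1}ws ws' !arrange_comp.
Qed.

Definition rho_profile i : 'I_n -> ring :=
  fun a => (0, 0, 0, if a == left_ring i then 2^-1 else 1).

(** The offset [3] exceeds the sum of the two radii and puts the left ring on the side of larger
    y-coordinate, as [sigma_loop] demands. *)
Definition sigma_profile i : 'I_n -> ring :=
  fun a => (0, if a == left_ring i then 3 else 0, 0, 1).

Definition rho_class i := swap_class i (rho_profile i).
Definition sigma_class i := swap_class i (sigma_profile i).

Lemma rho_profile_gt0 i a : 0 < radius (rho_profile i a).
Proof. by rewrite /rho_profile /radius /=; case: ifP => _; lra. Qed.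

Lemma rho_profile_nest i : nest (rho_profile i (left_ring i)) (rho_profile i (right_ring i)).
Proof.
rewrite /rho_profile eqxx eq_sym (negPf (left_right_neq i)).
by rewrite /nest /radius /cy /cz /= !subrr expr0n addr0 exprn_gt0; lra.
Qed.

Lemma sigma_profile_gt0 i a : 0 < radius (sigma_profile i a).
Proof. exact: ltr01. Qed.

Lemma sigma_profile_apart i :
  sat (Apart 1 0) (sigma_profile i (left_ring i)) (sigma_profile i (right_ring i)).
Proof.
split; first by rewrite expr0n expr1n addr0.
rewrite /sigma_profile eqxx eq_sym (negPf (left_right_neq i)) /cy /cz /radius /=; lra.
Qed.

Lemma swap_class_inside i f : (forall a, 0 < radius (f a)) ->
  nest (f (left_ring i)) (f (right_ring i)) -> swap_class i f = rho_class i.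
Proof.
move=> r h; apply: (@swap_class_eq i _ _ Inside) => //.
- exact: rho_profile_gt0.
- exact: rho_profile_nest.
Qed.

(** Relabelling by the transposition [s] turns the exchange into the reverse of the exchange for
    [f \o s], where the inner ring is on the left. *)
Lemma swap_class_outside i f : (forall a, 0 < radius (f a)) ->
  nest (f (right_ring i)) (f (left_ring i)) -> swap_class i f = ((rho_class i)^-1)%g.
Proof.
move=> r h; set s := tperm (left_ring i) (right_ring i).
have wE : perm_eq (swapped i) (enum 'I_n) by exact: perm_eq_map_perm.
have fr : free_pairs f (left_ring i) (right_ring i) by apply/asboolP; exists Outside.
have h1 := swap_free fr.
have h2 : free_inversions (free_pairs f) (swapped i) (enum 'I_n).
  by move=> a b _ _ ab ba; rewrite free_pairs_sym; apply: h1; rewrite ?mem_enum.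
rewrite -(@swap_class_inside i (f \o s)).
- rewrite /swap_class -edge_inv; last first.
    apply: arrange_fill => //; first by move=> a; exact: r.
      by apply: swap_free; rewrite /free_pairs /= /s tpermL tpermR; exact: disjoint_profiles_sym.
    move=> a b _ _ ab ba; rewrite free_pairs_sym; apply: (@swap_free i) => //; rewrite ?mem_enum//.
    by rewrite /free_pairs /= /s tpermL tpermR; exact: disjoint_profiles_sym.
  rewrite -(edge_comp s); last by move=> t; exact: arrange_segment.
  rewrite arrange_comp; congr edge; rewrite -arrange_comp -map_comp.
  by rewrite (eq_map (g := id)) ?map_id// => j /=; rewrite tpermK.
- by move=> a; exact: r.
- by rewrite /= /s tpermL tpermR.
Qed.

(** Directions at an acute angle admit a common profile [h], displaced far along one of them and so
    separated along both; [swap_class_eq] then applies twice. *)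
Lemma apart_common i (u v u' v' : R) f g : (forall a, 0 < radius (f a)) ->
  (forall a, 0 < radius (g a)) -> 0 < u * u' + v * v' ->
  sat (Apart u v) (f (left_ring i)) (f (right_ring i)) ->
  sat (Apart u' v') (g (left_ring i)) (g (right_ring i)) ->
  swap_class i f = swap_class i g.
Proof.
move=> rf rg d hf hg.
have [uv _] := hf; have [uv' hg'] := hg.
have d' : 0 < u' ^+ 2 + v' ^+ 2.
  rewrite ltNge; apply/negP => /sum_sqr_le0[u0 v0].
  by move: d; rewrite u0 v0 !mulr0 addr0 ltxx.
(* Each summand makes one of the two components of the displacement at least [3], more than the sum
   [2] of the radii. *)
pose k := 3 / (u * u' + v * v') + 3 / (u' ^+ 2 + v' ^+ 2).
have k1 : 3 <= k * (u * u' + v * v').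
  rewrite /k mulrDl divfK ?gt_eqF// lerDl mulr_ge0 ?(ltW d)// divr_ge0// ?(ltW d')//.
have k2 : 3 <= k * (u' ^+ 2 + v' ^+ 2).
  rewrite /k mulrDl [X in _ <= _ + X]divfK ?gt_eqF// lerDr mulr_ge0 ?(ltW d')// divr_ge0// ?(ltW d)//.
pose h : 'I_n -> ring := fun a => (0, if a == left_ring i then k * u' else 0, if a == left_ring i then k * v' else 0, 1).
have rh a : 0 < radius (h a) by exact: ltr01.
have hl : h (left_ring i) = (0, k * u', k * v', 1) by rewrite /h eqxx.
have hr : h (right_ring i) = (0, 0, 0, 1) by rewrite /h eq_sym (negPf (left_right_neq i)).
rewrite (@swap_class_eq i f h (Apart u v))//; last first.
  by split=> //; rewrite hl hr /cy /cz /radius /= !subr0; lra.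
rewrite (@swap_class_eq i h g (Apart u' v'))//.
by split=> //; rewrite hl hr /cy /cz /radius /= !subr0; lra.
Qed.

(** Any direction of separation is turned into [(1, 0)] through a few acute angles, with stops at
    [(0, 1)], [(0, -1)] and the diagonals. Hence the side on which a ring passes around another does
    not affect the class. *)
Lemma swap_class_apart i f (u v : R) : (forall a, 0 < radius (f a)) ->
  sat (Apart u v) (f (left_ring i)) (f (right_ring i)) -> swap_class i f = sigma_class i.
Proof.
(* For a direction of squared norm at least [1/4] the factor [10] gives a component of at least
   [5/2], beyond the sum [2] of the radii. *)
pose h (p q : R) : 'I_n -> ring := fun a =>
  (0, if a == left_ring i then 10 * p else 0, if a == left_ring i then 10 * q else 0, 1).
have rh p q a : 0 < radius (h p q a) by exact: ltr01.
have hh p q : p ^+ 2 + q ^+ 2 <= 1 -> 1 <= 4 * (p ^+ 2 + q ^+ 2) ->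
    sat (Apart p q) (h p q (left_ring i)) (h p q (right_ring i)).
  move=> h1 h2; split=> //; rewrite /h eqxx eq_sym (negPf (left_right_neq i)) /cy /cz /radius /= !subr0.
  have -> : 10 * p * p + 10 * q * q = 10 * (p ^+ 2 + q ^+ 2) by ring.
  lra.
have hs := sigma_profile_apart i; have rs := sigma_profile_gt0 i.
pose T p q := swap_class i (h p q).
have tA p : p ^+ 2 = 4^-1 -> T 2^-1 p = sigma_class i.
  move=> p2; apply: (apart_common _ _ _ (hh _ _ _ _) hs) => //; first by lra.
  - rewrite p2; lra.
  - rewrite p2; lra.
have tB p : p ^+ 2 = 1 -> T 0 p = sigma_class i.
  move=> p2; have p4 : (p / 2) ^+ 2 = 4^-1 by rewrite expr_div_n p2; lra.
  rewrite -(tA (p / 2))//; apply: (apart_common _ _ _ (hh _ _ _ _) (hh _ _ _ _)) => //.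
  - rewrite (_ : p * (p / 2) = p ^+ 2 / 2); last by field.
    rewrite p2; lra.
  - rewrite p2; lra.
  - rewrite p2; lra.
  - rewrite p4; lra.
  - rewrite p4; lra.
move=> rf hf; have [v0|v0|v0] := ltgtP v 0.
- rewrite -(tB (-1)); last by lra.
  by apply: (apart_common _ _ _ hf (hh _ _ _ _)) => //; lra.
- rewrite -(tB 1); last by lra.
  by apply: (apart_common _ _ _ hf (hh _ _ _ _)) => //; lra.
have [u0|u0|u0] := ltgtP u 0.
- transitivity (T (- 2^-1) 2^-1).
    by apply: (apart_common _ _ _ hf (hh _ _ _ _)) => //; lra.
  rewrite -(tB 1); last by lra.
  by apply: (apart_common _ _ _ (hh _ _ _ _) (hh _ _ _ _)) => //; lra.
- by apply: (apart_common _ _ _ hf hs) => //; lra.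
- have [_] := hf; rewrite u0 v0 !mulr0 addr0.
  by have := rf (left_ring i); have := rf (right_ring i) => ? ? ?; exfalso; lra.
Qed.

End elementary.

(** Positions in [transition] are natural numbers; a position out of range gets the letter [1]. *)
Definition at_index (m : nat) (Gm : groupType) (g : 'I_m -> Gm) (o : nat) : Gm :=
  if insub o is Some i then g i else 1%g.

Lemma at_indexE m (Gm : groupType) (g : 'I_m -> Gm) (i : 'I_m) : at_index g i = g i.
Proof. by rewrite /at_index valK. Qed.

Section steps.
Variables (R : realType) (n : nat) (Gm : groupType) (sg rh : 'I_n.-1 -> Gm).
Local Notation ring := (R * R * R * R)%type.

Definition step (f : 'I_n -> ring) (o : nat) (a b : 'I_n) : Gm :=
  letter (at_index sg o) (at_index rh o) (kind_of (f a) (f b)).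

End steps.

(** * Classes of straight paths as words in the exchanges *)

Section edges.
Variables (R : realType) (n : nat).
Local Notation ring := (R * R * R * R)%type.
Implicit Types (P Q S f g : 'I_n -> ring) (w u v : seq 'I_n) (i : 'I_n.-1).
Local Notation estep := (step (@sigma_class R n) (@rho_class R n)).
Local Notation letter_ i := (letter (sigma_class R i) (rho_class R i)).

Lemma swap_class_letter i f : (forall a, 0 < radius (f a)) ->
  free_pairs f (left_ring i) (right_ring i) ->
  swap_class i f = letter (sigma_class R i) (rho_class R i)
    (kind_of (f (left_ring i)) (f (right_ring i))).
Proof.
move=> r fr; case: (kind_ofP (r _) (r _) fr) => [h|h|u v _ _ h] /=.
- exact: swap_class_inside.
- exact: swap_class_outside.
- exact: swap_class_apart h.
Qed.

Lemma edge_arrange f w w' : (forall a, 0 < radius (f a)) ->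
  perm_eq w (enum 'I_n) -> perm_eq w w' -> free_inversions (free_pairs f) w w' ->
  edge (arrange w f) (arrange w' f) = transition (estep f) 0 w w'.
Proof.
move=> r e ww' h.
apply: (@ell_transition _ _ (estep f) (free_pairs f) (enum 'I_n)
  (fun w w' => edge (arrange w f) (arrange w' f))) => //.
- exact: enum_uniq.
- by move=> w1 w2 w3 e1 e2 e3 h1 h2; apply: edge_mul; exact: arrange_fill.
- move=> u a b v e' fab; have sz := perm_size e'.
  rewrite size_cat /= size_enum_ord in sz.
  have su : (size u < n.-1)%N.
    by rewrite -[X in X.-1]sz addnS /= addnS ltnS leq_addr.
  have [s ws] := perm_of_order e'.
  have [-> sl sr] := @edge_swap _ _ f u a b v s (Ordinal su) r ws erefl fab.
  rewrite swap_class_letter//=; last by rewrite /free_pairs /= sl sr.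
  by rewrite /step sl sr -[size u]/(val (Ordinal su)) !at_indexE.
Qed.

(** [P] is spread out in its own order, rearranged in the order of [Q] with its profiles unchanged,
    then joined to [Q]; only the middle step contributes. *)
Lemma edge_transition P Q : valid P -> valid Q ->
  (forall a b, a != b -> exists t, sat t (P a) (P b) /\ sat t (Q a) (Q b)) ->
  edge P Q = transition (estep P) 0 (order P) (order Q).
Proof.
move=> vP vQ coh; have rP : forall a, 0 < radius (P a) by case: vP.
have rQ : forall a, 0 < radius (Q a) by case: vQ.
have eP := order_perm_eq P; have eQ := order_perm_eq Q.
have sP := order_sorted vP; have sQ := order_sorted vQ.
have h : free_inversions (free_pairs P) (order P) (order Q).
  move=> a b _ _ ab ba; have neq := before_neq ab.
  have [t [tP tQ]] := coh _ _ neq; apply/asboolP; case: t tP tQ => [|||| u v] tP tQ.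
  - by have := sQ _ _ ba; rewrite leNgt (tQ : cx (Q a) < cx (Q b)).
  - by have := sP _ _ ab; rewrite leNgt (tP : cx (P b) < cx (P a)).
  - by exists Inside.
  - by exists Outside.
  - by exists (Apart u v).
pose M := arrange (order P) P; pose M' := arrange (order Q) P.
have eqPQ : perm_eq (order P) (order Q) by rewrite (permPr eQ).
have [e1 _] : edge P M = 1%g /\ edge M P = 1%g.
  by apply: edge_sorted => //; exact: arrange_ssorted.
have [_ e2] : edge Q M' = 1%g /\ edge M' Q = 1%g.
  by apply: edge_sorted => //; exact: arrange_ssorted.
have coh4 a b : a != b -> exists t, [/\ sat t (P a) (P b), sat t (M a) (M b),
    sat t (M' a) (M' b) & sat t (Q a) (Q b)].
  move=> ab; have [t [tP tQ]] := coh _ _ ab; exists t.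
  case: t tP tQ => [|||| u v] tP tQ; try by split=> //; rewrite sat_arrange.
  - split=> //; apply: arrange_before.
      have [//|k] := before_cases eP ab.
      by have := sP _ _ k; rewrite leNgt (tP : cx (P a) < cx (P b)).
    have [//|k] := before_cases eQ ab.
    by have := sQ _ _ k; rewrite leNgt (tQ : cx (Q a) < cx (Q b)).
  - split=> //; apply: arrange_after.
      have [k|//] := before_cases eP ab.
      by have := sP _ _ k; rewrite leNgt (tP : cx (P b) < cx (P a)).
    have [k|//] := before_cases eQ ab.
    by have := sQ _ _ k; rewrite leNgt (tQ : cx (Q b) < cx (Q a)).
have f1 : fill P M M'.
  by apply: fill_coherent => [a|a b /coh4[t [? ? ? ?]]]; [split; exact: rP|exists t].
have f2 : fill P M' Q.
  by apply: fill_coherent => [a|a b /coh4[t [? ? ? ?]]]; [split; [exact: rP|exact: rP|exact: rQ]|exists t].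
rewrite -(edge_mul f2) e2 mulg1 -(edge_mul f1) e1 mul1g.
exact: edge_arrange.
Qed.

Lemma transition_in (Gm : groupType) (G : Gm -> Prop) (L : eqType) (s : nat -> L -> L -> Gm) o (w w' : seq L) :
  G 1%g -> (forall x y, G x -> G y -> G (x * y)%g) -> (forall k a b, G (s k a b)) ->
  G (transition s o w w').
Proof.
move=> G1 GM Gs; elim: w' w o => [|x w' IH] w o //=; apply: (GM) => //.
elim: w o {IH} => [|a w IH] o //=; case: eqP => // _.
by apply: GM; [exact: IH|exact: Gs].
Qed.

Lemma enum_drop (k : 'I_n) : drop k (enum 'I_n) = k :: drop k.+1 (enum 'I_n).
Proof. by rewrite (drop_nth k) ?size_enum_ord// nth_ord_enum. Qed.

(** * Relations from families with pairwise disjoint profiles *)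

Section all_free.
Variable f : 'I_n -> ring.
Hypothesis rf : forall a, 0 < radius (f a).
Hypothesis ff : forall a b, a != b -> free_pairs f a b.
Local Notation E w w' := (edge (arrange w f) (arrange w' f)).

Let free_all w w' : free_inversions (free_pairs f) w w'.
Proof. by move=> a b _ _ ab _; apply: ff; exact: before_neq ab. Qed.

(** No order is forbidden here, so all triangles of arrangements are filled: chains of exchanges
    with the same ends have the same product. *)
Lemma free_mul w1 w2 w3 : perm_eq w1 (enum 'I_n) -> perm_eq w2 (enum 'I_n) ->
  perm_eq w3 (enum 'I_n) -> (E w1 w2 * E w2 w3)%g = E w1 w3.
Proof. by move=> e1 e2 e3; apply: edge_mul; exact: arrange_fill. Qed.

Lemma free_swap i u a b v : perm_eq (u ++ a :: b :: v) (enum 'I_n) -> size u = i ->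
  perm_eq (u ++ b :: a :: v) (enum 'I_n) /\
  E (u ++ a :: b :: v) (u ++ b :: a :: v) = letter_ i (kind_of (f a) (f b)).
Proof.
move=> wE su; have ww : perm_eq (u ++ a :: b :: v) (u ++ b :: a :: v).
  exact: (perm_move u [:: a] b v).
split; first by rewrite -(permPl ww).
rewrite edge_arrange// transition_swap; last by rewrite (perm_uniq wE) enum_uniq.
by rewrite add0n su /step !at_indexE.
Qed.

Let split_two i : enum 'I_n =
  take i (enum 'I_n) ++ left_ring i :: right_ring i :: drop i.+2 (enum 'I_n).
Proof.
by rewrite -{1}(cat_take_drop i (enum 'I_n)) (enum_drop (left_ring i)) (enum_drop (right_ring i)).
Qed.

Let size_prefix (k : nat) : (k <= n)%N -> size (take k (enum 'I_n)) = k.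
Proof. by move=> kn; rewrite size_take_min size_enum_ord; exact/minn_idPl. Qed.

Let prefix_size i : size (take i (enum 'I_n)) = i.
Proof. by apply: size_prefix; exact/ltnW/(ltn_ord (left_ring i)). Qed.

Lemma free_square i : (letter_ i (kind_of (f (left_ring i)) (f (right_ring i))) *
  letter_ i (kind_of (f (right_ring i)) (f (left_ring i))) = 1)%g.
Proof.
have e0 := perm_refl (enum 'I_n); rewrite {1}(split_two i) in e0.
have [e1 <-] := free_swap e0 (prefix_size i); have [_ <-] := free_swap e1 (prefix_size i).
by rewrite free_mul// edge_id//; exact: arrange_valid.
Qed.

(** The two exchanges, performed in either order, join the same arrangements. *)
Lemma free_far (i j : 'I_n.-1) : (i.+1 < j)%N ->
  commute (letter_ i (kind_of (f (left_ring i)) (f (right_ring i))))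
    (letter_ j (kind_of (f (left_ring j)) (f (right_ring j)))).
Proof.
move=> ij; have [w ew] : exists w, drop i.+2 (enum 'I_n) =
    w ++ left_ring j :: right_ring j :: drop j.+2 (enum 'I_n).
  exists (take (j - i.+2) (drop i.+2 (enum 'I_n))).
  rewrite -{1}(cat_take_drop (j - i.+2) (drop i.+2 (enum 'I_n))) drop_drop subnK//.
  by rewrite (enum_drop (left_ring j)) (enum_drop (right_ring j)).
have e0 := perm_refl (enum 'I_n); rewrite {1}(split_two i) ew in e0.
have sj a b : size (take i (enum 'I_n) ++ a :: b :: w) = j.
  have := congr1 size ew; rewrite size_drop !size_cat /= prefix_size size_drop size_enum_ord.
  by have := ltn_ord (right_ring j); rewrite /=; lia.
have assoc a b v : take i (enum 'I_n) ++ a :: b :: w ++ v =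
    (take i (enum 'I_n) ++ a :: b :: w) ++ v by rewrite -catA.
have [e1 h1] := free_swap e0 (prefix_size i).
have e0' := e0; rewrite assoc in e0'; have [e2 h2] := free_swap e0' (sj _ _).
have e1' := e1; rewrite assoc in e1'; have [e3 h3] := free_swap e1' (sj _ _).
have e2' := e2; rewrite -assoc in e2'; have [_ h4] := free_swap e2' (prefix_size i).
rewrite -!assoc in h2 h3 e3.
rewrite /commute -[in LHS]h1 -[in LHS]h3 -[in RHS]h2 -[in RHS]h4.
by rewrite !free_mul.
Qed.

(* Both sides are the class of a straight path reversing three adjacent rings. *)
Lemma free_hexagon (i j : 'I_n.-1) : j = i.+1 :> nat ->
  let a := f (left_ring i) in let b := f (right_ring i) in let c := f (right_ring j) in
  (letter_ i (kind_of a b) * letter_ j (kind_of a c) * letter_ i (kind_of b c) =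
   letter_ j (kind_of b c) * letter_ i (kind_of a c) * letter_ j (kind_of a b))%g.
Proof.
move=> ij /=; set a := left_ring i; set b := right_ring i; set c := right_ring j.
have e0 : perm_eq (take i (enum 'I_n) ++ a :: b :: c :: drop j.+2 (enum 'I_n)) (enum 'I_n).
  rewrite {3}(split_two i) -/a -/b.
  by have := enum_drop c; rewrite /c /= ij => ->.
have si := prefix_size i.
have sj x : size (rcons (take i (enum 'I_n)) x) = j by rewrite size_rcons si ij.
have [e1 <-] := free_swap e0 si.
have e0' := e0; rewrite -cat_rcons in e0'; have [e2 <-] := free_swap e0' (sj _).
have e1' := e1; rewrite -cat_rcons in e1'; have [e3 <-] := free_swap e1' (sj _).
rewrite cat_rcons in e2; have [e4 <-] := free_swap e2 si.
rewrite cat_rcons in e3; have [e5 <-] := free_swap e3 si.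
have e4' := e4; rewrite -cat_rcons in e4'; have [_ <-] := free_swap e4' (sj _).
by rewrite !cat_rcons !free_mul.
Qed.

End all_free.

End edges.

(** * Relations in the fundamental group *)

Section lines.
Variables (R : realType) (n : nat).
Local Notation ring := (R * R * R * R)%type.

Definition line (y r : R) : ring := (0, y, 0, r).

Lemma line_nest y r y' r' : r < r' -> r - r' < y - y' -> y - y' < r' - r ->
  nest (line y r) (line y' r').
Proof.
move=> rr h1 h2; rewrite /nest /line /radius /cy /cz /= rr subrr expr0n addr0 /=.
rewrite -subr_gt0 (_ : _ - _ = (r' - r - (y - y')) * (r' - r + (y - y'))); last by ring.
by rewrite mulr_gt0//; lra.
Qed.

Lemma line_apart y r y' r' : r + r' < y - y' -> sat (Apart 1 0) (line y r) (line y' r').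
Proof.
move=> h; split; first by rewrite expr1n expr0n addr0.
by rewrite /line /radius /cy /cz /= mulr1 mulr0 addr0.
Qed.

Definition line_disjoint (y r y' r' : R) := [\/ r + r' < y - y', r + r' < y' - y |
  (r < r' /\ r - r' < y - y' < r' - r)].

Lemma line_free y r y' r' : line_disjoint y r y' r' ->
  disjoint_profiles (line y r) (line y' r').
Proof.
case=> [h|h|[h1 /andP[h2 h3]]]; apply/asboolP.
- by exists (Apart 1 0) => //; exact: line_apart.
- by exists (Apart (- 1) (- 0)) => //; apply: apart_opp; apply: line_apart; lra.
- by exists Inside => //; exact: line_nest.
Qed.

Lemma line_separate y r y' r' : 0 < r -> 0 < r' -> r + r' < y - y' \/ r + r' < y' - y ->
  kind_of (line y r) (line y' r') = Separate.
Proof.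
move=> r0 r0' h; rewrite /kind_of; case: h => h.
- have {}h : sat (Apart 1 0) (line y r) (line y' r') by exact: line_apart.
  by rewrite (apart_nest _ h)// (apart_nest _ (apart_opp h)).
- have {}h : sat (Apart 1 0) (line y' r') (line y r) by apply: line_apart; lra.
  by rewrite (apart_nest _ (apart_opp h))// (apart_nest _ h).
Qed.

Lemma line_inner y r y' r' : r < r' -> r - r' < y - y' -> y - y' < r' - r ->
  kind_of (line y r) (line y' r') = Inner.
Proof. by move=> h1 h2 h3; rewrite /kind_of line_nest. Qed.

(** The labels [i], [i + 1], [i + 2] carry the prescribed circles. The spacing [100] keeps all
    others away from circles with centres between [-50] and [50] and radii at most [10]. *)
Definition tri (i : nat) (ya ra yb rb yc rc : R) (c : 'I_n) : ring :=
  if c == i :> nat then line ya ra else if c == i.+1 :> nat then line yb rb else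
  if c == i.+2 :> nat then line yc rc else line (100 * (c%:R - i%:R)) 1.

Lemma tri_free i ya ra yb rb yc rc :
  [/\ 0 < ra <= 10, 0 < rb <= 10 & 0 < rc <= 10] ->
  [/\ -50 <= ya <= 50, -50 <= yb <= 50 & -50 <= yc <= 50] ->
  line_disjoint ya ra yb rb -> line_disjoint ya ra yc rc -> line_disjoint yb rb yc rc ->
  forall c d, c != d -> free_pairs (tri i ya ra yb rb yc rc) c d.
Proof.
move=> [ra0 rb0 rc0] [yaB ybB ycB] ab ac bc c d; wlog cd : c d / (c < d)%N => [hw cd|_].
  have [h|h|e] := ltngtP c d; first exact: hw.
  - by rewrite free_pairs_sym; apply: hw => //; rewrite eq_sym.
  - by case/eqP: cd; exact: val_inj.
have lt1 (a b : nat) : (a < b)%N -> a%:R + 1 <= b%:R :> R.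
  by move=> h; rewrite natr1 ler_nat.
have hcd := lt1 _ _ cd.
rewrite /free_pairs /tri; apply: contraT => nfr.
have i1 : (i.+1)%:R = i%:R + 1 :> R by rewrite -natr1.
have i2 : (i.+2)%:R = i%:R + 2 :> R by rewrite -!natr1; lra.
have lo (a : nat) : a <> i -> a <> i.+1 -> a <> i.+2 -> a%:R - i%:R <= -1 :> R \/ a%:R - i%:R >= 3 :> R.
  move=> h1 h2 h3; have [k|k] : (a < i)%N \/ (i.+2 < a)%N by clear -h1 h2 h3; lia.
    by left; have := lt1 _ _ k; lra.
  by right; have := lt1 _ _ k; lra.
move: nfr; case: eqP => [ci|ci]; [|case: eqP => [ci1|ci1]; [|case: eqP => [ci2|ci2]]];
  (case: eqP => [di|di]; [|case: eqP => [di1|di1]; [|case: eqP => [di2|di2]]]);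
  move/negP; case;
  try (exfalso; clear -cd ci di; lia); try (exfalso; clear -cd ci di1; lia);
  try (exfalso; clear -cd ci di2; lia); try (exfalso; clear -cd ci1 di; lia);
  try (exfalso; clear -cd ci1 di1; lia); try (exfalso; clear -cd ci1 di2; lia);
  try (exfalso; clear -cd ci2 di; lia); try (exfalso; clear -cd ci2 di1; lia);
  try (exfalso; clear -cd ci2 di2; lia);
  try (exact: line_free); apply: line_free.
all: try (have hc := lo _ ci ci1 ci2); try (have hd := lo _ di di1 di2).
- case: hd => hd; last by apply: Or32; lra.
  by exfalso; rewrite ci in hcd; lra.
- case: hd => hd; last by apply: Or32; lra.
  by exfalso; rewrite ci1 in hcd; lra.
- case: hd => hd; last by apply: Or32; lra.
  by exfalso; rewrite ci2 in hcd; lra.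
- case: hc => hc; first by apply: Or32; lra.
  by exfalso; rewrite di in hcd; lra.
- case: hc => hc; first by apply: Or32; lra.
  by exfalso; rewrite di1 in hcd; lra.
- case: hc => hc; first by apply: Or32; lra.
  by exfalso; rewrite di2 in hcd; lra.
- by apply: Or32; lra.
Qed.

Lemma tri_radius i ya ra yb rb yc rc : [/\ 0 < ra <= 10, 0 < rb <= 10 & 0 < rc <= 10] ->
  forall c, 0 < radius (tri i ya ra yb rb yc rc c).
Proof.
move=> [ra0 rb0 rc0] c; rewrite /tri.
by case: eqP => _; [|case: eqP => _; [|case: eqP => _]]; rewrite /line /radius /=; lra.
Qed.

(** With [p] the circle [i] takes the centre of the larger circle [i + 1] and lies inside it;
    otherwise the two are separate. [q] does the same at [j], so the booleans select between [rho]
    and [sigma]. *)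
Definition far_center (p q : bool) (i j c : nat) : nat :=
  if ((c == i) && p) || ((c == j) && q) then c.+1 else c.

Definition far_radius (i j c : nat) : nat := if (c == i.+1) || (c == j.+1) then 2%N else 1%N.

Definition far_pairs p q (i j : nat) (c : 'I_n) : ring :=
  line (100 * (far_center p q i j c)%:R) (far_radius i j c)%:R.

Lemma far_pairs_free p q i j : (i.+1 < j)%N ->
  forall c d, c != d -> free_pairs (far_pairs p q i j) c d.
Proof.
move=> ij c d; wlog cd : c d / (c < d)%N => [hw cd|_].
  have [h|h|e] := ltngtP c d; first exact: hw.
  - by rewrite free_pairs_sym; apply: hw => //; rewrite eq_sym.
  - by case/eqP: cd; exact: val_inj.
have rB (a : nat) : 1 <= (far_radius i j a)%:R :> R /\ (far_radius i j a)%:R <= 2 :> R.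
  by rewrite /far_radius; case: ifP => _; split; lra.
have [h|[h1 h2 h3]] : (far_center p q i j c < far_center p q i j d)%N \/
    [/\ far_center p q i j c = far_center p q i j d, far_radius i j c = 1%N & far_radius i j d = 2%N].
  rewrite /far_center /far_radius.
  case: (eqVneq (val c) i) => /= [ci|ci]; case: (eqVneq (val c) j) => /= [cj|cj];
  case: (eqVneq (val d) i) => /= [di|di]; case: (eqVneq (val d) j) => /= [dj|dj];
  case: (p) => /=; case: (q) => /=; try (by left; lia);
  case: (eqVneq (val d) (val c).+1) => /= [e|e]; try (by left; lia);
  right; split; try lia; by case: ifP => //; lia.
- rewrite /free_pairs /far_pairs; apply: line_free; apply: Or32.
  have := rB c; have := rB d; move: h; rewrite -(ler_nat R) -natr1; lra.
- rewrite /free_pairs /far_pairs h1 h2 h3; apply: line_free; apply: Or33; rewrite subrr; lra.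
Qed.

Lemma far_pairs_radius p q i j c : 0 < radius (far_pairs p q i j c).
Proof. by rewrite /far_pairs /line /radius /far_radius /=; case: ifP => _; lra. Qed.

End lines.

Section relations_hold.
Variables (R : realType) (n : nat).
Local Notation letter_ i := (letter (sigma_class R i) (rho_class R i)).

Definition UR_generator (Gm : groupType) (sg rh : 'I_n.-1 -> Gm) (x : generator n.-1) : Gm :=
  match x with Sigma i => sg i | Rho i => rh i end.

Let gen := UR_generator (@sigma_class R n) (@rho_class R n).

(** [Separate] is its own opposite, so the two letters in [free_square] coincide. *)
Lemma sigma_class_square i : (sigma_class R i * sigma_class R i = 1 :> UR_group R n)%g.
Proof.
have t : [/\ 0 < (1 : R) <= 10, 0 < (1 : R) <= 10 & 0 < (1 : R) <= 10] by split; lra.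
have b : [/\ -50 <= (0 : R) <= 50, -50 <= (10 : R) <= 50 & -50 <= (20 : R) <= 50] by split; lra.
have d1 : line_disjoint (0 : R) 1 10 1 by apply: Or32; lra.
have d2 : line_disjoint (0 : R) 1 20 1 by apply: Or32; lra.
have d3 : line_disjoint (10 : R) 1 20 1 by apply: Or32; lra.
have := free_square (tri_radius i 0 10 20 t) (tri_free i t b d1 d2 d3) i.
rewrite /tri /= eqxx (gtn_eqF (ltnSn i)) eqxx.
have -> : kind_of (line (0 : R) 1) (line 10 1) = Separate.
  by apply: line_separate; try lra; right; lra.
have -> : kind_of (line (10 : R) 1) (line 0 1) = Separate.
  by apply: line_separate; try lra; left; lra.
by [].
Qed.

Lemma far_commute (p q : bool) (i j : 'I_n.-1) : (i.+1 < j)%N ->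
  commute (letter_ i (if p then Inner else Separate))
    (letter_ j (if q then Inner else Separate)).
Proof.
move=> ij; have := free_far (@far_pairs_radius R n p q i j) (@far_pairs_free R n p q i j ij) ij.
have k (b : bool) (c : 'I_n.-1) : (c == i) && (b == p) || (c == j) && (b == q) ->
  kind_of (far_pairs R p q i j (left_ring c)) (far_pairs R p q i j (right_ring c)) = if b then Inner else Separate.
  move=> h; rewrite /far_pairs /far_center /far_radius /=.
  case/orP: h => /andP[/eqP -> /eqP ->].
    rewrite !eqxx (ltn_eqF (ltnW ij)) (ltn_eqF (leqW (ltnW ij))) (ltn_eqF (ltnSn i))
      (gtn_eqF (ltnSn i)) (ltn_eqF ij) /= orbF.
    case: (p) => /=; first by rewrite line_inner// ?subrr; lra.
    by apply: line_separate; try lra; right; rewrite -natr1; lra.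
  rewrite !eqxx (gtn_eqF (ltnW ij)) (gtn_eqF (leqW (ltnW ij))) (ltn_eqF (ltnSn j))
    (gtn_eqF (ltnSn j)) (gtn_eqF ij) /= orbT.
  case: (q) => /=; first by rewrite line_inner// ?subrr; lra.
  by apply: line_separate; try lra; right; rewrite -natr1; lra.
by rewrite (k p i) ?eqxx// (k q j) ?eqxx ?orbT.
Qed.

Lemma far_commute_gen (i j : 'I_n.-1) : (i.+1 < j)%N || (j.+1 < i)%N ->
  [/\ commute (rho_class R i) (rho_class R j), commute (sigma_class R i) (sigma_class R j) &
      commute (rho_class R i) (sigma_class R j)].
Proof.
move=> /orP[ij|ij].
  by split; [exact: (far_commute true true ij)|exact: (far_commute false false ij)|exact: (far_commute true false ij)].
split; apply: commute_sym.
- exact: (far_commute true true ij).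
- exact: (far_commute false false ij).
- exact: (far_commute false true ij).
Qed.

Lemma tri_hexagon (i j : 'I_n.-1) (ya ra yb rb yc rc : R) (ka kb kc : kind) : j = i.+1 :> nat ->
  [/\ 0 < ra <= 10, 0 < rb <= 10 & 0 < rc <= 10] ->
  [/\ -50 <= ya <= 50, -50 <= yb <= 50 & -50 <= yc <= 50] ->
  line_disjoint ya ra yb rb -> line_disjoint ya ra yc rc -> line_disjoint yb rb yc rc ->
  kind_of (line ya ra) (line yb rb) = ka -> kind_of (line ya ra) (line yc rc) = kb ->
  kind_of (line yb rb) (line yc rc) = kc ->
  (letter_ i ka * letter_ j kb * letter_ i kc = letter_ j kc * letter_ i kb * letter_ j ka)%g.
Proof.
move=> ij r y ab ac bc <- <- <-.
have := free_hexagon (tri_radius i ya yb yc r) (tri_free i r y ab ac bc) ij.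
rewrite /tri /= eqxx (gtn_eqF (ltnSn i)) eqxx ij.
have -> : (i.+2 == i) = false by lia.
have -> : (i.+2 == i.+1) = false by lia.
by rewrite eqxx.
Qed.

(* Each braid-like relation is the hexagon of three disjoint circles centred on a
   line, nested as its letters prescribe. *)
Ltac by_lines := by [split; lra|apply: Or32; lra|apply: Or33; split; lra|
  apply: line_inner; lra|apply: line_separate; try lra; right; lra].

Lemma UR_relations_hold u v : UR_rel u v -> word_val gen u = word_val gen v.
Proof.
have comm x y : commute (gen x) (gen y) -> word_val gen (commw x y) = 1%g.
  by move=> c; rewrite /commw !word_val_cons word_val_nil /= mulg1 !mulgA c -mulgA -invgM mulgV.
have b3 x y z x' y' z' : (gen x * gen y * gen z = gen x' * gen y' * gen z')%g ->
    word_val gen (posw [:: x; y; z]) = word_val gen (posw [:: x'; y'; z']).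
  by rewrite /posw /= !word_val_cons word_val_nil /= !mulg1 !mulgA.
case=> [i j ij|i j ij|i j ij|i j ij|i j ij|i j ij|i j ij|i j ij|i].
- by rewrite comm ?word_val_nil//; have [] := far_commute_gen ij.
- by rewrite comm ?word_val_nil//; have [] := far_commute_gen ij.
- by rewrite comm ?word_val_nil//; have [] := far_commute_gen ij.
- apply: b3; apply: (@tri_hexagon i j 0 1 0 2 0 3 Inner Inner Inner ij); by_lines.
- apply: b3; apply: (@tri_hexagon i j 0 1 10 1 20 1 Separate Separate Separate ij); by_lines.
- apply: b3; apply: (@tri_hexagon i j 0 1 0 2 20 1 Inner Separate Separate ij); by_lines.
- apply: b3; apply: (@tri_hexagon i j 0 1 20 1 20 2 Separate Separate Inner ij); by_lines.
- apply: b3; apply: (@tri_hexagon i j (-3) 1 3 1 0 9 Separate Inner Inner ij); by_lines.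
- by rewrite /posw /= !word_val_cons word_val_nil /= mulg1 sigma_class_square.
Qed.

End relations_hold.

(** * Generation *)

Section small_paths.
Variables (R : realType) (n : nat).
Local Notation ring := (R * R * R * R)%type.
Local Notation Y := (UR R n).
Implicit Types (P Q S : 'I_n -> ring).

Definition separated (e : R) P := forall a b, a != b -> e <= `|P a - P b|.

Lemma separated_near P (k : R) : 0 < k -> valid P -> \forall e \near 0^'+, separated (k * e) P.
Proof.
move=> k0 vP; apply: filter_forall => a; apply: filter_forall => b.
have [->|ab] := eqVneq a b; first by near=> e.
have d0 : 0 < `|P a - P b| by rewrite normr_gt0 subr_eq0; exact: valid_neq.
near=> e => _; rewrite mulrC -ler_pdivlMr//.
by near: e; apply: nbhs_right_le; rewrite divr_gt0.
Unshelve. all: by end_near. Qed.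

Definition coherent (e : R) P := forall a b, a != b ->
  exists t, forall Q, within_dist e P Q -> sat t (Q a) (Q b).

Lemma good_radius P (k : R) : 0 < k -> valid P ->
  exists e, [/\ 0 < e, coherent e P & separated (k * e) P].
Proof.
move=> k0 vP; have sP := separated_near k0 vP; have cP := coherent_near vP.
have /filter_ex [e [? [? ?]]] : \forall e \near 0^'+, 0 < e /\ coherent e P /\ separated (k * e) P.
  near=> e; split; first by near: e; exact: nbhs_right_gt.
  by split; near: e.
by exists e.
Unshelve. all: by end_near. Qed.

(** A separation of [3 * e] leaves room for only one labelling within [e] of [P0], so the labels
    chosen point by point depend continuously on [t]. *)
Lemma small_lift (P0 : 'I_n -> ring) (e : R) (F : R -> Y) : 0 < e ->
  separated (3 * e) P0 -> continuous F ->
  (forall t, exists Q, [/\ valid Q, within_dist e P0 Q & config Q = F t]) ->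
  exists q : R -> 'I_n -> ring, [/\ forall t, valid (q t), forall t, within_dist e P0 (q t),
     forall t, config (q t) = F t & forall a, continuous (fun t => q t a)].
Proof.
move=> e0 sep cF lift; pose q t := projT1 (cid (lift t)).
have qP t : [/\ valid (q t), within_dist e P0 (q t) & config (q t) = F t].
  exact: projT2 (cid (lift t)).
exists q; split=> [t|t|t|a]; [by have [] := qP t|by have [] := qP t|by have [] := qP t|].
move=> t; apply/cvgrPdist_lt => d d0.
have [vq wq Fq] := qP t.
pose d' := Num.min d e.
have d'0 : 0 < d' by rewrite lt_min d0 e0.
have := config_nbhs vq d'0; rewrite Fq => /cF.
apply: (@filterS _ (nbhs t)) => t' [S /= [vS wS] FS].
have [vq' wq' Fq'] := qP t'.
have [s hs] := config_eq vS vq' (etrans FS (esym Fq')).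
(* Otherwise [P0 (s a)] and [P0 a], both near [S (s a)], would be closer than [2 * e + e]. *)
suff sa : s a = a by rewrite hs /= sa (lt_le_trans (wS a))// ge_min lexx.
apply/eqP; apply: contraT => neq.
have h1 := sep _ _ neq.
have h2 : `|P0 (s a) - S (s a)| < 2 * e.
  apply: (le_lt_trans (ler_distD (q t (s a)) _ _)).
  have k1 := wq (s a); have k2 := wS (s a).
  have k3 : d' <= e by rewrite ge_min lexx orbT.
  lra.
have h3 : `|S (s a) - P0 a| < e by have := wq' a; rewrite hs /= distrC.
have h4 := ler_distD (S (s a)) (P0 (s a)) (P0 a).
lra.
Qed.

(** The lifted path is deformed onto the chord of its ends by straight segments. *)
Lemma small_path_edge (P0 : 'I_n -> ring) (e : R) (F : R -> Y) : 0 < e ->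
  separated (3 * e) P0 -> coherent e P0 -> continuous F ->
  (forall t, 0 <= t <= 1 -> exists Q, [/\ valid Q, within_dist e P0 Q & config Q = F t]) ->
  exists P Q, [/\ valid P /\ valid Q, within_dist e P0 P, within_dist e P0 Q &
    path_class F = edge P Q].
Proof.
move=> e0 sep coh cF lift.
have cFc : continuous (F \o clamp) by apply: comp_cts cF; exact: clamp_cts.
have liftc t : exists Q, [/\ valid Q, within_dist e P0 Q & config Q = (F \o clamp) t].
  by apply: lift; exact: clamp_itv.
have [q [vq wq Fq cq]] := small_lift e0 sep cFc liftc.
exists (q 0), (q 1); split=> //.
(* A type valid on the whole ball holds along the curve [q], by convexity on the chord, and again by
   convexity between curve and chord. *)
have V w1 w2 w3 t (w : weights w1 w2 w3) : valid (mixc w1 w2 w3 (q t) (segment (q 0) (q 1) t) (q t)).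
  have seg a b u : (forall t, sat u (q t a) (q t b)) ->
      sat u (segment (q 0) (q 1) t a) (segment (q 0) (q 1) t b).
    by move=> h; apply: mix_sat => //; exact: weights2.
  split=> [a|a b ab].
    have r t' : 0 < radius (q t' a) by have [] := vq t'.
    by apply: mix_gt0 => //; apply: mix_gt0 => //; exact: weights2.
  have [u hu] := coh _ _ ab; exists u.
  by apply: mix_sat => //; [|apply: seg|]; move=> *; apply: hu; exact: wq.
have e0' : F 0 = config (q 0) by rewrite Fq /= clampK// lexx ler01.
have e1' : F 1 = config (q 1) by rewrite Fq /= clampK// lexx ler01.
have vs t : valid (segment (q 0) (q 1) t).
  have w : weights (0 : R) 1 0 by split; lra.
  have := V _ _ _ t w; rewrite /mixc (_ : (fun i => _) = segment (q 0) (q 1) t)//.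
  by apply/funext => i; rewrite mix010.
pose p := Arc cF e0' e1'.
rewrite -[F]/(arc_fun p) /edge -[X in _ = path_class X]/(arc_fun (edge_arc vs)).
rewrite !path_class_arc; apply: closed_class_homotopic.
exists (fun u => config (mixc (1 - clamp u.1) (clamp u.1) 0 (q u.2) (segment (q 0) (q 1) u.2) (q u.2))).
have c1 : continuous (fun u : R * R => clamp u.1) by apply: comp_cts clamp_cts; exact: fst_continuous.
split.
- apply: config_cts => [u|a]; first by apply: V; exact: weights2.
  apply: (@mixc_cts _ _ _ (fun u => 1 - clamp u.1) (fun u => clamp u.1) (cst 0) (fun u => q u.2)
    (fun u => segment (q 0) (q 1) u.2) (fun u => q u.2)) => //.
  + by apply: sub_cts => //; exact: cst_cts.
  + exact: cst_cts.
  + by move=> i; apply: (@comp_cts _ _ _ snd (fun t => q t i)) => //; exact: snd_continuous.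
  + by move=> i; apply: (@comp_cts _ _ _ snd (fun t => segment (q 0) (q 1) t i)); [exact: snd_continuous|exact: segment_cts].
  + by move=> i; apply: (@comp_cts _ _ _ snd (fun t => q t i)) => //; exact: snd_continuous.
- move=> t t01 /=; rewrite (@clampK _ 0) ?lexx ?ler01// subr0 -[RHS](congr1 F (clampK t01)).
  rewrite -[RHS]Fq; congr config; apply/funext => a; exact: mix100.
- move=> t t01 /=; rewrite (@clampK _ 1) ?lexx ?ler01// subrr.
  congr config; apply/funext => a; exact: mix010.
- move=> s s01 /=; congr config; rewrite segment0; apply: mixcc; exact: weights2.
- move=> s s01 /=; congr config; rewrite segment1; apply: mixcc; exact: weights2.
Qed.

Definition subpath (F : R -> Y) (s t : R) : R -> Y := fun x => F ((t - s) * x + s).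

Lemma subpath_cts F s t : continuous F -> continuous (subpath F s t).
Proof. by move=> cF; apply: comp_cts cF; exact: affineR_cts. Qed.

Lemma path_class_subpath F s t u : continuous F ->
  (path_class (subpath F s t) * path_class (subpath F t u))%g = path_class (subpath F s u).
Proof.
move=> cF.
have e0 a b : subpath F a b 0 = F a by rewrite /subpath mulr0 add0r.
have e1 a b : subpath F a b 1 = F b by rewrite /subpath mulr1 subrK.
pose p a b := Arc (@subpath_cts F a b cF) (e0 a b) (e1 a b).
rewrite -[subpath F s t]/(arc_fun (p s t)) -[subpath F t u]/(arc_fun (p t u)).
rewrite -[subpath F s u]/(arc_fun (p s u)) !path_class_arc closed_class_cat.
apply: closed_class_homotopic.
apply: (@arc_homotopic_reparam _ _ _ _ _ _ F
   (fun x => (t - s) * Num.min (2 * x + 0) 1 + s + (u - t) * Num.max 0 (2 * x - 1)) (fun x => (u - s) * x + s)) => //.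
- apply: add_cts; first apply: add_cts.
  + by apply: mul_cts; [exact: cst_cts|apply: min_cts; [exact: affineR_cts|exact: cst_cts]].
  + exact: cst_cts.
  + by apply: mul_cts; [exact: cst_cts|apply: max_cts; [exact: cst_cts|exact: affineR_cts]].
- exact: affineR_cts.
- rewrite mulr0 addr0 (min_idPl _) ?ler01// (max_idPl _); last by lra.
  by rewrite !mulr0 !add0r addr0.
- rewrite mulr1 addr0 (min_idPr _); last by lra.
  rewrite (max_idPr _); last by lra.
  lra.
- move=> x /andP[x0 x1]; rewrite /= /arc_cat_fun /= /subpath.
  case: ifPn => h.
    rewrite (min_idPl _); last by lra.
    by rewrite (max_idPl _) ?mulr0 ?addr0//; lra.
  rewrite -ltNge in h; rewrite (min_idPr _); last by lra.
  rewrite (max_idPr _); last by lra.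
  by congr F; ring.
Qed.

End small_paths.

Section generation.
Variables (R : realType) (n : nat).
Local Notation ring := (R * R * R * R)%type.
Local Notation Y := (UR R n).
Local Notation gen := (UR_generator (@sigma_class R n) (@rho_class R n)).

Definition generated (x : UR_group R n) := exists w, word_val gen w = x.

Lemma generated1 : generated 1%g.
Proof. by exists [::]; rewrite word_val_nil. Qed.

Lemma generatedM x y : generated x -> generated y -> generated (x * y)%g.
Proof. by move=> [u <-] [v <-]; exists (u ++ v); rewrite word_val_cat. Qed.

Lemma generated_letter (f : 'I_n -> ring) k (a b : 'I_n) :
  generated (step (@sigma_class R n) (@rho_class R n) f k a b).
Proof.
rewrite /step /at_index; case: insubP => [i _ _|_]; case: (kind_of _ _) => /=.
- by exists [:: (Rho i, false)]; rewrite word_val_cons word_val_nil mulg1.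
- by exists [:: (Rho i, true)]; rewrite word_val_cons word_val_nil mulg1.
- by exists [:: (Sigma i, false)]; rewrite word_val_cons word_val_nil mulg1.
- exact: generated1.
- by rewrite invg1; exact: generated1.
- exact: generated1.
Qed.

(** Short pieces are edges, which [edge_transition] spells out in letters; [interval_chain]
    multiplies the pieces. *)
Lemma path_class_generated (F : R -> Y) : continuous F -> generated (path_class F).
Proof.
move=> cF; suff : generated (path_class (subpath F 0 1)).
  congr (generated (path_class _)); apply/funext => x.
  by rewrite /subpath subr0 mul1r addr0.
apply: (@interval_chain _ (fun s t => generated (path_class (subpath F s t)))) => //.
  move=> s t u _ _ _ _ h1 h2; rewrite -(@path_class_subpath _ _ F s t u cF).
  exact: generatedM.
move=> t t01; have [P0 vP0 FP0] := configP (F t).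
have [e [e0 coh sep]] := good_radius (ltr0Sn R 2) vP0.
have := config_nbhs vP0 e0; rewrite FP0 => /cF /nbhs_ballP[d /= d0 hd].
near=> c => s u sa ts st tu ut ub.
have cd : c <= d by near: c; exact: nbhs_right_le.
have [|P [Q [[vP vQ] wP wQ ->]]] := small_path_edge e0 sep coh (@subpath_cts _ _ F s u cF).
  move=> x /andP[x0 x1].
  have hx : ball t d ((u - s) * x + s).
    have k1 : 0 <= (u - s) * x by rewrite mulr_ge0//; lra.
    have k2 : (u - s) * x <= u - s by rewrite ler_piMr//; lra.
    by rewrite /ball /= ltr_norml; lra.
  by have [Q [vQ wQ] FQ] := hd _ hx; exists Q.
rewrite (edge_transition vP vQ); last first.
  by move=> a b ab; have [v hv] := coh _ _ ab; exists v; split; exact: hv.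
apply: transition_in; [exact: generated1|exact: generatedM|exact: generated_letter].
Unshelve. all: by end_near. Qed.

Lemma all_generated (x : UR_group R n) : generated x.
Proof.
rewrite -[x]loop_class_repr -arc_of_loopE -(closed_class_loop (@tail_base R n)).
rewrite -path_class_arc; apply: path_class_generated; exact: arc_cts.
Qed.

End generation.

(** * Monodromy in the presented group *)

(** The quotient defining a presented group requires a choice type of generators; the structure is
    the classical one. *)
HB.instance Definition _ m := gen_eqMixin (generator m).
HB.instance Definition _ m := gen_choiceMixin (generator m).

Section presented_relations.
Variable m : nat.

Definition UR_presented := presented (@UR_rel m).
HB.instance Definition _ := Group.on UR_presented.

Definition psigma (i : 'I_m) : UR_presented := word_class (@UR_rel m) [:: (Sigma i, false)].
Definition prho (i : 'I_m) : UR_presented := word_class (@UR_rel m) [:: (Rho i, false)].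

Let pgen (x : generator m) : UR_presented := word_class (@UR_rel m) [:: (x, false)].

Lemma presented_rel u v : UR_rel u v -> word_val pgen u = word_val pgen v.
Proof.
by move=> h; rewrite /pgen !word_val_class; apply/word_classP; exact: word_eq_rel.
Qed.

Lemma presented_commw x y : UR_rel (commw x y) [::] -> commute (pgen x) (pgen y).
Proof.
move=> /presented_rel; rewrite /commw !word_val_cons word_val_nil /= mulg1.
rewrite mulgA => h; apply: (mulIg (pgen x)^-1%g); apply: (mulIg (pgen y)^-1%g).
by rewrite mulgK mulgV -!mulgA -h !mulgA.
Qed.

Lemma presented_pos3 x y z x' y' z' :
  UR_rel (posw [:: x; y; z]) (posw [:: x'; y'; z']) ->
  (pgen x * pgen y * pgen z = pgen x' * pgen y' * pgen z')%g.
Proof.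
by move=> /presented_rel; rewrite /posw /= !word_val_cons word_val_nil /= !mulg1 !mulgA.
Qed.

Lemma psigma_square i : (psigma i * psigma i = 1)%g.
Proof.
have := presented_rel (UR_sigma_square i).
by rewrite /posw /= !word_val_cons word_val_nil /= mulg1.
Qed.

Lemma at_index_square (o : nat) : (at_index psigma o * at_index psigma o = 1)%g.
Proof. by rewrite /at_index; case: insubP => [i _ _|_]; [exact: psigma_square|rewrite mulg1]. Qed.

Lemma at_index_commute o o' (k k' : kind) : (o.+1 < o')%N ->
  commute (letter (at_index psigma o) (at_index prho o) k)
    (letter (at_index psigma o') (at_index prho o') k').
Proof.
move=> oo; rewrite /at_index; case: insubP => [i _ io|_]; last first.
  by case: k => /=; rewrite ?invg1; exact/commute_sym/commute1.
case: insubP => [j _ jo|_]; last first.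
  by case: k' => /=; rewrite ?invg1; exact: commute1.
have ij : (i.+1 < j)%N || (j.+1 < i)%N by rewrite (io : i = o :> nat) (jo : j = o' :> nat) oo.
apply: letter_commute.
- exact: (presented_commw (UR_sigma_sigma ij)).
- exact: (presented_commw (UR_rho_rho ij)).
- exact: (presented_commw (UR_rho_sigma ij)).
- by apply/commute_sym/(presented_commw (UR_rho_sigma _)); rewrite orbC.
Qed.

Lemma at_index_hexagon o p q r : (o.+1 < m)%N -> consistent p q r ->
  (letter (at_index psigma o) (at_index prho o) p *
   letter (at_index psigma o.+1) (at_index prho o.+1) q *
   letter (at_index psigma o) (at_index prho o) r =
   letter (at_index psigma o.+1) (at_index prho o.+1) r *
   letter (at_index psigma o) (at_index prho o) q *
   letter (at_index psigma o.+1) (at_index prho o.+1) p)%g.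
Proof.
move=> om cs; pose i : 'I_m := Ordinal (ltnW om); pose j : 'I_m := Ordinal om.
have ei (g : 'I_m -> UR_presented) : at_index g o = g i by exact: (at_indexE g i).
have ej (g : 'I_m -> UR_presented) : at_index g o.+1 = g j by exact: (at_indexE g j).
rewrite !ei !ej.
have ij : j = i.+1 :> nat by [].
apply: letter_hexagon => //; try exact: psigma_square.
- exact: (presented_pos3 (UR_braid_rho ij)).
- exact: (presented_pos3 (UR_braid_sigma ij)).
- exact: (presented_pos3 (UR_mixed1 ij)).
- exact: (presented_pos3 (UR_mixed2 ij)).
- exact: (presented_pos3 (UR_mixed3 ij)).
Qed.

End presented_relations.

Section monodromy.
Variables (R : realType) (n : nat).
Local Notation ring := (R * R * R * R)%type.
Local Notation Y := (UR R n).
Local Notation G := (UR_presented n.-1).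
Local Notation pstep := (step (@psigma n.-1) (@prho n.-1)).
Implicit Types (P Q S : 'I_n -> ring).

(* The labels of [Q] are the only ones making it [P]-close. *)
Definition close P Q := forall a b, a != b -> `|P a - Q a| < `|P a - P b| / 2.

(** If the relabellings differed at [a], the ring [Q (t a)] would be nearer than half their distance
    to both [P (s a)] and [P (t a)]. *)
Lemma close_comp P Q (s t : {perm 'I_n}) : close P Q -> close (P \o s) (Q \o t) -> s = t.
Proof.
move=> h1 h2; apply/permP => a; apply/eqP; apply: contraT => neq.
have := h2 a ((s^-1)%g (t a)); rewrite /= permKV => k2.
have neq' : a != (s^-1)%g (t a) by apply: contraNneq neq => e; rewrite {1}e permKV.
have {}k2 := k2 neq'.
have k1 : `|P (t a) - Q (t a)| < `|P (t a) - P (s a)| / 2 by apply: h1; rewrite eq_sym.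
have k3 := ler_distD (Q (t a)) (P (s a)) (P (t a)).
have k4 := distrC (Q (t a)) (P (t a)); have k5 := distrC (P (t a)) (P (s a)).
lra.
Qed.

Definition close_lifts (y y' : Y) (PQ : ('I_n -> ring) * ('I_n -> ring)) :=
  [/\ valid PQ.1, valid PQ.2, config PQ.1 = y, config PQ.2 = y' & close PQ.1 PQ.2].

(** The default [1] is for pairs without close lifts; the cocycle law is claimed only near each
    configuration. *)
Definition monodromy (y y' : Y) : G :=
  match pselect (exists PQ, close_lifts y y' PQ) with
  | left h => let PQ := projT1 (cid h) in
      transition (pstep PQ.1) 0 (order PQ.1) (order PQ.2)
  | right _ => 1%g
  end.

Lemma pstep_comp P (s : {perm 'I_n}) o a b :
  pstep (P \o s) o ((s^-1)%g a) ((s^-1)%g b) = pstep P o a b.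
Proof. by rewrite /step /= !permKV. Qed.

(** Any two pairs of close lifts differ by one common relabelling, under which [order] and [pstep]
    are equivariant. *)
Lemma monodromyE P Q : valid P -> valid Q -> close P Q ->
  monodromy (config P) (config Q) = transition (pstep P) 0 (order P) (order Q).
Proof.
move=> vP vQ cPQ; rewrite /monodromy; case: pselect => [h|]; last first.
  by case; exists (P, Q).
case: (cid h) => -[P' Q'] /= [/= vP' vQ' eP eQ cPQ'].
have [s hs] := config_eq vP vP' (esym eP).
have [t ht] := config_eq vQ vQ' (esym eQ).
have {}hs : P' = P \o s by apply/funext.
have {}ht : Q' = Q \o t by apply/funext.
subst P' Q'; have st := close_comp cPQ cPQ'; subst t.
rewrite !order_comp// transition_map; last exact: perm_inj.
by congr transition; apply/funext => o; apply/funext => a; apply/funext => b; exact: pstep_comp.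
Qed.

Lemma kind_of_planar t (C D C' D' : ring) : planar t -> 0 < radius C -> 0 < radius D ->
  0 < radius C' -> 0 < radius D' -> sat t C D -> sat t C' D' -> kind_of C D = kind_of C' D'.
Proof.
rewrite /kind_of; case: t => [|||| u v] // _ rC rD rC' rD' h h'.
- by rewrite (h : nest C D) (h' : nest C' D').
- by rewrite (nest_asym (h : nest D C)) (nest_asym (h' : nest D' C')) (h : nest D C) (h' : nest D' C').
- rewrite (apart_nest rC h) (apart_nest rD (apart_opp h)).
  by rewrite (apart_nest rC' h') (apart_nest rD' (apart_opp h')).
Qed.

(** The common type of an inverted pair is neither [Before] nor [After], so it is planar and the
    kind is constant on the ball. All three words can then be computed with the letters of [P]. *)
Lemma pstep_transition_mul P Q S (e : R) (P0 : 'I_n -> ring) : coherent e P0 ->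
  valid P -> valid Q -> valid S ->
  within_dist e P0 P -> within_dist e P0 Q -> within_dist e P0 S ->
  (transition (pstep P) 0 (order P) (order Q) * transition (pstep Q) 0 (order Q) (order S) =
   transition (pstep P) 0 (order P) (order S))%g.
Proof.
move=> coh vP vQ vS wP wQ wS.
pose fr : rel 'I_n := fun a b => `[< exists2 t, planar t & forall U, within_dist e P0 U -> sat t (U a) (U b) >].
have r (U : 'I_n -> ring) a : valid U -> 0 < radius (U a) by case.
have frU U a b : within_dist e P0 U -> fr a b -> disjoint_profiles (U a) (U b).
  by move=> wU /asboolP[t pt h]; apply/asboolP; exists t => //; exact: h.
have frinv U V a b : valid U -> valid V -> within_dist e P0 U -> within_dist e P0 V ->
    before (order U) a b -> before (order V) b a -> fr a b.
  move=> vU vV wU wV ab ba; apply/asboolP.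
  have neq := before_neq ab.
  have [t ht] := coh _ _ neq; exists t => //.
  case: t ht => [|||| u v] // ht.
  - by have := order_sorted vV ba; rewrite leNgt (ht V wV : cx (V a) < cx (V b)).
  - by have := order_sorted vU ab; rewrite leNgt (ht U wU : cx (U b) < cx (U a)).
have fr_sym : symmetric fr.
  suff h a b : fr a b -> fr b a by move=> a b; apply/idP/idP; exact: h.
  move=> /asboolP[[|||| u v]] // _ h; apply/asboolP.
  - by exists Outside.
  - by exists Inside.
  - by exists (Apart (- u) (- v)) => // U wU; apply: apart_opp; exact: h.
have pe := fun U => @order_perm_eq R n U.
have pp (U V : 'I_n -> ring) : perm_eq (order U) (order V) by rewrite (permPr (pe V)).
have uw (U : 'I_n -> ring) : uniq (order U) by rewrite (perm_uniq (pe U)) enum_uniq.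
have -> : transition (pstep Q) 0 (order Q) (order S) = transition (pstep P) 0 (order Q) (order S).
  apply: transition_eq => // o a b ab ba; rewrite /step; congr letter.
  have /asboolP[t pt h] := frinv Q S a b vQ vS wQ wS ab ba.
  by apply: (kind_of_planar pt); [exact: r|exact: r|exact: r|exact: r|exact: h|exact: h].
apply: (@transition_mul _ _ (pstep P) n fr) => //.
- move=> o a b ab; rewrite /step [kind_of (P b) _]kind_of_opp; apply: letter_opp; exact: at_index_square.
- by move=> o o' a b c d; exact: at_index_commute.
- move=> o a x y on _ ax ay xy; apply: at_index_hexagon; first by lia.
  apply: kinds_consistent; try exact: r.
  + exact: frU ax.
  + exact: frU ay.
  + by apply: frU => //; rewrite fr_sym.
- by rewrite (perm_size (pe P)) size_enum_ord.
- by move=> a b _ _; exact: frinv.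
- by move=> a b _ _; exact: frinv.
Qed.

(** Origin of the [6]: [P a] and [Q a] are less than [2 * e] apart, while [P a] and [P b] are more
    than [6 * e - 2 * e] apart. *)
Lemma close_near (P0 : 'I_n -> ring) (e : R) P Q : separated (6 * e) P0 -> within_dist e P0 P ->
  within_dist e P0 Q -> close P Q.
Proof.
move=> sep wP wQ a b ab; have s := sep _ _ ab.
have h1 := wP a; have h2 := wQ a; have h3 := wP b.
have k1 := ler_distD (P0 a) (P a) (Q a).
have k2 := ler_distD (P a) (P0 a) (P0 b).
have k3 := ler_distD (P b) (P a) (P0 b).
have k4 := distrC (P a) (P0 a); have k5 := distrC (P b) (P0 b).
lra.
Qed.

Lemma monodromy_cocycle (y : Y) : exists2 V, nbhs y V & cocycle_on monodromy V.
Proof.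
have [P0 vP0 <-] := configP y.
have [e [e0 coh sep]] := good_radius (ltr0Sn R 5) vP0.
exists [set config Q | Q in [set Q | valid Q /\ within_dist e P0 Q]].
  exact: config_nbhs.
move=> _ _ _ [P [vP wP] <-] [Q [vQ wQ] <-] [S [vS wS] <-].
rewrite !monodromyE//; try exact: (close_near sep).
exact: (pstep_transition_mul coh).
Qed.

End monodromy.

(** * Evaluation of loops *)

Section evaluation.
Context {R : realType} {Y : topologicalType} {Gm : groupType}.
Variable T : Y -> Y -> Gm.
Hypothesis T_cocycle : forall y : Y, exists2 V, nbhs y V & cocycle_on T V.
Variable y0 : Y.
Local Notation loop := {path unit_interval R from y0 to y0 in Y}.

Lemma loop_holonomy_exists (p : loop) : exists x, holonomy T (p \o clip) 0 1 x.
Proof. by apply: holonomy_exists ler01 => //; exact: arc_of_loop_cts. Qed.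

Definition evaluation (a : pi1 R y0) : Gm := projT1 (cid (loop_holonomy_exists (repr a))).

(** The chosen representative is homotopic to [p], and holonomy is unique and invariant under
    homotopy. *)
Lemma evaluationE (p : loop) x : holonomy T (p \o clip) 0 1 x ->
  evaluation (loop_class p) = x.
Proof.
move=> px; rewrite /evaluation; case: cid => z /= hz.
apply: (holonomy_unique ler01 hz).
have [H [cH H0 H1 Hz Ho]] := loop_homotopic_sym (repr_loop_class p).
pose K (u : R * R) := H (clip u.1, clip u.2).
have i01 : 0 <= (0 : R) <= 1 by rewrite lexx ler01.
have -> : (repr (loop_class p) : loop) \o clip = fun t => K (1, t).
  by apply/funext => t; rewrite -[LHS]H1.
apply: (@holonomy_homotopy _ _ _ _ T_cocycle K y0 y0).
- apply: comp_cts cH; apply: pair_continuous.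
    by apply: comp_cts (@clip_continuous R); exact: fst_continuous.
  by apply: comp_cts (@clip_continuous R); exact: snd_continuous.
- by move=> s _; exact: Hz.
- by move=> s _; exact: Ho.
- rewrite (_ : (fun t => K (0, t)) = p \o clip)//.
  by apply/funext => t; rewrite -[RHS]H0.
Qed.

Lemma evaluationM : {morph evaluation : a b / (a * b)%g >-> (a * b)%g}.
Proof.
move=> a b; rewrite -[a]loop_class_repr -[b]loop_class_repr.
set p : loop := repr a; set q : loop := repr b.
have [x px] := loop_holonomy_exists p; have [y qy] := loop_holonomy_exists q.
rewrite (evaluationE px) (evaluationE qy) [X in evaluation X]pi1_mulE.
apply: evaluationE; apply: (@holonomy_cat _ _ _ _ _ 0 2^-1 1).
- by rewrite invr_ge0.
- by rewrite invf_le1// ler1n.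
- apply: (@holonomy_ext _ _ _ _ (fun t => (p \o clip) (2 * t + 0))).
  + move=> t /andP[t0 t1]; have t1' : t <= 1 by lra.
    by rewrite /= concatE clipK ?t0// t1 addr0.
  + by rewrite invr_ge0.
  + apply: holonomy_affine => //.
    by rewrite mulr0 mulfV// !addr0.
- apply: (@holonomy_ext _ _ _ _ (fun t => (q \o clip) (2 * t - 1))).
  + move=> t /andP[t0 t1]; have t0' : 0 <= t by lra.
    rewrite /= concatE clipK ?t0'//; case: ifPn => // ht.
    have -> : t = 2^-1 by lra.
    by rewrite mulfV// subrr path_one path_zero.
  + by rewrite invf_le1// ler1n.
  + apply: holonomy_affine => //.
    by rewrite mulfV// subrr (_ : 2 * 1 - 1 = 1)//; lra.
Qed.

End evaluation.

(** * Holonomy of an exchange of two neighbours *)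

Section exchanges.
Variables (R : realType) (n : nat).
Local Notation ring := (R * R * R * R)%type.
Local Notation Y := (UR R n).
Local Notation G := (UR_presented n.-1).
Local Notation pstep := (step (@psigma n.-1) (@prho n.-1)).
Implicit Types (P Q S : 'I_n -> ring).

Lemma enum_split (i : 'I_n.-1) : exists u v,
  [/\ enum 'I_n = u ++ left_ring i :: right_ring i :: v,
      swapped i = u ++ right_ring i :: left_ring i :: v & size u = i].
Proof.
set l := left_ring i; set r := right_ring i.
have e : enum 'I_n = take i (enum 'I_n) ++ l :: r :: drop i.+2 (enum 'I_n).
  by rewrite -{1}(cat_take_drop i (enum 'I_n)) (enum_drop l) (enum_drop r).
exists (take i (enum 'I_n)), (drop i.+2 (enum 'I_n)); split=> //; last first.
  by rewrite size_take size_enum_ord (ltn_ord l).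
have := enum_uniq 'I_n; rewrite /swapped {1 2}e.
move: (take _ _) (drop _ _) => u v uw.
rewrite map_cat /= -/l -/r tpermL tpermR.
move: uw; rewrite cat_uniq => /and3P[_ /hasPn out].
have lu : l \notin u by apply: (out l); rewrite mem_head.
have ru : r \notin u by apply: (out r); rewrite !inE eqxx orbT.
rewrite cons_uniq inE negb_or => /andP[/andP[_ lv]]; rewrite cons_uniq => /andP[rv _].
have fix_on (w : seq 'I_n) : l \notin w -> r \notin w -> [seq tperm l r j | j <- w] = w.
  move=> lw rw; rewrite -[RHS]map_id; apply/eq_in_map => j jw; rewrite tpermD//.
    by apply: contraNneq lw => ->.
  by apply: contraNneq rw => ->.
by rewrite !fix_on.
Qed.

Lemma sign_constant (f : R -> R) (a b : R) : continuous f -> a <= b ->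
  (forall t, a <= t <= b -> f t <> 0) -> (0 < f a) = (0 < f b).
Proof.
move=> cf ab h.
have [|e] := eqVneq (0 < f a) (0 < f b); first by [].
have [|t] := @IVT R f a b 0 ab (continuous_subspaceT cf).
  rewrite ge_min le_max; move: e.
  by case: (leP (f a) 0) => ha; case: (leP (f b) 0) => hb //= _; rewrite ?(ltW ha) ?(ltW hb) ?orbT.
by rewrite in_itv /= => /h.
Qed.

Section exchange.
Variables (i : 'I_n.-1) (c : unit_interval R -> @ordered_rings R n) (t0 : unit_interval R).
Hypothesis ex : exchange i c t0.
Let l := left_ring i.
Let r := right_ring i.
Let P (s : R) := ringj (c (clip s)).

Let P_cts a : continuous (fun s => P s a).
Proof.
have [cc _ _ _ _] := ex.
apply: (@comp_cts _ _ _ (c \o clip) (fun d => ringj d a)); last exact: ringj_cts.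
exact: comp_cts (@clip_continuous R) cc.
Qed.

Let P_valid s : valid (P s).
Proof. exact: valid_ringj. Qed.

Let P0 : P 0 = standard R (enum 'I_n).
Proof.
have [_ c0 _ _ _] := ex; rewrite -base_standard; apply/funext => j.
by rewrite /P (c0 : c (clip 0) = _) /ringj set_valE /= mxE.
Qed.

Let P1 : P 1 = standard R (swapped i).
Proof.
have [_ _ [c1 c2] c3 _] := ex; apply/funext => j.
have -> : standard R (swapped i) j = base_ring R (tperm l r j).
  by rewrite /standard /arrange /swapped index_map_perm tpermV.
rewrite /P; case: tpermP => [->|->|/eqP jl /eqP jr]; [exact: c1|exact: c2|].
by have [-> _ _] := c3 j (clip 1) jl jr.
Qed.

Let base_neq (a b : 'I_n) : a <> b -> cx (base_ring R a) <> cx (base_ring R b).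
Proof.
move=> ab /eqP; rewrite /cx /= eqr_nat eqn_pmul2l// eqSS => /eqP /val_inj.
exact: ab.
Qed.

Let P_neq a b s : a <> b -> ~ (a = l /\ b = r) -> ~ (a = r /\ b = l) ->
  cx (P s a) <> cx (P s b).
Proof.
have [_ _ _ c3 _] := ex => ab n1 n2.
have out j : j != l -> j != r -> [/\ P s j = base_ring R j,
   cx (P s l) <> cx (base_ring R j) & cx (P s r) <> cx (base_ring R j)].
  exact: c3.
have [e|al] := eqVneq a l.
  subst a; have bl : b != l by apply/eqP => e; exact: ab.
  have br : b != r by apply/eqP => e; exact: n1.
  by have [-> h _] := out b bl br.
have [e|ar] := eqVneq a r.
  subst a; have br : b != r by apply/eqP => e; exact: ab.
  have bl : b != l by apply/eqP => e; exact: n2.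
  by have [-> _ h] := out b bl br.
have [-> h1 h2] := out a al ar.
have [e|bl] := eqVneq b l; first by subst b => /esym.
have [e|br] := eqVneq b r; first by subst b => /esym.
have [-> _ _] := out b bl br; exact: base_neq.
Qed.

Let gap_cts (a b : 'I_n) : continuous (fun s => cx (P s b) - cx (P s a)).
Proof. by apply: sub_cts; apply: comp_cts (@cx_cts R); exact: P_cts. Qed.

Let P_lt_cst a b s t : a <> b -> ~ (a = l /\ b = r) -> ~ (a = r /\ b = l) ->
  s <= t -> (cx (P s a) < cx (P s b)) = (cx (P t a) < cx (P t b)).
Proof.
move=> ab n1 n2 st; rewrite -subr_gt0 -[RHS]subr_gt0.
apply: (sign_constant (@gap_cts a b) st) => u _ /subr0_eq /esym; exact: P_neq.
Qed.

(** Every pair other than [l], [r] has the same strict order at all times, so the order of [l] and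
    [r] decides between the initial and the final word. When their planes coincide, either may
    occur. *)
Let P_order s : 0 <= s <= 1 ->
  (before (order (P s)) l r -> order (P s) = enum 'I_n) /\
  (before (order (P s)) r l -> order (P s) = swapped i).
Proof.
move=> /andP[s0 s1]; set w := order (P s).
have wE : perm_eq w (enum 'I_n) by exact: order_perm_eq.
have st a b t : before w a b -> ~ (a = l /\ b = r) -> ~ (a = r /\ b = l) -> (s <= t \/ t <= s) ->
    cx (P t a) < cx (P t b).
  move=> ab n1 n2 h; have neq : a <> b by apply/eqP; exact: before_neq ab.
  have lt_s : cx (P s a) < cx (P s b).
    rewrite lt_neqAle (order_sorted (P_valid s) ab) andbT.
    by apply/eqP; exact: P_neq.
  by case: h => h; [rewrite -(P_lt_cst neq n1 n2 h)|rewrite (P_lt_cst neq n1 n2 h)].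
split=> h.
- have <- : order (P 0) = w.
    apply: order_ssorted => // a b ab.
    have [[-> ->]|n1] := pselect (a = l /\ b = r).
      by rewrite P0; apply: arrange_ssorted; rewrite /before !index_enum_ord.
    have [[e1 e2]|n2] := pselect (a = r /\ b = l).
      by subst a b; case: (before_asym h ab).
    by apply: st ab n1 n2 _; right.
  by rewrite P0 order_arrange// => a; exact: ltr01.
- have <- : order (P 1) = w.
    apply: order_ssorted => // a b ab.
    have [[-> ->]|n1] := pselect (a = r /\ b = l).
      by rewrite P1; apply: arrange_ssorted; rewrite before_swapped tpermL tpermR.
    have [[e1 e2]|n2] := pselect (a = l /\ b = r).
      by subst a b; case: (before_asym h ab).
    by apply: st ab n2 n1 _; left.
  rewrite P1; apply: order_arrange; first exact: perm_eq_map_perm.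
  by move=> a; exact: ltr01.
Qed.

Let tau := Ival t0.
Let d s := cx (P s r) - cx (P s l).

Let d_zero s : 0 <= s <= 1 -> s <> tau -> d s <> 0.
Proof.
have [_ _ _ _ h] := ex => s01 st /subr0_eq /esym /h e; apply: st.
by rewrite /tau -e clipK.
Qed.

Let d0 : 0 < d 0.
Proof.
rewrite /d P0 subr_gt0; apply: arrange_ssorted.
by rewrite /before !index_enum_ord.
Qed.

Let d1 : d 1 < 0.
Proof.
rewrite /d P1 subr_lt0; apply: arrange_ssorted.
by rewrite before_swapped tpermL tpermR.
Qed.

Let order_left s : 0 <= s -> s < tau -> order (P s) = enum 'I_n.
Proof.
move=> s0 st; have /andP[_ t1] := Ival_itv t0.
have s01 : 0 <= s <= 1 by rewrite s0 (le_trans (ltW st)).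
have [h _] := P_order s01; apply: h.
have [//|k] := before_cases (order_perm_eq (P s)) (left_right_neq i).
have := order_sorted (P_valid s) k; rewrite leNgt -subr_gt0 -/(d s).
rewrite -(@sign_constant d 0 s) ?d0//; first exact: gap_cts.
move=> t /andP[t0' ts]; apply: d_zero; first by rewrite t0' (le_trans ts)//; case/andP: s01.
by move=> e; move: ts; rewrite e leNgt st.
Qed.

Let order_right s : s <= 1 -> tau < s -> order (P s) = swapped i.
Proof.
move=> s1 st; have /andP[t0' _] := Ival_itv t0.
have s01 : 0 <= s <= 1 by rewrite s1 (le_trans _ (ltW st)).
have [_ h] := P_order s01; apply: h.
have [k|//] := before_cases (order_perm_eq (P s)) (left_right_neq i).
have := order_sorted (P_valid s) k; rewrite -subr_ge0 -/(d s) le_eqVlt => /orP[/eqP/esym e|].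
  by case: (d_zero s01 _ e) => e'; move: st; rewrite e' ltxx.
rewrite (@sign_constant d s 1)//; first by rewrite ltNge (ltW d1).
- exact: gap_cts.
- move=> t /andP[t1 ts]; apply: d_zero; first by rewrite ts andbT (le_trans _ t1)//; case/andP: s01.
  by move=> e; move: t1; rewrite e leNgt st.
Qed.

Let close_P t : \forall s \near t, close (P t) (P s).
Proof.
suff h a b : \forall s \near t, a != b -> `|P t a - P s a| < `|P t a - P t b| / 2.
  exact: (@filter_forall _ _ _ _ _ (fun a => @filter_forall _ _ _ _ _ (h a))).
have [->|ab] := eqVneq a b; first by near=> s.
have pos : 0 < `|P t a - P t b| / 2 by rewrite divr_gt0// normr_gt0 subr_eq0 valid_neq.
have := @P_cts a t; move=> /cvgr_dist_lt /(_ _ pos).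
by apply: filterS => s h _.
Unshelve. all: by end_near. Qed.

(** The order of the labels is constant before and after [t0], so the whole holonomy arises at [t0],
    from the relative position of the two circles at that moment. *)
Lemma exchange_holonomy : holonomy (@monodromy R n) (fun s => unordered (c (clip s))) 0 1
  (letter (psigma i) (prho i) (kind_of (ringj (c t0) l) (ringj (c t0) r))).
Proof.
have Pt0 : P tau = ringj (c t0) by rewrite /P /tau IvalK.
have cfg s : unordered (c (clip s)) = config (P s) by rewrite /config /P to_orderedK.
pose w := order (P tau).
have /andP[tau0 tau1] := Ival_itv t0.
have tau0' : 0 < tau.
  rewrite lt_neqAle tau0 andbT eq_sym; apply/eqP => e; have [_ _ _ _ h] := ex.
  have : cx (P tau l) = cx (P tau r) by rewrite Pt0; apply/h.
  move=> e'; have : d tau = 0 by rewrite /d e' subrr.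
  by rewrite e => z; have := d0; rewrite z ltxx.
have tau1' : tau < 1.
  rewrite lt_neqAle tau1 andbT; apply/eqP => e; have [_ _ _ _ h] := ex.
  have : cx (P tau l) = cx (P tau r) by rewrite Pt0; apply/h.
  move=> e'; have : d tau = 0 by rewrite /d e' subrr.
  by rewrite e => z; have := d1; rewrite z ltxx.
(* Based at [tau], where the order [w] may be either of the two. *)
exists (fun s => transition (pstep (P tau)) 0 w (order (P s))).
- move=> t /andP[t0' t1]; rewrite !cfg.
  have step_near : \forall s \near t, 0 <= s <= 1 ->
      monodromy (config (P t)) (config (P s)) = transition (pstep (P t)) 0 (order (P t)) (order (P s)).
    apply: filterS (close_P t) => s cl _; exact: monodromyE.
  have [tt|tt|tt] := ltgtP t tau.
  + apply: filterS2 step_near (lt_nbhsl tt) => s h st s01; rewrite !cfg h//.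
    have /andP[s0 _] := s01.
    by rewrite !order_left// transition_id mulg1.
  + apply: filterS2 step_near (lt_nbhsr tt) => s h st s01; rewrite !cfg h//.
    have /andP[_ s1] := s01.
    by rewrite !order_right// transition_id mulg1.
  + apply: filterS step_near => s h s01; rewrite !cfg h// tt.
    by rewrite transition_id mul1g.
- rewrite order_left// order_right//.
  have [u [v [eu es su]]] := enum_split i.
  have uE : uniq (enum 'I_n) by exact: enum_uniq.
  have uS : uniq (swapped i) by rewrite (perm_uniq (perm_eq_map_perm _)) enum_uniq.
  have stepE a b : pstep (P tau) i a b = letter (psigma i) (prho i) (kind_of (P tau a) (P tau b)).
    by rewrite /step !at_indexE.
  have trES : transition (pstep (P tau)) 0 (enum 'I_n) (swapped i) = pstep (P tau) i l r.
    by rewrite es eu transition_swap ?su -?eu.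
  have trSE : transition (pstep (P tau)) 0 (swapped i) (enum 'I_n) = pstep (P tau) i r l.
    by rewrite es eu transition_swap ?su -?es.
  have := P_order (s := tau); rewrite tau0 tau1 => /(_ isT) [hl hr].
  have [k|k] := before_cases (order_perm_eq (P tau)) (left_right_neq i).
  + by rewrite /w (hl k) transition_id invg1 mul1g trES stepE Pt0.
  (* If the tie at [tau] is broken in favour of [r], the letter of the opposite kind appears
     inverted, which is the same element. *)
  + rewrite /w (hr k) transition_id mulg1 trSE stepE Pt0 [kind_of (_ r) _]kind_of_opp.
    set k' := kind_of _ _; apply: (mulIg (letter (psigma i) (prho i) (opp_kind k'))).
    by rewrite mulVg letter_opp//; exact: psigma_square.
Qed.

End exchange.

End exchanges.

(** * Standard exchange loops *)

Section standard_exchange.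
Variables (R : realType) (n : nat) (i : 'I_n.-1).
Local Notation ring := (R * R * R * R)%type.
Local Notation Y := (UR R n).
Let l := left_ring i.
Let r := right_ring i.
Variable f : 'I_n -> ring.
Hypothesis f_gt0 : forall a, 0 < radius (f a).
Hypothesis f_free : free_pairs f l r.
Hypothesis f_out : forall a, a != l -> a != r -> [/\ cy (f a) = 0, cz (f a) = 0 & radius (f a) = 1].

Let S0 := standard R (enum 'I_n).
Let S1 := standard R (swapped i).
Let A0 := arrange (enum 'I_n) f.
Let A1 := arrange (swapped i) f.
(* The moment when the two planes coincide. *)
Let M := mixc 2^-1 2^-1 0 A0 A1 A1.

Let half_weights : weights (2^-1) (2^-1) (0 : R).
Proof. by split => //; lra. Qed.

Let M_gt0 a : 0 < radius (M a).
Proof. by apply: (mix_gt0 half_weights); exact: f_gt0. Qed.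

Let M_cx a : cx (M a) = (cx (S0 a) + cx (S1 a)) / 2.
Proof. by rewrite /M /mixc /mix {1}/cx /=; lra. Qed.

Let M_profile a : [/\ cy (M a) = cy (f a), cz (M a) = cz (f a) & radius (M a) = radius (f a)].
Proof.
rewrite /M /mixc /mix /A0 /A1 /arrange /cy /cz /radius /=.
by case: (f a) => [[[x y] z] s] /=; split; lra.
Qed.

Let S0E a : cx (S0 a) = 4 * a%:R + 4.
Proof. by rewrite /S0 /standard /arrange /cx /= index_enum_ord natrM -natr1; lra. Qed.

Let S1E a : cx (S1 a) = cx (S0 (tperm l r a)).
Proof. by rewrite S0E /S1 /standard /arrange /cx /= index_map_perm tpermV natrM -natr1; lra. Qed.

Let rE : r%:R = l%:R + 1 :> R.
Proof. by rewrite natr1. Qed.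

Let M_planes : cx (M l) = cx (M r).
Proof. by rewrite !M_cx !S1E tpermL tpermR !S0E; lra. Qed.

(** [l] and [r] share a plane in [M], so both orders sort it; this makes [fill0] and [fill1]
    available, one for each half of the motion. *)
Let M_sorted : sorted_by (enum 'I_n) M /\ sorted_by (swapped i) M.
Proof.
have s0 : ssorted_by (enum 'I_n) S0 by exact: arrange_ssorted.
have s1 : ssorted_by (swapped i) S1 by exact: arrange_ssorted.
have wE : perm_eq (swapped i) (enum 'I_n) by exact: perm_eq_map_perm.
split=> a b ab.
- have [[-> ->]|nlr] := pselect (a = l /\ b = r); first by rewrite M_planes.
  have h0 := s0 _ _ ab.
  have neq := before_neq ab.
  have h1 : cx (S1 a) < cx (S1 b).
    apply: s1; have [//|k] := before_cases wE neq.
    by case: nlr; exact: swapped_order k.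
  by rewrite !M_cx; lra.
- have [[-> ->]|nlr] := pselect (b = l /\ a = r); first by rewrite M_planes.
  have h1 := s1 _ _ ab.
  have neq := before_neq ab; rewrite eq_sym in neq.
  have h0 : cx (S0 a) < cx (S0 b).
    apply: s0; have [k|//] := before_cases (perm_refl (enum 'I_n)) neq.
    by case: nlr; exact: swapped_order ab.
  by rewrite !M_cx; lra.
Qed.

Let M_sat a b t : planar t -> sat t (f a) (f b) -> sat t (M a) (M b).
Proof.
have [ya za ra] := M_profile a; have [yb zb rb] := M_profile b.
case: t => [|||| u v] // _ h.
- by move: h; rewrite /= /nest ya za ra yb zb rb.
- by move: h; rewrite /= /nest ya za ra yb zb rb.
- by case: h => uv h; split=> //; rewrite ya za ra yb zb rb.
Qed.

Let A_fill : fill A0 M A1.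
Proof.
apply: fill_coherent => [a|a b ab].
  by split; [exact: f_gt0|exact: M_gt0|exact: f_gt0].
have planar_ok a' b' : free_pairs f a' b' ->
    exists t, [/\ sat t (A0 a') (A0 b'), sat t (M a') (M b') & sat t (A1 a') (A1 b')].
  by move=> /asboolP[t pt h]; exists t; rewrite !sat_arrange//; split=> //; exact: M_sat.
have [[-> ->]|nlr] := pselect (a = l /\ b = r); first exact: planar_ok.
have [[-> ->]|nrl] := pselect (b = l /\ a = r).
  by apply: planar_ok; rewrite free_pairs_sym.
have wE : perm_eq (swapped i) (enum 'I_n) by exact: perm_eq_map_perm.
have ba : b != a by rewrite eq_sym.
have mid x y : x != y -> ~ (x = l /\ y = r) -> before (enum 'I_n) x y ->
    [/\ cx (A0 x) < cx (A0 y), cx (M x) < cx (M y) & cx (A1 x) < cx (A1 y)].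
  move=> xy n1 h; have h' : before (swapped i) x y.
    by have [//|k] := before_cases wE xy; case: n1; exact: swapped_order k.
  have h0 : cx (A0 x) < cx (A0 y) by exact: arrange_ssorted.
  have h1 : cx (A1 x) < cx (A1 y) by exact: arrange_ssorted.
  split=> //; rewrite !M_cx.
  have e0 : forall z, cx (S0 z) = cx (A0 z) by [].
  have e1 : forall z, cx (S1 z) = cx (A1 z) by [].
  by rewrite !e0 !e1; lra.
have [h|h] := before_cases (perm_refl (enum 'I_n)) ab.
  by exists Before; exact: mid.
by exists After; apply: mid ba _ h => -[? ?]; exact: nrl.
Qed.

Let one_gt0 (a : 'I_n) : 0 < radius ((fun=> (0, 0, 0, 1) : ring) a).
Proof. exact: ltr01. Qed.

Let M_valid : valid M.
Proof. by have := segment_valid A_fill 1; rewrite segment1. Qed.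

Let fill0 : fill M S0 A0.
Proof.
apply: (@fill_sorted _ _ (enum 'I_n)).
- exact: perm_refl.
- exact: M_valid.
- exact: M_sorted.1.
- exact: one_gt0.
- exact: arrange_ssorted.
- exact: f_gt0.
- exact: arrange_ssorted.
Qed.

Let fill1 : fill M A1 S1.
Proof.
apply: (@fill_sorted _ _ (swapped i)).
- exact: perm_eq_map_perm.
- exact: M_valid.
- exact: M_sorted.2.
- exact: f_gt0.
- exact: arrange_ssorted.
- exact: one_gt0.
- exact: arrange_ssorted.
Qed.

(** An exchange loop has to start and end at base positions with the other rings at rest, so it runs
    from [S0] by [M] to [S1]. Filled triangles compare it with the path from [A0] to [A1] that
    defines [swap_class]. *)
Let swap_edges : (edge S0 M * edge M S1)%g = swap_class i f.
Proof.
have wE : perm_eq (swapped i) (enum 'I_n) by exact: perm_eq_map_perm.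
have o0 : order S0 = enum 'I_n by exact: order_arrange.
have o1 : order A1 = swapped i by exact: order_arrange.
have e0 : edge S0 A0 = 1%g.
  apply: (@edge_sorted R n S0 A0 _ f_gt0 _).1; first exact: standard_valid.
  by rewrite o0; exact: arrange_ssorted.
have e1 : edge A1 S1 = 1%g.
  apply: (@edge_sorted R n A1 S1 _ one_gt0 _).1; first exact: arrange_valid.
  by rewrite o1; exact: arrange_ssorted.
rewrite -(edge_mul (fill_rot fill0)) e0 mul1g.
by rewrite -(edge_mul fill1) e1 mulg1 edge_mul.
Qed.

Let v0 t : valid (segment S0 M t).
Proof. exact: (segment_valid (fill_swap (fill_rot fill0))). Qed.
Let v1 t : valid (segment M S1 t).
Proof. exact: (segment_valid (fill_swap fill1)). Qed.

Let F (t : R) : 'I_n -> ring :=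
  if t <= 2^-1 then segment S0 M (2 * t + 0) else segment M S1 (2 * t - 1).

Let F_valid t : valid (F t).
Proof. by rewrite /F; case: ifP => _; [exact: v0|exact: v1]. Qed.

Let F_cts a : continuous (fun t => F t a).
Proof.
have -> : (fun t => F t a) = fun t => if t <= 2^-1 then segment S0 M (2 * t + 0) a
    else segment M S1 (2 * t - 1) a.
  by apply/funext => t; rewrite /F; case: ifP.
apply: (@pasting _ _ _ id); first exact: id_cts.
- exact: (comp_cts (@affineR_cts R 2 0) (@segment_cts R n S0 M a)).
- exact: (comp_cts (@affineR_cts R 2 (-1)) (@segment_cts R n M S1 a)).
- by move=> t ->; rewrite mulfV// addr0 subrr segment1 segment0.
Qed.

Let swap_arc_cts : continuous (arc_cat_fun (edge_arc v0) (edge_arc v1)).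
Proof. exact: (@arc_cts _ _ _ _ (arc_cat (edge_arc v0) (edge_arc v1))). Qed.

Let swap_arc0 : arc_cat_fun (edge_arc v0) (edge_arc v1) 0 = UR_base R n.
Proof. by rewrite arc_cat0 config_base. Qed.

Let swap_arc1 : arc_cat_fun (edge_arc v0) (edge_arc v1) 1 = UR_base R n.
Proof. by rewrite arc_cat1 config_standard//; exact: perm_eq_map_perm. Qed.

Definition swap_loop := loop_of (Arc swap_arc_cts swap_arc0 swap_arc1).

Lemma swap_loop_class : loop_class swap_loop = swap_class i f.
Proof.
rewrite -[LHS]/(arc_class (Arc swap_arc_cts swap_arc0 swap_arc1)).
rewrite -(closed_class_loop (@tail_base R n)) -path_class_arc /=.
rewrite -[X in path_class X]/(arc_fun (arc_cat (edge_arc v0) (edge_arc v1))).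
by rewrite path_class_arc -closed_class_cat -!path_class_arc; exact: swap_edges.
Qed.

Let c (t : unit_interval R) := to_ordered (F (Ival t)).

Let c_ring t j : ringj (c t) j = F (Ival t) j.
Proof. by apply: ringj_to_ordered; exact: F_valid. Qed.

(** Along the x-axis the two halves form one uniform motion, so the planes of [l] and [r] meet only
    at the midpoint in time. *)
Let F_cx t a : 0 <= t <= 1 -> cx (F t a) = (1 - t) * cx (S0 a) + t * cx (S1 a).
Proof.
move=> /andP[t0 t1].
have segE (P Q : 'I_n -> ring) s : 0 <= s <= 1 -> cx (segment P Q s a) = (1 - s) * cx (P a) + s * cx (Q a).
  by move=> s01; rewrite /segment clampK// /mixc /mix {1}/cx /=; lra.
rewrite /F; have [h|h] := leP t 2^-1; rewrite segE ?M_cx; try lra.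
Qed.

Lemma swap_loop_exchange : exists c t0, [/\ exchange i c t0,
  forall t, swap_loop t = unordered (c t),
  cx (ringj (c t0) l) = cx (ringj (c t0) r) &
  forall a, [/\ cy (ringj (c t0) a) = cy (f a), cz (ringj (c t0) a) = cz (f a) &
    radius (ringj (c t0) a) = radius (f a)]].
Proof.
have half01 : 0 <= (2^-1 : R) <= 1 by lra.
have cmid a : ringj (c (clip 2^-1)) a = M a.
  by rewrite c_ring clipK// /F lexx mulfV// addr0 segment1.
have cxE t a : cx (ringj (c t) a) = (1 - Ival t) * cx (S0 a) + Ival t * cx (S1 a).
  by rewrite c_ring F_cx//; exact: Ival_itv.
exists c, (clip 2^-1); split; last 2 first.
- by rewrite !cmid M_planes.
- by move=> a; rewrite cmid; exact: M_profile.
- split.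
  + apply: to_ordered_cts => [t|a]; first exact: F_valid.
    exact: (comp_cts (@Ival_continuous R) (@F_cts a)).
  + apply: ringj_inj => j; rewrite c_ring Ival0 /F invr_ge0 ler0n mulr0 addr0 segment0.
    by rewrite /S0 -base_standard /ringj set_valE /= mxE.
  + have c1 a : ringj (c one) a = base_ring R (tperm l r a).
      rewrite c_ring Ival1 /F leNgt invf_lt1 ?ltr0n// ltr1n /= mulr1.
      rewrite (_ : 2 - 1 = 1); last by lra.
      by rewrite segment1 /S1 /standard /arrange /swapped index_map_perm tpermV.
    by rewrite !c1 tpermL tpermR.
  + move=> j t jl jr; have /andP[t0 t1] := Ival_itv t.
    have tj : tperm l r j = j by rewrite tpermD// eq_sym.
    have bx : cx (base_ring R j) = 4 * j%:R + 4 by rewrite /cx /= natrM -natr1; lra.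
    have jn : j%:R + 1 <= l%:R :> R \/ l%:R + 2 <= j%:R :> R.
      have [h|h] : (j < l)%N \/ (l.+2 <= j)%N.
        have jl' : nat_of_ord j <> nat_of_ord l by move=> e; case/eqP: jl; exact: val_inj.
        have jr' : nat_of_ord j <> (nat_of_ord l).+1 by move=> e; case/eqP: jr; exact: val_inj.
        by clear -jl' jr'; lia.
      - by left; rewrite natr1 ler_nat.
      - by right; rewrite -natrD ler_nat addn2.
    split.
    * rewrite c_ring.
      have S1j : S1 j = base_ring R j.
        by rewrite /S1 /standard /arrange /swapped index_map_perm tpermV tj.
      have S0j : S0 j = base_ring R j by rewrite /S0 -base_standard.
      have Mj : M j = base_ring R j.
        have [y z s] := M_profile j; have [y' z' s'] := f_out jl jr.
        have x : cx (M j) = cx (base_ring R j) by rewrite M_cx S1j S0j; lra.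
        move: x y z s; rewrite y' z' s'.
        by case: (M j) => [[[x y] z] s]; rewrite /cx /cy /cz /radius /= => -> -> -> ->.
      have segj (P Q : 'I_n -> ring) s : P j = base_ring R j -> Q j = base_ring R j ->
          segment P Q s j = base_ring R j.
        move=> e1 e2; rewrite /segment /mixc e1 e2.
        exact: (congr1 (fun g => g j) (mixcc (base_ring R (n := n)) (weights2 s))).
      by rewrite /F; case: ifP => _; exact: segj.
    (* The moving plane stays between two adjacent planes of the base configuration, outside which
       [jn] places the ring [j]. *)
    * rewrite cxE S1E tpermL !S0E rE bx => e.
      by case: jn => jn; nra.
    * rewrite cxE S1E tpermR !S0E rE bx => e.
      by case: jn => jn; nra.
  + move=> t; rewrite !cxE !S1E tpermL tpermR !S0E rE; split=> [e|->].
      by rewrite -(IvalK t); congr clip; nra.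
    by rewrite clipK//; lra.
- move=> t; rewrite -[LHS]/(arc_cat_fun (edge_arc v0) (edge_arc v1) (Ival t)).
  by rewrite /arc_cat_fun /c /F /=; case: ifP.
Qed.

End standard_exchange.

(** * The evaluation inverts the map from the presented group *)

Section generators.
Variables (R : realType) (n : nat).
Local Notation Y := (UR R n).
Local Notation G := (UR_presented n.-1).
Implicit Types (i : 'I_n.-1).

Let eval : UR_group R n -> G := evaluation (@monodromy_cocycle R n) (y0 := UR_base R n).

Let exchange_eval i (p : {path unit_interval R from UR_base R n to UR_base R n in Y}) c t0 :
  exchange i c t0 -> (forall t, p t = unordered (c t)) ->
  eval (loop_class p) =
  letter (psigma i) (prho i) (kind_of (ringj (c t0) (left_ring i)) (ringj (c t0) (right_ring i))).
Proof.
move=> ex pc; apply: evaluationE.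
rewrite (_ : _ \o _ = fun s => unordered (c (clip s))); last by apply/funext => s; exact: pc.
exact: exchange_holonomy.
Qed.

Lemma rho_loop_eval i p : rho_loop i p -> eval (loop_class p) = prho i.
Proof.
move=> [c [t0 [ex pc nst]]]; rewrite (exchange_eval ex pc).
have [_ _ _ _ /(_ t0) [_ /(_ erefl) e]] := ex.
have [r0 _] := valid_ringj (c t0).
by rewrite /kind_of (nested_nest (r0 _) (r0 _) e).1.
Qed.

Lemma sigma_loop_eval i p : sigma_loop i p -> eval (loop_class p) = psigma i.
Proof.
move=> [c [t0 [ex pc [n1 n2 _]]]]; rewrite (exchange_eval ex pc).
have [_ _ _ _ /(_ t0) [_ /(_ erefl) e]] := ex.
have [r0 _] := valid_ringj (c t0).
rewrite /kind_of; case: ifPn => [h|_].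
  by case: n1; apply/(nested_nest (r0 _) (r0 _) e).
by case: ifPn => // h; case: n2; apply/(nested_nest (r0 _) (r0 _) (esym e)).
Qed.

(** Realizes the class of the straight exchange by a loop of the required form, so that
    [rho_loop_eval] gives its value. *)
Lemma rho_class_loop i : exists2 p, rho_loop i p & loop_class p = rho_class R i.
Proof.
have f0 := @rho_profile_gt0 R n i; have nst := rho_profile_nest R i.
have ff : free_pairs (rho_profile R i) (left_ring i) (right_ring i).
  by apply/asboolP; exists Inside.
have fo a : a != left_ring i -> a != right_ring i -> [/\ cy (rho_profile R i a) = 0,
    cz (rho_profile R i a) = 0 & radius (rho_profile R i a) = 1].
  by move=> al _; rewrite /rho_profile (negPf al).
exists (swap_loop f0 ff); last exact: swap_loop_class.
have [c [t0 [ex pc e prof]]] := swap_loop_exchange f0 ff fo.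
exists c, t0; split=> //; have [r0 _] := valid_ringj (c t0).
apply/(nested_nest (r0 _) (r0 _) e).
have [y1 z1 s1] := prof (left_ring i); have [y2 z2 s2] := prof (right_ring i).
by move: nst; rewrite /nest y1 z1 s1 y2 z2 s2.
Qed.

Lemma sigma_class_loop i : exists2 p, sigma_loop i p & loop_class p = sigma_class R i.
Proof.
have f0 := @sigma_profile_gt0 R n i; have ap := sigma_profile_apart R i.
have ff : free_pairs (sigma_profile R i) (left_ring i) (right_ring i).
  by apply/asboolP; exists (Apart 1 0).
have fo a : a != left_ring i -> a != right_ring i -> [/\ cy (sigma_profile R i a) = 0,
    cz (sigma_profile R i a) = 0 & radius (sigma_profile R i a) = 1].
  by move=> al _; rewrite /sigma_profile (negPf al).
exists (swap_loop f0 ff); last exact: swap_loop_class.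
have [c [t0 [ex pc e prof]]] := swap_loop_exchange f0 ff fo.
exists c, t0; split=> //; have [r0 _] := valid_ringj (c t0).
have n1 := apart_nest (f0 _) ap; have n2 := apart_nest (f0 _) (apart_opp ap).
have [y1 z1 s1] := prof (left_ring i); have [y2 z2 s2] := prof (right_ring i).
split.
- move=> /(nested_nest (r0 _) (r0 _) e); rewrite /nest y1 z1 s1 y2 z2 s2.
  by rewrite -[_ && _]/(nest _ _) n1.
- move=> /(nested_nest (r0 _) (r0 _) (esym e)); rewrite /nest y1 z1 s1 y2 z2 s2.
  by rewrite -[_ && _]/(nest _ _) n2.
- rewrite y1 y2 /sigma_profile eqxx eq_sym (negPf (left_right_neq i)) /cy /=; lra.
Qed.

Local Notation gen := (UR_generator (@sigma_class R n) (@rho_class R n)).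

(** The evaluation is a morphism with the right values on generators, hence a left inverse of the
    map from the presented group. *)
Lemma eval_word w : eval (word_val gen w) = word_class (@UR_rel n.-1) w.
Proof.
rewrite word_val_morph; last exact: evaluationM.
rewrite -word_val_class; congr word_val; apply/funext => -[i|i] /=.
- by have [p sp <-] := sigma_class_loop i; exact: sigma_loop_eval.
- by have [p sp <-] := rho_class_loop i; exact: rho_loop_eval.
Qed.

Lemma word_val_class_eq u v : word_val gen u = word_val gen v <-> word_eq (@UR_rel n.-1) u v.
Proof.
split=> [e|]; last by apply: word_val_eq; exact: UR_relations_hold.
by apply/word_classP; rewrite -!eval_word e.
Qed.

Lemma eval_inj : injective eval.
Proof.
move=> a b; have [u <-] := all_generated a; have [v <-] := all_generated b.
by rewrite !eval_word => /word_classP /word_val_class_eq.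
Qed.

End generators.

Theorem proposition3p3 (R : realType) (n : nat) (hn : (1 <= n)%N) :
  exists sigma rho : 'I_n.-1 -> UR_group R n,
    [/\ (forall i a, (exists2 p, sigma_loop i p & loop_class p = a) <-> a = sigma i),
        (forall i a, (exists2 p, rho_loop i p & loop_class p = a) <-> a = rho i) &
        has_presentation
          (fun s : generator n.-1 =>
             match s with Sigma i => sigma i | Rho i => rho i end)
          (@UR_rel n.-1)].
Proof.
exists (@sigma_class R n), (@rho_class R n); split.
- move=> i a; have [q sq eq] := sigma_class_loop R i; split=> [[p sp <-]|->]; last by exists q.
  (* Loops of the same type have the same value under the injective evaluation, hence the same
     class. *)
  by rewrite -eq; apply: eval_inj; rewrite (sigma_loop_eval sp) (sigma_loop_eval sq).
- move=> i a; have [q rq eq] := rho_class_loop R i; split=> [[p rp <-]|->]; last by exists q.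
  by rewrite -eq; apply: eval_inj; rewrite (rho_loop_eval rp) (rho_loop_eval rq).
- by split; [exact: all_generated|exact: word_val_class_eq].
Qed.
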